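(* (a) Let $\mu,\nu\in\mathbb{C}$. For $i\in\{1,2\}$ and all $j\in\mathbb{Z}$, and, when $\mu$ is a positive odd integer, also for $i\in\{3,4\}$ and all $j\in\mathbb{Z}$, one has $\mathcal{D}_{\mu,\nu}\Lambda_{i,j}^{\mu,\nu}=\lambda_j^{\mu,\nu}\Lambda_{i,j}^{\mu,\nu}$ on $\mathbb{R}_+$. (b) If $\mu$ is a positive odd integer and $\nu>0$ is real with $\mu-\nu\notin2\mathbb{Z}$, then for every fixed $j\in\mathbb{N}_0$ the four functions $\Lambda_{1,j}^{\mu,\nu},\Lambda_{2,j}^{\mu,\nu},\Lambda_{3,j}^{\mu,\nu},\Lambda_{4,j}^{\mu,\nu}$ are linearly independent and form a fundamental system of solutions of $\mathcal{D}_{\mu,\nu}u=\lambda_j^{\mu,\nu}u$ on $\mathbb{R}_+$.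
   Context: $\theta=x\frac{d}{dx}$; $\mathcal{D}_{\mu,\nu}=\frac{1}{x^2}\big((\theta+\nu)(\theta+\mu+\nu)-x^2\big)\big(\theta(\theta+\mu)-x^2\big)-\frac{(\mu-\nu)(\mu+\nu+2)}{2}$ (products = composition). $\lambda_j^{\mu,\nu}=(2j+\mu+1)^2-\frac{(\mu+1)^2}{2}-\frac{(\nu+1)^2}{2}$. Normalized modified Bessel functions: $\widetilde I_\alpha(z)=(z/2)^{-\alpha}I_\alpha(z)$, $\widetilde K_\alpha(z)=(z/2)^{-\alpha}K_\alpha(z)$. For $x>0$ and $t$ near $0$ (principal branch of $(1-t)^{-s}$): $G_1^{\mu,\nu}=(1-t)^{-\frac{\mu+\nu+2}{2}}\widetilde I_{\mu/2}(\tfrac{tx}{1-t})\widetilde I_{\nu/2}(\tfrac{x}{1-t})$, $G_2^{\mu,\nu}=(1-t)^{-\frac{\mu+\nu+2}{2}}\widetilde I_{\mu/2}(\tfrac{tx}{1-t})\widetilde K_{\nu/2}(\tfrac{x}{1-t})$, $G_3^{\mu,\nu}=(1-t)^{-\frac{\mu+\nu+2}{2}}\widetilde K_{\mu/2}(\tfrac{tx}{1-t})\widetilde I_{\nu/2}(\tfrac{x}{1-t})$, $G_4^{\mu,\nu}=(1-t)^{-\frac{\mu+\nu+2}{2}}\widetilde K_{\mu/2}(\tfrac{tx}{1-t})\widetilde K_{\nu/2}(\tfrac{x}{1-t})$; $\Lambda_{i,j}^{\mu,\nu}(x)$ are the coefficients of the Taylor ($i=1,2$) resp. Laurent ($i=3,4$,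 $\mu$ odd integer) expansion $G_i^{\mu,\nu}(t,x)=\sum_{j\in\mathbb{Z}}t^j\Lambda_{i,j}^{\mu,\nu}(x)$. *)

(* Defs.v *)
From HB Require Import structures.
From mathcomp Require Import all_boot all_order all_algebra.
From mathcomp Require Import all_classical all_reals all_analysis.
From mathcomp Require Import complex.
Import Order.TTheory GRing.Theory Num.Theory.
Import numFieldNormedType.Exports.

Set Implicit Arguments.
Unset Strict Implicit.
Unset Printing Implicit Defensive.

Local Open Scope ring_scope.
Local Open Scope complex_scope.
Local Open Scope classical_set_scope.

(* R[i] gets the (metric) topology of its complex modulus, i.e. the usual
   topology of the complex plane (it is the one of the numFieldType R[i]). *)
HB.instance Definition _ (R : realType) :=
  PseudoPointedMetric.copy R[i] R[i]^o.

Section Defs.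
Variable R : realType.
Local Notation C := R[i].

Definition csum (u : nat -> C) : C :=
  lim ((fun N => \sum_(0 <= k < N) u k) @ \oo).

Definition cabs (z : C) : R := Num.sqrt (complex.Re z ^+ 2 + complex.Im z ^+ 2).

Definition cexp (z : C) : C :=
  (expR (complex.Re z))%:C * ((cos (complex.Im z)) +i* (sin (complex.Im z))).

(* principal argument, with values in (-pi, pi] *)
Definition carg (z : C) : R :=
  let x := complex.Re z in let y := complex.Im z in
  if 0 < x then atan (y / x)
  else if x < 0 then (if 0 <= y then atan (y / x) + pi else atan (y / x) - pi)
  else (if 0 < y then pi / 2 else if y < 0 then - (pi / 2) else 0).

Definition cLog (z : C) : C := (ln (cabs z)) +i* (carg z).

Definition cpow (w s : C) : C := cexp (s * cLog w).

Definition csin (w : C) : C := (cexp ('i * w) - cexp (- ('i * w))) / (2%:R * 'i).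

(* reciprocal Gamma function 1/Gamma(s) (entire; = 0 at s = 0,-1,-2,...),
   by the Euler--Gauss limit formula
   1/Gamma(s) = lim_n s(s+1)...(s+n) / (n! n^s). *)
Definition rgamma (s : C) : C :=
  lim ((fun n : nat => (\prod_(0 <= k < n.+1) (s + k%:R)) /
                       (n`!%:R * cpow n%:R s)) @ \oo).

Definition besselI (a z : C) : C :=
  cpow (z / 2%:R) a *
  csum (fun k => (z / 2%:R) ^+ (2 * k) * rgamma (a + k%:R + 1) / k`!%:R).

Definition besselK_nonint (a z : C) : C :=
  (pi%:C / 2%:R) * (besselI (- a) z - besselI a z) / csin (a * pi%:C).

Definition besselK (a z : C) : C :=
  if `[< exists n : int, a = n%:~R >]
  then lim (besselK_nonint^~ z @ a^')
  else besselK_nonint a z.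

Definition Itil (a z : C) : C := cpow (z / 2%:R) (- a) * besselI a z.
Definition Ktil (a z : C) : C := cpow (z / 2%:R) (- a) * besselK a z.

Definition Gpref (mu nu t : C) : C :=
  cpow (1 - t) (- ((mu + nu + 2%:R) / 2%:R)).

Definition G (i : nat) (mu nu t : C) (x : R) : C :=
  let z1 := t * x%:C / (1 - t) in
  let z2 := x%:C / (1 - t) in
  match i with
  | 1 => Gpref mu nu t * Itil (mu / 2%:R) z1 * Itil (nu / 2%:R) z2
  | 2 => Gpref mu nu t * Itil (mu / 2%:R) z1 * Ktil (nu / 2%:R) z2
  | 3 => Gpref mu nu t * Ktil (mu / 2%:R) z1 * Itil (nu / 2%:R) z2
  | 4 => Gpref mu nu t * Ktil (mu / 2%:R) z1 * Ktil (nu / 2%:R) z2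
  | _ => 0
  end.

(* c is the coefficient sequence of a Laurent expansion of F around t = 0:
   F t = sum_{n in Z} c n t^n on a punctured disc 0 < |t| < r
   (both the part n >= 0 and the part n < 0 converge). A Taylor expansion
   is the special case where c n = 0 for n < 0. *)
Definition is_laurent_expansion (F : C -> C) (c : int -> C) : Prop :=
  exists r : R, 0 < r /\
    forall t : C, t != 0 -> cabs t < r ->
      exists a b : C,
        (fun N => \sum_(0 <= n < N) c (n%:Z) * t ^+ n) @ \oo --> a /\
        (fun N => \sum_(1 <= n < N) c (- (n%:Z)) * t ^- n) @ \oo --> b /\
        F t = a + b.

Definition laurent_coef (F : C -> C) : int -> C :=
  xget (fun _ => 0) (is_laurent_expansion F).

Definition Lambda (i : nat) (mu nu : C) (j : int) (x : R) : C :=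
  laurent_coef (fun t => G i mu nu t x) j.

Definition cderivable (f : R -> C) (x : R) : Prop :=
  cvg ((fun h : R => (h^-1)%:C * (f (x + h) - f x)) @ 0^').

Definition cderiv (f : R -> C) (x : R) : C :=
  lim ((fun h : R => (h^-1)%:C * (f (x + h) - f x)) @ 0^').

Definition theta (f : R -> C) : R -> C := fun x => x%:C * cderiv f x.
Definition thetaS (a : C) (f : R -> C) : R -> C := fun x => theta f x + a * f x.

Definition Dop (mu nu : C) (u : R -> C) : R -> C :=
  let A := fun y => theta (thetaS mu u) y - (y ^+ 2)%:C * u y in
  fun x => (x ^- 2)%:C * (thetaS nu (thetaS (mu + nu) A) x - (x ^+ 2)%:C * A x)
           - ((mu - nu) * (mu + nu + 2%:R) / 2%:R) * u x.

Definition lambda (mu nu : C) (j : int) : C :=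
  (2%:R * j%:~R + mu + 1) ^+ 2 - (mu + 1) ^+ 2 / 2%:R - (nu + 1) ^+ 2 / 2%:R.

Definition cderivable4 (u : R -> C) : Prop :=
  forall k : nat, (k < 4)%N -> forall x : R, 0 < x -> cderivable (iter k cderiv u) x.

Definition is_solution (mu nu lam : C) (u : R -> C) : Prop :=
  cderivable4 u /\ forall x : R, 0 < x -> Dop mu nu u x = lam * u x.

Definition fundamental_system (mu nu lam : C) (f : nat -> R -> C) : Prop :=
  (forall i : nat, (1 <= i <= 4)%N -> is_solution mu nu lam (f i)) /\
  (forall a : nat -> C,
      (forall x : R, 0 < x -> \sum_(1 <= i < 5) a i * f i x = 0) ->
      forall i : nat, (1 <= i <= 4)%N -> a i = 0) /\
  (forall u : R -> C, is_solution mu nu lam u ->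
      exists a : nat -> C, forall x : R, 0 < x ->
        u x = \sum_(1 <= i < 5) a i * f i x).

End Defs.

(* Main.v *)
(* Expand each factor of G_i at t = 0 for fixed x > 0. Since F(x / (1 - t)) =
   sum_n phi_n(x) t^n satisfies x d/dx = (1 - t) d/dt, the coefficients obey
   theta phi_n = (n + 1) phi_(n+1) - n phi_n, and the Bessel equation of F reads
   (theta^2 + nu theta) phi = x^2 phi / (1 - t)^2. The other factor is a power
   series (for K of half-odd order a sum of two Frobenius series) in
   z = t x / (1 - t), so Lambda_(i,j) is the finite sum over m of
   h_m x^(m - N) [t^(j + N - m)] (1 - t)^(-(m - N + (mu + nu + 2)/2)) F(x / (1 - t)),
   with N = 0 or mu.
   In terms of four such sums (with or without theta acting on each factor) and
   of the shift in j, the identity D Lambda_j = lambda_j Lambda_j becomes a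
   linear identity with polynomial coefficients. Uniqueness of Laurent
   coefficients, which identifies these sums with Lambda, follows by averaging
   over roots of unity.

   For integer order, K is handled through the derivative of 1/Gamma at the
   integers, obtained from the Gauss product.

   For (b), Lambda_(1,j), ..., Lambda_(4,j) are equivalent at 0+ to nonzero
   multiples of x^0, x^(-nu), x^(-mu), x^(-mu-nu), hence independent; a solution
   with zero Cauchy data at x = 1 vanishes by a Gronwall estimate, so the
   solution space has dimension at most 4. *)
Require Import Defs.
From HB Require Import structures.
From mathcomp Require Import all_boot all_order all_algebra.
From mathcomp Require Import all_classical all_reals all_analysis.
From mathcomp Require Import complex ring lra zify.
Import Order.TTheory GRing.Theory Num.Theory.
Import numFieldNormedType.Exports.
Local Open Scope ring_scope.
Local Open Scope complex_scope.
Local Open Scope classical_set_scope.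
Set Implicit Arguments.
Unset Strict Implicit.
Unset Printing Implicit Defensive.

(** * Limits and absolutely convergent series of complex numbers *)

Section ComplexLimits.
Variable R : realType.
Local Notation C := R[i].
Implicit Types (z w : C) (x : R).

(** The obstacle is differentiability of Lambda_(i,j) in x: Laurent coefficients are chosen
    separately for each x, and no Cauchy integral is at hand. Finite sums of explicit functions can
    be differentiated directly. The relation between theta phi_n, phi_n and phi_(n+1) determines the
    whole sequence from phi_0. Hence Bessel's equation for all coefficients, and any equality of two
    expansions, need only be checked at n = 0, where the argument is x itself. Multiplication by 1 -
    t links sums whose exponents of 1 - t differ by one, so the factor (1 - t)^(-2) in Bessel's
    equation never leaves the four families of sums. In (b), mu - nu outside 2Z serves twice: it
    gives mu different from nu, hence four distinct exponents at 0, and it keeps the leading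
    constants, multiples of (b)_n / n!, from vanishing, because 2 b differs from mu - nu or nu - mu
    by an even integer. Even nu is allowed, so the logarithmic K of integer order is needed for the
    asymptotics as well. *)

Lemma cabsE z : `|z| = (cabs z)%:C :> C.
Proof. by rewrite normc_def. Qed.

Lemma cabs_ge0 z : 0 <= cabs z.
Proof. exact: sqrtr_ge0. Qed.

Lemma cabs0 : cabs (0 : C) = 0.
Proof. by rewrite /cabs /= expr0n /= addr0 sqrtr0. Qed.

Lemma cabsM z w : cabs (z * w) = cabs z * cabs w.
Proof. by apply: (@complexI R); rewrite rmorphM /= -!cabsE normrM. Qed.

Lemma cabsN z : cabs (- z) = cabs z.
Proof. by apply: (@complexI R); rewrite -!cabsE normrN. Qed.

Lemma cabsD z w : cabs (z + w) <= cabs z + cabs w.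
Proof. by rewrite -lecR rmorphD /= -!cabsE ler_normD. Qed.

Lemma cabsB z w : cabs (z - w) = cabs (w - z).
Proof. by rewrite -cabsN opprB. Qed.

Lemma cabsR x : cabs x%:C = `|x|.
Proof. by rewrite /cabs /= expr0n /= addr0 sqrtr_sqr. Qed.

Lemma cabs1 : cabs (1 : C) = 1.
Proof. by rewrite -[1]/((1:R)%:C) cabsR normr1. Qed.

Lemma cabs_eq0 z : (cabs z == 0) = (z == 0).
Proof. by rewrite -(normr_eq0 z) cabsE -(inj_eq (@complexI R)). Qed.

Lemma cabs_gt0 z : (0 < cabs z) = (z != 0).
Proof. by rewrite lt0r cabs_ge0 andbT cabs_eq0. Qed.

Lemma cabsV z : cabs z^-1 = (cabs z)^-1.
Proof. by apply: (@complexI R); rewrite fmorphV /= -!cabsE normfV. Qed.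

Lemma cabsX z n : cabs (z ^+ n) = cabs z ^+ n.
Proof. by apply: (@complexI R); rewrite rmorphXn /= -!cabsE normrX. Qed.

Lemma cabs_sum (I : Type) (r : seq I) (P : pred I) (u : I -> C) :
  cabs (\sum_(i <- r | P i) u i) <= \sum_(i <- r | P i) cabs (u i).
Proof.
elim/big_ind2 : _ => //; first by rewrite cabs0.
by move=> a b c d h1 h2; rewrite (le_trans (cabsD _ _))// lerD.
Qed.

Lemma cabs_nat n : cabs (n%:R : C) = n%:R.
Proof. by rewrite -(rmorph_nat (real_complex R)) cabsR normr_nat. Qed.

Lemma cabs_Re z : `|complex.Re z| <= cabs z.
Proof.
by rewrite /cabs -[leLHS]sqrtr_sqr ler_wsqrtr// lerDl sqr_ge0.
Qed.

Lemma cabs_Im z : `|complex.Im z| <= cabs z.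
Proof.
by rewrite /cabs -[leLHS]sqrtr_sqr ler_wsqrtr// lerDr sqr_ge0.
Qed.

Lemma cabs_ReIm z : cabs z <= `|complex.Re z| + `|complex.Im z|.
Proof.
rewrite {1}(complexE z) (le_trans (cabsD _ _))// cabsM !cabsR.
have -> : cabs ('i%C : C) = 1 by rewrite /cabs /= expr0n expr1n add0r sqrtr1.
by rewrite mul1r.
Qed.

Lemma cabs_subr z w : cabs z - cabs w <= cabs (z - w).
Proof. by rewrite lerBlDr (le_trans _ (cabsD _ _))// subrK. Qed.

(** A positive element of the ordered field [R[i]] is real, so its metric can be tested with real
    epsilons. *)
Lemma cvgCP {T : Type} (F : set_system T) {FF : Filter F} (f : T -> C) (l : C) :
  f @ F --> l <-> (forall e : R, 0 < e -> \forall y \near F, cabs (f y - l) < e).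
Proof.
split => [/(@cvgrPdist_lt _ (R[i]^o) _ _ FF) h e e0|h].
  have := h e%:C; rewrite ltcR => /(_ e0).
  by apply: filterS => y; rewrite cabsE ltcR cabsB.
apply/(@cvgrPdist_lt _ (R[i]^o) _ _ FF) => e e0.
have e1 : e = (complex.Re e)%:C by rewrite RRe_real// gtr0_real.
rewrite e1; move: e0; rewrite e1 ltcR => /h.
by apply: filterS => y; rewrite cabsE ltcR cabsB.
Qed.

Lemma cvgC_cabs {T : Type} (F : set_system T) {FF : Filter F} (f : T -> C) (l : C) :
  f @ F --> l <-> (fun y => cabs (f y - l)) @ F --> (0 : R).
Proof.
rewrite cvgCP; split.
  move=> h; apply/cvgrPdist_lt => e /h; apply: filterS => y.
  by rewrite sub0r normrN ger0_norm ?cabs_ge0.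
move/cvgrPdist_lt => h e /h; apply: filterS => y.
by rewrite sub0r normrN ger0_norm ?cabs_ge0.
Qed.

Lemma cvgC_lim {T : Type} (F : set_system T) {FF : ProperFilter F} (f : T -> C) (l : C) :
  f @ F --> l -> lim (f @ F) = l.
Proof. by move=> h; apply: (@cvg_lim R[i]^o (@norm_hausdorff _ _)) h. Qed.

Lemma cvgC_unique {T : Type} (F : set_system T) {FF : ProperFilter F} (f : T -> C) (l l' : C) :
  f @ F --> l -> f @ F --> l' -> l = l'.
Proof. by move=> /cvgC_lim <- /cvgC_lim <-. Qed.

Section algebra.
Context {T : Type} (F : set_system T) {FF : Filter F}.
Implicit Types (f g : T -> C) (a b : C).

Lemma cvgC_cst a : (fun _ : T => a) @ F --> a.
Proof. exact: (@cvg_cst (R[i]^o)). Qed.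

Arguments cvgC_cst : clear implicits.
Lemma cvgCD f g a b : f @ F --> a -> g @ F --> b -> (fun y => f y + g y) @ F --> a + b.
Proof. exact: (@cvgD _ (R[i]^o)). Qed.

Lemma cvgCN f a : f @ F --> a -> (fun y => - f y) @ F --> - a.
Proof. exact: (@cvgN _ (R[i]^o)). Qed.

Lemma cvgCB f g a b : f @ F --> a -> g @ F --> b -> (fun y => f y - g y) @ F --> a - b.
Proof. by move=> h /cvgCN; exact: cvgCD. Qed.

Lemma cvgCM f g a b : f @ F --> a -> g @ F --> b -> (fun y => f y * g y) @ F --> a * b.
Proof. exact: (@cvgM (R[i])). Qed.

Lemma cvgCV f a : a != 0 -> f @ F --> a -> (fun y => (f y)^-1) @ F --> a^-1.
Proof. by move=> a0 h; apply: (@cvgV (R[i])). Qed.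

Lemma cvgC_sum (I : Type) (r : seq I) (f : I -> T -> C) (a : I -> C) :
  (forall i, f i @ F --> a i) -> (fun y => \sum_(i <- r) f i y) @ F --> \sum_(i <- r) a i.
Proof.
move=> h; elim: r => [|i r IH].
  by under eq_fun do rewrite big_nil; rewrite big_nil; exact: cvgC_cst.
under eq_fun do rewrite big_cons; rewrite big_cons.
exact: (cvgCD (h i) IH).
Qed.

Lemma cvgC_near f g a : (\forall y \near F, f y = g y) -> f @ F --> a -> g @ F --> a.
Proof.
move=> h /cvgCP H; apply/cvgCP => e /H; apply: filterS2 h => y -> //.
Qed.

Lemma cvgCR (f : T -> R) (a : R) : f @ F --> a -> (fun y => (f y)%:C) @ F --> a%:C.
Proof.
move=> /cvgrPdist_lt h; apply/cvgCP => e /h; apply: filterS => y.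
by rewrite -rmorphB cabsR distrC.
Qed.

Lemma cvgC_ReIm f a : (fun y => complex.Re (f y)) @ F --> complex.Re a ->
  (fun y => complex.Im (f y)) @ F --> complex.Im a -> f @ F --> a.
Proof.
move=> /cvgrPdist_lt h1 /cvgrPdist_lt h2; apply/cvgCP => e e0.
have e2 : 0 < e / 2 by rewrite divr_gt0.
have := h1 _ e2; apply: filterS2 (h2 _ e2) => y.
rewrite distrC => i2; rewrite distrC => i1.
rewrite (le_lt_trans (cabs_ReIm _))// [ltRHS](splitr e).
by move: i1 i2; case: (f y) => ? ?; case: (a) => ? ? /= i1 i2; rewrite ltrD.
Qed.

Lemma cvgC_Re f a : f @ F --> a -> (fun y => complex.Re (f y)) @ F --> complex.Re a.
Proof.
move=> /cvgCP h; apply/cvgrPdist_lt => e /h; apply: filterS => y.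
apply: le_lt_trans; rewrite distrC; have := cabs_Re (f y - a).
by case: (f y) (a) => ? ? [].
Qed.

Lemma cvgC_Im f a : f @ F --> a -> (fun y => complex.Im (f y)) @ F --> complex.Im a.
Proof.
move=> /cvgCP h; apply/cvgrPdist_lt => e /h; apply: filterS => y.
apply: le_lt_trans; rewrite distrC; have := cabs_Im (f y - a).
by case: (f y) (a) => ? ? [].
Qed.

End algebra.

Lemma cvgC_cabs_le {T : Type} (F : set_system T) {FF : ProperFilter F} (f : T -> C) a (M : R) :
  f @ F --> a -> (\forall y \near F, cabs (f y) <= M) -> cabs a <= M.
Proof.
move=> /cvgCP h H; rewrite leNgt; apply/negP => Ma.
have e0 : 0 < cabs a - M by rewrite subr_gt0.
have [y [h1 h2]] := filter_ex (filterI (h _ e0) H).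
have := cabs_subr a (f y); rewrite cabsB.
by lra.
Qed.

End ComplexLimits.
Arguments cvgC_cst {R T F FF} a.

Section AbsoluteSeries.
Variable R : realType.
Local Notation C := R[i].
Implicit Types (z w : C) (x : R) (u v : nat -> C).

Definition hassum u (l : C) := (fun N => \sum_(0 <= k < N) u k) @ \oo --> l.
Definition absbnd u (M : R) := forall N, \sum_(0 <= k < N) cabs (u k) <= M.

Lemma hassum_csum u l : hassum u l -> csum u = l.
Proof. exact: cvgC_lim. Qed.

Lemma hassum_unique u l l' : hassum u l -> hassum u l' -> l = l'.
Proof. exact: cvgC_unique. Qed.

Lemma psumS (V : nmodType) (v : nat -> V) N :
  \sum_(0 <= k < N.+1) v k = \sum_(0 <= k < N) v k + v N.
Proof. by rewrite big_nat_recr. Qed.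

Lemma psumSl (V : nmodType) (v : nat -> V) N :
  \sum_(0 <= k < N.+1) v k = v 0%N + \sum_(0 <= k < N) v k.+1.
Proof. by rewrite big_nat_recl. Qed.

Lemma diag_sum (V : nmodType) (a : nat -> nat -> V) N :
  \sum_(0 <= J < N) \sum_(0 <= k < J.+1) a k (J - k)%N =
  \sum_(0 <= k < N) \sum_(0 <= n < N - k) a k n.
Proof.
elim: N => [|N IH]; first by rewrite !big_geq.
rewrite psumS IH [RHS]psumS subSnn big_nat1.
rewrite [X in _ + X]psumS subnn addrA; congr (_ + _).
rewrite -big_split/=; apply: eq_big_nat => k /andP[_ kN].
by rewrite (subSn (ltnW kN)) psumS.
Qed.

Lemma psum_le (M : nat -> R) m n : (forall k, 0 <= M k) -> (m <= n)%N ->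
  \sum_(0 <= k < m) M k <= \sum_(0 <= k < n) M k.
Proof.
move=> M0 mn; rewrite (big_cat_nat (leq0n m) mn)//= lerDl sumr_ge0//.
Qed.

Lemma bnd_tail (M : nat -> R) (B : R) : (forall k, 0 <= M k) ->
  (forall N, \sum_(0 <= k < N) M k <= B) ->
  forall e, 0 < e -> exists K, forall N, \sum_(K <= k < N) M k <= e.
Proof.
move=> M0 MB e e0.
have nd : nondecreasing_seq (fun N => \sum_(0 <= k < N) M k).
  by move=> m n mn; exact: psum_le.
have /cvg_ex [l /= hl] : cvgn (fun N => \sum_(0 <= k < N) M k).
  by apply: nondecreasing_is_cvgn => //; exists B => _ [N _ <-].
have le_l N : \sum_(0 <= k < N) M k <= l.
  have -> : l = limn (fun N => \sum_(0 <= k < N) M k) by rewrite (cvg_lim _ hl).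
  by apply: nondecreasing_cvgn_le => //; apply/cvg_ex; exists l.
have /cvgrPdist_lt /(_ _ e0) := hl; move=> [K _ hK].
exists K => N; have := hK K (leqnn K); rewrite ger0_norm ?subr_ge0//= => h.
have [KN|NK] := leqP K N; last by rewrite big_geq ?ltW// ltnW.
have := le_l N; rewrite (big_cat_nat (leq0n K) KN)//=; lra.
Qed.

Lemma absbnd_hassum u M : absbnd u M -> hassum u (csum u).
Proof.
move=> h.
suff [l hl] : exists l, hassum u l by rewrite (hassum_csum hl).
have aux (v : nat -> R) : (forall k, `|v k| <= cabs (u k)) ->
    cvgn (fun N => \sum_(0 <= k < N) v k).
  move=> hv; apply: (@normed_cvg _ (R : completeNormedModType R) v).
  apply: nondecreasing_is_cvgn.
    by move=> m n mn; apply: (@psum_le (fun k => `|v k|)).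
  exists M => _ [N _ <-]; apply: le_trans (h N).
  by apply: (@ler_sum _ _ _ _ (fun k => `|v k|)) => k _.
have /cvg_ex[a ha] := aux _ (fun k => cabs_Re (u k)).
have /cvg_ex[b hb] := aux _ (fun k => cabs_Im (u k)).
exists (a +i* b); apply: cvgC_ReIm => /=.
  apply: cvg_trans ha; apply: near_eq_cvg; near=> N => /=.
  by elim/big_ind2 : _ => //= [[? ?] ? [? ?] ? /= -> ->].
apply: cvg_trans hb; apply: near_eq_cvg; near=> N => /=.
by elim/big_ind2 : _ => //= [[? ?] ? [? ?] ? /= -> ->].
Unshelve. all: by end_near. Qed.

Lemma absbnd_le u M : absbnd u M -> cabs (csum u) <= M.
Proof.
move=> h; apply: (cvgC_cabs_le (absbnd_hassum h)).
by near=> N; rewrite (le_trans (cabs_sum _ _ _))// ; exact: h.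
Unshelve. all: by end_near. Qed.

Lemma absbnd_mono u (M : nat -> R) B : (forall k, cabs (u k) <= M k) ->
  (forall N, \sum_(0 <= k < N) M k <= B) -> absbnd u B.
Proof. by move=> h hB N; apply: le_trans (hB N); apply: ler_sum => k _. Qed.

Lemma hassum_tail u l K e : hassum u l ->
  (forall N, \sum_(K <= k < N) cabs (u k) <= e) ->
  cabs (l - \sum_(0 <= k < K) u k) <= e.
Proof.
move=> h he.
have h' : (fun N => \sum_(0 <= k < N) u k - \sum_(0 <= k < K) u k) @ \oo -->
    l - \sum_(0 <= k < K) u k.
  have hc : (fun _ : nat => \sum_(0 <= k < K) u k) @ \oo --> \sum_(0 <= k < K) u k.
    exact: cvgC_cst.
  exact: (cvgCB h hc).
apply: (cvgC_cabs_le h'); exists K => // N /= KN.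
rewrite (big_cat_nat (leq0n K) KN)//= addrAC subrr add0r.
by rewrite (le_trans (cabs_sum _ _ _)).
Qed.

(** Dominated convergence for series: a finite head converges and both tails are small by
    domination. It carries the exchanges of sums and limits below: double sums, termwise derivatives
    in x and in the order, averages over roots of unity. *)
Lemma tannery {T : Type} (F : set_system T) {FF : ProperFilter F}
    (f : T -> nat -> C) (g : nat -> C) (M : nat -> R) (B : R) :
  (forall N, \sum_(0 <= k < N) M k <= B) ->
  (\forall y \near F, forall k, cabs (f y k) <= M k) ->
  (forall k, (fun y => f y k) @ F --> g k) ->
  absbnd g B /\ (fun y => csum (f y)) @ F --> csum g.
Proof.
move=> MB fM fg.
have gM k : cabs (g k) <= M k.
  by apply: (cvgC_cabs_le (fg k)); apply: filterS fM => y /(_ k).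
have M0 k : 0 <= M k by rewrite (le_trans (cabs_ge0 _) (gM k)).
have gB : absbnd g B by apply: absbnd_mono MB.
split => //; apply/cvgCP => e e0.
have e3 : 0 < e / 4 by rewrite divr_gt0.
have [K hK] := bnd_tail M0 MB e3.
have tl v : (forall k, cabs (v k) <= M k) ->
    cabs (csum v - \sum_(0 <= k < K) v k) <= e / 4.
  move=> hv; apply: hassum_tail.
    by apply: absbnd_hassum; apply: absbnd_mono MB.
  by move=> N; apply: le_trans (hK N); apply: ler_sum => k _.
have hs : (fun y => \sum_(0 <= k < K) f y k) @ F --> \sum_(0 <= k < K) g k.
  exact: (@cvgC_sum _ _ _ _ _ _ (fun k y => f y k)).
move/cvgCP : hs => /(_ _ e3); apply: filterS2 fM => y hy h1.
have -> : csum (f y) - csum g = (csum (f y) - \sum_(0 <= k < K) f y k) +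
   (\sum_(0 <= k < K) f y k - \sum_(0 <= k < K) g k) -
   (csum g - \sum_(0 <= k < K) g k) by ring.
rewrite (le_lt_trans (cabsD _ _))// cabsN.
have := cabsD (csum (f y) - \sum_(0 <= k < K) f y k)
   (\sum_(0 <= k < K) f y k - \sum_(0 <= k < K) g k).
have := tl _ hy; have := tl _ gM; lra.
Qed.

Lemma csum_fin u K : (forall k, (K <= k)%N -> u k = 0) ->
  csum u = \sum_(0 <= k < K) u k.
Proof.
move=> h; apply: hassum_csum; apply: (@cvgC_near _ _ _ _ (fun=> \sum_(0 <= k < K) u k)); last exact: cvgC_cst.
exists K => // N /= KN; rewrite (big_cat_nat (leq0n K) KN) /=.
rewrite [X in _ = _ + X]big1_seq ?addr0//.
by move=> k; rewrite mem_index_iota => /andP[_ /andP[/h]].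
Qed.

Section hassum_algebra.
Variables (u v : nat -> C) (a b : C).
Hypotheses (hu : hassum u a) (hv : hassum v b).

Lemma hassumD : hassum (fun k => u k + v k) (a + b).
Proof.
rewrite /hassum; under eq_fun do rewrite big_split.
exact: cvgCD hu hv.
Qed.

Lemma hassumZ c : hassum (fun k => c * u k) (c * a).
Proof.
rewrite /hassum; under eq_fun do rewrite -big_distrr.
have hc : (fun _ : nat => c) @ \oo --> c by exact: cvgC_cst.
exact: (cvgCM hc hu).
Qed.

Lemma hassum_terms0 : u @ \oo --> (0 : C).
Proof.
have h1 : (fun N => \sum_(0 <= k < N.+1) u k) @ \oo --> a.
  by have := hu; rewrite /hassum -(cvg_shiftS (fun N => \sum_(0 <= k < N) u k : R[i]^o)).
have h2 : (fun N => \sum_(0 <= k < N.+1) u k - \sum_(0 <= k < N) u k) @ \oo --> a - a.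
  exact: cvgCB h1 hu.
rewrite subrr in h2.
by apply: cvg_trans h2; apply: near_eq_cvg; near=> N; rewrite psumS addrAC subrr add0r.
Unshelve. all: by end_near.
Qed.

Lemma hassumS : hassum (fun k => u k.+1) (a - u 0%N).
Proof.
have h1 : (fun N => \sum_(0 <= k < N.+1) u k) @ \oo --> a.
  by have := hu; rewrite /hassum -(cvg_shiftS (fun N => \sum_(0 <= k < N) u k : R[i]^o)).
have hc : (fun _ : nat => u 0%N) @ \oo --> u 0%N by exact: cvgC_cst.
have h2 : (fun N => \sum_(0 <= k < N.+1) u k - u 0%N) @ \oo --> a - u 0%N.
  exact: cvgCB h1 hc.
apply: cvg_trans h2; apply: near_eq_cvg; near=> N.
by rewrite psumSl addrAC subrr add0r.
Unshelve. all: by end_near.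
Qed.
End hassum_algebra.

Section fubini.
Variables (a : nat -> nat -> C) (M : nat -> R) (B : R).
Hypotheses (aM : forall k, absbnd (a k) (M k))
           (MB : forall N, \sum_(0 <= k < N) M k <= B).

Let pM k (N : nat) : cabs (\sum_(0 <= n < N) a k n) <= M k.
Proof. by apply: le_trans (cabs_sum _ _ _) _; exact: aM. Qed.

Let akn k n : cabs (a k n) <= M k.
Proof.
apply: le_trans (aM k n.+1); rewrite big_nat_recr//= lerDr sumr_ge0// => i _.
exact: cabs_ge0.
Qed.

(** Truncating every row at N gives terms bounded by [M k] for all N, so [tannery] applies with the
    rows as terms. *)
Lemma fubini_col : hassum (fun n => csum (fun k => a k n)) (csum (fun k => csum (a k))).
Proof.
have [] := @tannery nat \oo _ (fun N k => \sum_(0 <= n < N) a k n)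
  (fun k => csum (a k)) M B MB.
- by near=> N => k; exact: pM.
- by move=> k; apply: absbnd_hassum (aM k).
move=> _; rewrite /hassum; apply: cvg_trans; apply: near_eq_cvg; near=> N.
apply: hassum_csum; rewrite /hassum.
under eq_fun do rewrite exchange_big /=.
apply: cvgC_sum => n; apply: (@absbnd_hassum _ B).
exact: absbnd_mono MB.
Unshelve. all: by end_near. Qed.

(** The triangle k + n < N meets row k in n < N - k, so the truncated rows are again dominated by
    [M k]. *)
Lemma fubini_diag : hassum (fun J => \sum_(0 <= k < J.+1) a k (J - k)%N)
  (csum (fun k => csum (a k))).
Proof.
have [] := @tannery nat \oo _ (fun N k => \sum_(0 <= n < N - k) a k n)
  (fun k => csum (a k)) M B MB.
- by near=> N => k; exact: pM.
- move=> k; apply/cvgCP => e e0.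
  have /cvgCP /(_ _ e0) [K _ hK] := absbnd_hassum (aM k).
  exists (K + k)%N => // N /= KN; apply: hK => /=.
  by rewrite leq_subRL ?(leq_trans _ KN)// ?leq_addl// addnC.
move=> _; rewrite /hassum; apply: cvg_trans; apply: near_eq_cvg; near=> N.
rewrite diag_sum; apply: csum_fin => k Nk.
by move: Nk; rewrite -subn_eq0 => /eqP ->; rewrite big_geq.
Unshelve. all: by end_near. Qed.

Lemma absbnd_diag : absbnd (fun J => \sum_(0 <= k < J.+1) a k (J - k)%N) B.
Proof.
move=> N; apply: le_trans (MB N).
apply: (@le_trans _ _ (\sum_(0 <= J < N) \sum_(0 <= k < J.+1) cabs (a k (J - k)%N))).
  by apply: ler_sum => J _; exact: cabs_sum.
rewrite (@diag_sum _ (fun k n => cabs (a k n))).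
by apply: ler_sum => k _; exact: aM.
Qed.

End fubini.

Definition conv (u v : nat -> C) J := \sum_(0 <= k < J.+1) u k * v (J - k)%N.

Lemma absbndM u v A B : absbnd u A -> absbnd v B ->
  absbnd (conv u v) (A * B) /\ hassum (conv u v) (csum u * csum v).
Proof.
move=> hu hv.
have B0 : 0 <= B by have := hv 0%N; rewrite big_geq.
have h1 k : absbnd (fun n => u k * v n) (cabs (u k) * B).
  move=> N; under eq_bigr do rewrite cabsM.
  by rewrite -big_distrr/= ler_wpM2l ?cabs_ge0.
have h2 N : \sum_(0 <= k < N) cabs (u k) * B <= A * B.
  by rewrite -big_distrl /= ler_wpM2r.
split; first exact: absbnd_diag h1 h2.
have -> : csum u * csum v = csum (fun k => csum (fun n => u k * v n)).
  symmetry; have -> : (fun k => csum (fun n => u k * v n)) = (fun k => csum v * u k).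
    apply/funext => k; rewrite mulrC; apply: hassum_csum.
    exact: (hassumZ (absbnd_hassum hv)).
  rewrite mulrC; apply: hassum_csum; exact: (hassumZ (absbnd_hassum hu)).
exact: fubini_diag h1 h2.
Qed.

End AbsoluteSeries.

(** * Derivatives, exponential, logarithm and powers *)

Section ComplexDerivative.
Variable R : realType.
Local Notation C := R[i].
Implicit Types (z w : C) (x : R) (f g : R -> C).
Local Notation Re := complex.Re.
Local Notation Im := complex.Im.

(** The difference quotient is that of [cderiv]; naming its limit gives existence and value in one
    statement. *)
Definition cd f x (l : C) := (fun h : R => (h^-1)%:C * (f (x + h) - f x)) @ 0^' --> l.

Lemma is_deriveE (f : R -> R) x l :
  is_derive x 1 f l <-> (fun h : R => h^-1 * (f (x + h) - f x)) @ 0^' --> l.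
Proof.
have E : (fun h : R => h^-1 *: ((f \o shift x) (h *: 1) - f x)) =
         (fun h : R => h^-1 * (f (x + h) - f x)).
  apply/funext => h; have -> : h *: (1 : R) = h by rewrite /GRing.scale/= mulr1.
  by rewrite /= addrC (addrC h) /GRing.scale /= addrC.
split.
  move=> [h1 h2]; move: h1 h2; rewrite /derivable /derive.
  by rewrite E => h1 <-.
move=> h; have dv : derivable f x 1.
  by rewrite /derivable E; apply/cvg_ex; exists l.
by split => //; rewrite /derive E; apply: cvg_lim h.
Qed.

Lemma Re_rmul (a : R) z : Re (a%:C * z) = a * Re z.
Proof. by case: z => ? ? /=; rewrite mul0r subr0. Qed.
Lemma Im_rmul (a : R) z : Im (a%:C * z) = a * Im z.
Proof. by case: z => ? ? /=; rewrite mul0r addr0. Qed.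
Lemma ReD z w : Re (z + w) = Re z + Re w. Proof. by case: z w => ? ? []. Qed.
Lemma ImD z w : Im (z + w) = Im z + Im w. Proof. by case: z w => ? ? []. Qed.
Lemma ReN z : Re (- z) = - Re z. Proof. by case: z. Qed.
Lemma ImN z : Im (- z) = - Im z. Proof. by case: z. Qed.
Lemma ReB z w : Re (z - w) = Re z - Re w. Proof. by rewrite ReD ReN. Qed.
Lemma ImB z w : Im (z - w) = Im z - Im w. Proof. by rewrite ImD ImN. Qed.
Lemma ReM z w : Re (z * w) = Re z * Re w - Im z * Im w. Proof. by case: z w => ? ? []. Qed.
Lemma ImM z w : Im (z * w) = Re z * Im w + Im z * Re w. Proof. by case: z w => ? ? []. Qed.
Lemma eqC z w : Re z = Re w -> Im z = Im w -> z = w.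
Proof. by case: z w => ? ? [? ?] /= -> ->. Qed.

Lemma cdP f x l :
  cd f x l <-> is_derive x 1 (fun y => Re (f y)) (Re l) /\ is_derive x 1 (fun y => Im (f y)) (Im l).
Proof.
rewrite !is_deriveE /cd; split.
  move=> h; split.
    have h1 : (fun k : R => Re ((k^-1)%:C * (f (x + k) - f x))) @ 0^' --> Re l by exact: cvgC_Re h.
    apply: cvg_trans h1; apply: near_eq_cvg; near=> k.
    by rewrite Re_rmul ReB.
  have h1 : (fun k : R => Im ((k^-1)%:C * (f (x + k) - f x))) @ 0^' --> Im l by exact: cvgC_Im h.
  apply: cvg_trans h1; apply: near_eq_cvg; near=> k.
  by rewrite Im_rmul ImB.
move=> [h1 h2]; apply: cvgC_ReIm.
  by move: h1; apply: cvg_trans; apply: near_eq_cvg; near=> k; rewrite Re_rmul ReB.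
by move: h2; apply: cvg_trans; apply: near_eq_cvg; near=> k; rewrite Im_rmul ImB.
Unshelve. all: by end_near. Qed.

Lemma cd_eq f x l l' : cd f x l -> l = l' -> cd f x l'.
Proof. by move=> ? <-. Qed.

Lemma cd_cst (a : C) x : cd (fun=> a) x 0.
Proof. by apply/cdP; split => /=; apply: is_derive_cst. Qed.

Lemma cdD f g x l m : cd f x l -> cd g x m -> cd (fun y => f y + g y) x (l + m).
Proof.
move=> /cdP[f1 f2] /cdP[g1 g2]; apply/cdP; rewrite ReD ImD; split.
  by under eq_fun do rewrite ReD; exact: is_deriveD.
by under eq_fun do rewrite ImD; exact: is_deriveD.
Qed.

Lemma cdM f g x l m : cd f x l -> cd g x m -> cd (fun y => f y * g y) x (l * g x + f x * m).
Proof.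
move=> /cdP[f1 f2] /cdP[g1 g2]; apply/cdP; rewrite ReD ImD !ReM !ImM; split.
  under eq_fun do rewrite ReM; apply: is_derive_eq.
  by rewrite /GRing.scale /=; ring.
under eq_fun do rewrite ImM; apply: is_derive_eq.
by rewrite /GRing.scale /=; ring.
Qed.

Lemma cdZ f x l c : cd f x l -> cd (fun y => c * f y) x (c * l).
Proof. by move=> h; apply: cd_eq (cdM (cd_cst c x) h) _; rewrite mul0r add0r. Qed.

Lemma cdN f x l : cd f x l -> cd (fun y => - f y) x (- l).
Proof.
move=> h; have := cdZ (c := -1) h.
by rewrite mulN1r; under eq_fun do rewrite mulN1r.
Qed.

Lemma cdR (f : R -> R) x l : is_derive x 1 f l -> cd (fun y => (f y)%:C) x l%:C.
Proof. by move=> h; apply/cdP; split => //=; apply: is_derive_cst. Qed.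

Lemma cd_near f g x l : (\forall y \near x, f y = g y) -> cd f x l -> cd g x l.
Proof.
move=> fg; rewrite /cd; apply: cvgC_near.
have fgx : f x = g x by exact: nbhs_singleton fg.
have := fg; move/(nbhs_ballP x) => [e /= e0 he].
near=> h; rewrite fgx he// /ball /= opprD addrA subrr sub0r normrN.
by near: h; apply: dnbhs0_lt.
Unshelve. all: by end_near. Qed.

Lemma cd_unique f x l l' : cd f x l -> cd f x l' -> l = l'.
Proof. exact: cvgC_unique. Qed.

Lemma cd_sum (I : Type) (r : seq I) (f : I -> R -> C) x (l : I -> C) :
  (forall i, cd (f i) x (l i)) -> cd (fun y => \sum_(i <- r) f i y) x (\sum_(i <- r) l i).
Proof.
move=> h; elim: r => [|i r IH].
  by under eq_fun do rewrite big_nil; rewrite big_nil; exact: cd_cst.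
under eq_fun do rewrite big_cons; rewrite big_cons; exact: (cdD (h i) IH).
Qed.

Lemma cd_cst_seg f : (forall x, 0 <= x <= 1 -> cd f x 0) -> f 1 = f 0.
Proof.
have aux (g : R -> R) : (forall x, 0 <= x <= 1 -> is_derive x 1 g 0) -> g 1 = g 0.
  move=> hg; have [||x _] := @MVT_segment R g (fun=> 0) 0 1 ler01.
  - by move=> x; rewrite in_itv/= => /andP[/ltW h1 /ltW h2]; apply: hg; rewrite h1 h2.
  - apply: derivable_within_continuous => x; rewrite in_itv/= => h.
    by have := hg _ h; move=> [].
  by rewrite mul0r => /eqP; rewrite subr_eq0 => /eqP.
move=> hf; apply: eqC; [apply: (aux (fun x => Re (f x)))|apply: (aux (fun x => Im (f x)))].
  by move=> x /hf/cdP[].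
by move=> x /hf/cdP[].
Qed.

Lemma cexpD z w : cexp (z + w) = cexp z * cexp w.
Proof.
rewrite /cexp ReD ImD expRD; apply: eqC; rewrite !(Re_rmul, Im_rmul, ReM, ImM) /=.
  by rewrite cosD; ring.
by rewrite sinD; ring.
Qed.

Lemma cexp0 : cexp (0 : C) = 1.
Proof. by rewrite /cexp /= expR0 cos0 sin0 mul1r. Qed.

Lemma cexpNM z : cexp (- z) * cexp z = 1.
Proof. by rewrite -cexpD addNr cexp0. Qed.

Lemma cexp_neq0 z : cexp z != 0.
Proof. by apply/eqP => h; have := cexpNM z; rewrite h mulr0 => /eqP; rewrite eq_sym oner_eq0. Qed.

Lemma cexpN z : cexp (- z) = (cexp z)^-1.
Proof. by apply: (mulIf (cexp_neq0 z)); rewrite cexpNM mulVf// cexp_neq0. Qed.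

Lemma cexpMn z n : cexp (n%:R * z) = cexp z ^+ n.
Proof.
elim: n => [|n IH]; first by rewrite mul0r cexp0 expr0.
by rewrite exprSr -IH -cexpD -[X in n%:R * z + X]mul1r -mulrDl natr1.
Qed.

Lemma cabs_cexp z : cabs (cexp z) = expR (Re z).
Proof.
rewrite /cexp cabsM cabsR ger0_norm ?expR_ge0// /cabs /= cos2Dsin2 sqrtr1 mulr1//.
Qed.

Lemma cexp_real (a : R) : cexp a%:C = (expR a)%:C.
Proof. by rewrite /cexp /= cos0 sin0 mulr1. Qed.

Lemma Re_cexp z : Re (cexp z) = expR (Re z) * cos (Im z).
Proof. by rewrite /cexp Re_rmul. Qed.
Lemma Im_cexp z : Im (cexp z) = expR (Re z) * sin (Im z).
Proof. by rewrite /cexp Im_rmul. Qed.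

Lemma cd_cexp g x l : cd g x l -> cd (fun y => cexp (g y)) x (l * cexp (g x)).
Proof.
move=> /cdP[h1 h2]; apply/cdP; rewrite (ReM l) (ImM l) Re_cexp Im_cexp.
under eq_fun do rewrite Re_cexp.
under [X in _ /\ is_derive _ _ X _]eq_fun do rewrite Im_cexp.
have e1 := is_derive1_comp (is_derive_expR (Re (g x))) h1.
have e2 := is_derive1_comp (is_derive_cos (Im (g x))) h2.
have e3 := is_derive1_comp (is_derive_sin (Im (g x))) h2.
split.
  by apply: is_derive_eq; rewrite /GRing.scale /=; ring.
by apply: is_derive_eq; rewrite /GRing.scale /=; ring.
Qed.

End ComplexDerivative.

Section PowerSeriesDerivative.
Variable R : realType.
Local Notation C := R[i].
Implicit Types (z w : C) (x : R) (f g : R -> C).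
Local Notation Re := complex.Re.
Local Notation Im := complex.Im.

Lemma cdX x k : cd (fun y : R => y%:C ^+ k : C) x (k%:R * x%:C ^+ k.-1).
Proof.
elim: k => [|k IH].
  rewrite mul0r; under eq_fun do rewrite expr0; exact: cd_cst.
have h1 : cd (fun y : R => y%:C : C) x 1 by exact: (cdR (is_derive_id x 1)).
under eq_fun do rewrite exprS.
apply: cd_eq (cdM h1 IH) _ => /=.
case: k {IH} => [|k] /=; first by rewrite !mul0r mulr0 addr0.
by rewrite mulrCA -exprS -[in RHS]natr1 mulrDl mul1r addrC.
Qed.

Lemma ord_pred_le k (i : 'I_k) : (i <= k.-1)%N.
Proof. by rewrite -ltnS prednK ?ltn_ord// (leq_ltn_trans _ (ltn_ord i)). Qed.

Lemma expr_diff_bnd (a h r : R) k : `|a| <= r -> `|a + h| <= r ->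
  `|(a + h) ^+ k - a ^+ k| <= `|h| * (k%:R * r ^+ k.-1).
Proof.
move=> ar ahr; rewrite subrXX addrAC subrr add0r normrM ler_wpM2l//.
rewrite (le_trans (ler_norm_sum _ _ _))//.
have -> : k%:R * r ^+ k.-1 = \sum_(i < k) r ^+ k.-1.
  by rewrite sumr_const card_ord mulr_natl.
apply: ler_sum => i _; rewrite normrM !normrX.
rewrite -[in leRHS](subnK (ord_pred_le i)).
by rewrite exprD ler_pM ?exprn_ge0//; rewrite lerXn2r ?nnegrE// (le_trans _ ar).
Qed.

(** Each of the k terms of 1 + q + ... + q^(k-1) is at least q^(k-1), and the geometric sum is at
    most 1 / (1 - q). *)
Lemma kq_bnd (q : R) k : 0 <= q -> q < 1 -> k%:R * q ^+ k.-1 <= (1 - q)^-1.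
Proof.
move=> q0 q1; have d : 0 < 1 - q by rewrite subr_gt0.
rewrite -[leRHS]mul1r ler_pdivlMr//.
have h : \sum_(i < k) q ^+ k.-1 <= \sum_(i < k) q ^+ i.
  by apply: ler_sum => i _; apply: ler_wiXn2l => //; [exact: ltW|exact: ord_pred_le].
have -> : k%:R * q ^+ k.-1 = \sum_(i < k) q ^+ k.-1.
  by rewrite sumr_const card_ord mulr_natl.
apply: (@le_trans _ _ ((\sum_(i < k) q ^+ i) * (1 - q))).
  by rewrite ler_wpM2r// ltW.
have := subrX1 q k; rewrite -(opprB 1 q) mulNr => e.
have -> : (\sum_(i < k) q ^+ i) * (1 - q) = 1 - q ^+ k by rewrite mulrC -[LHS]opprK -e opprB.
by rewrite lerBlDr lerDl exprn_ge0.
Qed.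

Lemma absbnd_deriv (c : nat -> C) (r r' B : R) : 0 <= r -> r < r' ->
  (forall N, \sum_(0 <= k < N) cabs (c k) * r' ^+ k <= B) ->
  exists B', forall N, \sum_(0 <= k < N) cabs (c k) * (k%:R * r ^+ k.-1) <= B'.
Proof.
move=> r0 rr' h; have r'0 : 0 < r' by exact: le_lt_trans rr'.
pose q := r / r'.
have q0 : 0 <= q by rewrite divr_ge0// ltW.
have q1 : q < 1 by rewrite ltr_pdivrMr// mul1r.
exists (B * ((1 - q)^-1 / r')) => N; apply: (@le_trans _ _ ((\sum_(0 <= k < N) cabs (c k) * r' ^+ k) * ((1 - q)^-1 / r'))); last first.
  by rewrite ler_wpM2r// divr_ge0 ?invr_ge0 ?subr_ge0 ?ltW.
rewrite big_distrl/=; apply: ler_sum => k _.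
rewrite -mulrA ler_wpM2l ?cabs_ge0//.
have [->|k0] := posnP k; first by rewrite mul0r expr0 mul1r divr_ge0 ?invr_ge0 ?subr_ge0 ?ltW.
have -> : r = q * r' by rewrite mulfVK// gt_eqF.
have -> : r' ^+ k * ((1 - q)^-1 / r') = (1 - q)^-1 * r' ^+ k.-1.
  rewrite -{1}(prednK k0) exprSr mulrCA; congr (_ * _).
  by rewrite -mulrA divff ?mulr1// gt_eqF.
rewrite exprMn mulrA; apply: ler_wpM2r; first by rewrite exprn_ge0// ltW.
exact: kq_bnd.
Qed.

Lemma cd_pseries (c : nat -> C) (r B x : R) : `|x| < r ->
  (forall N, \sum_(0 <= k < N) cabs (c k) * r ^+ k <= B) ->
  cd (fun y => csum (fun k => c k * y%:C ^+ k)) x (csum (fun k => c k * (k%:R * x%:C ^+ k.-1))).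
Proof.
move=> xr hB.
(* A radius strictly between |x| and r contains x + h for small h and leaves room to absorb the
   factor k of the derivative. *)
pose r1 := (`|x| + r) / 2.
have xr1 : `|x| < r1 by rewrite /r1; lra.
have r1r : r1 < r by rewrite /r1; lra.
have r10 : 0 <= r1 by rewrite (le_trans _ (ltW xr1)).
have [B' hB'] := absbnd_deriv r10 r1r hB.
have abs y : `|y| <= r1 -> absbnd (fun k => c k * y%:C ^+ k) B.
  move=> yr N; apply: le_trans (hB N); apply: ler_sum => k _.
  rewrite cabsM cabsX cabsR ler_wpM2l ?cabs_ge0// lerXn2r// ?nnegrE ?(le_trans yr) ?ltW//.
  exact: le_lt_trans r1r.
have nr : \forall h \near (0 : R)^', `|x + h| <= r1.
  near=> h; rewrite (le_trans (ler_normD _ _))// -lerBrDl ltW//.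
  by near: h; apply: dnbhs0_lt; rewrite subr_gt0.
have [] := @tannery R R (0 : R)^' _ (fun h k => (h^-1)%:C * (c k * (x + h)%:C ^+ k - c k * x%:C ^+ k))
  (fun k => c k * (k%:R * x%:C ^+ k.-1)) (fun k => cabs (c k) * (k%:R * r1 ^+ k.-1)) B' hB'.
- near=> h => k.
  have h0 : h != 0 by near: h; exact: nbhs_dnbhs_neq.
  rewrite -mulrBr mulrCA cabsM ler_wpM2l ?cabs_ge0//.
  rewrite -!rmorphXn -rmorphB -rmorphM cabsR normrM normfV.
  rewrite ler_pdivrMl ?normr_gt0//; apply: expr_diff_bnd; first exact: ltW.
  by near: h.
- move=> k; have := cdZ (c := c k) (@cdX x k).
  exact.
move=> _; apply: cvgC_near; near=> h.
have h1 : `|x + h| <= r1 by near: h.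
have s1 := absbnd_hassum (abs _ h1).
have s2 := absbnd_hassum (abs _ (ltW xr1)).
apply: hassum_csum; apply: hassumZ.
have := hassumD s1 (hassumZ (c := -1) s2); rewrite mulN1r.
by under eq_fun do rewrite mulN1r.
Unshelve. all: by end_near. Qed.

End PowerSeriesDerivative.

Section ComplexLogPow.
Variable R : realType.
Local Notation C := R[i].
Implicit Types (z w : C) (x : R) (f g : R -> C).
Local Notation Re := complex.Re.
Local Notation Im := complex.Im.

Lemma cabs_sqr w : cabs w ^+ 2 = Re w ^+ 2 + Im w ^+ 2.
Proof. by rewrite sqr_sqrtr// addr_ge0 ?sqr_ge0. Qed.

Lemma Re_neq0 w : 0 < Re w -> w != 0.
Proof. by apply: contraTneq => ->; rewrite ltxx. Qed.

Lemma cLogE w : 0 < Re w -> cLog w = (ln (cabs w)) +i* (atan (Im w / Re w)).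
Proof. by rewrite /cLog /carg => ->. Qed.

Lemma cabs_polar w : Re w != 0 ->
  cabs w = `|Re w| * Num.sqrt (1 + (Im w / Re w) ^+ 2).
Proof.
move=> h; rewrite -sqrtr_sqr -sqrtrM ?sqr_ge0// mulrDr mulr1 -exprMn.
by rewrite mulrCA divff// mulr1.
Qed.

Lemma sin_atan (y : R) : sin (atan y) = y / Num.sqrt (1 + y ^+ 2).
Proof.
have h := cos_atan y; have hs : 0 < 1 + y ^+ 2 by rewrite ltr_pwDl// sqr_ge0.
have c0 : cos (atan y) != 0 by rewrite h invr_eq0 sqrtr_eq0 -ltNge.
by rewrite -[in LHS](mulfVK c0 (sin (atan y))) -[_ / cos _]/(tan (atan y)) atanK h.
Qed.

Lemma carg_polar w : w != 0 -> Re w = cabs w * cos (carg w) /\ Im w = cabs w * sin (carg w).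
Proof.
move=> w0; rewrite /carg.
have hs (y : R) : Num.sqrt (1 + y ^+ 2) != 0.
  by rewrite sqrtr_eq0 -ltNge ltr_pwDl// sqr_ge0.
case: ltgtP => ha.
- have a0 : Re w != 0 by rewrite gt_eqF.
  rewrite (cabs_polar a0) gtr0_norm// cos_atan sin_atan; split; field; rewrite ?hs ?a0//.
- have a0 : Re w != 0 by rewrite lt_eqF.
  have E : Re w = cabs w * - cos (atan (Im w / Re w)) /\ Im w = cabs w * - sin (atan (Im w / Re w)).
    rewrite (cabs_polar a0) ltr0_norm// cos_atan sin_atan; split; field; rewrite ?hs ?a0//.
  case: ifP => _; first by rewrite cosDpi sinDpi.
  by rewrite -[X in _ - X]opprK opprK -{1 2}(opprK (atan _)) -opprD cosN sinN cosDpi sinDpi cosN sinN opprK.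
- have E : cabs w = `|Im w| by rewrite /cabs -ha expr0n /= add0r sqrtr_sqr.
  rewrite E -ha; case: ltgtP => hb.
  + by rewrite cos_pihalf sin_pihalf mulr0 mulr1 gtr0_norm.
  + by rewrite cosN sinN cos_pihalf sin_pihalf mulr0 mulrN1 ltr0_norm// opprK.
  + by rewrite -hb normr0 !mul0r.
Qed.

Lemma cexp_cLog w : w != 0 -> cexp (cLog w) = w.
Proof.
move=> w0; have [h1 h2] := carg_polar w0.
apply: eqC; rewrite ?Re_cexp ?Im_cexp /= lnK ?posrE ?cabs_gt0//.
Qed.

Lemma cpow_mul w a b : cpow w a * cpow w b = cpow w (a + b).
Proof. by rewrite /cpow -cexpD mulrDl. Qed.

Lemma cpow0 w : cpow w 0 = 1.
Proof. by rewrite /cpow mul0r cexp0. Qed.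

Lemma cpowN w a : cpow w (- a) = (cpow w a)^-1.
Proof. by rewrite /cpow mulNr cexpN. Qed.

Lemma cpow_nat w n : w != 0 -> cpow w n%:R = w ^+ n.
Proof. by move=> w0; rewrite /cpow cexpMn cexp_cLog. Qed.

Lemma cLog_scale x w : 0 < x -> 0 < Re w -> cLog (x%:C * w) = (ln x)%:C + cLog w.
Proof.
move=> x0 w0; rewrite cLogE ?Re_rmul ?mulr_gt0// Im_rmul cLogE// cabsM cabsR gtr0_norm//.
apply: eqC; rewrite ?ReD ?ImD /= ?add0r.
  by rewrite lnM// posrE// cabs_gt0 Re_neq0.
by congr atan; rewrite -mulf_div divff ?mul1r// gt_eqF.
Qed.

Lemma Re_inv w : Re w^-1 = Re w / cabs w ^+ 2.
Proof. by rewrite cabs_sqr; case: w. Qed.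
Lemma Im_inv w : Im w^-1 = - Im w / cabs w ^+ 2.
Proof. by rewrite cabs_sqr mulNr; case: w. Qed.

Lemma Re_inv_gt0 w : 0 < Re w -> 0 < Re w^-1.
Proof. by move=> h; rewrite Re_inv divr_gt0// exprn_gt0// cabs_gt0 Re_neq0. Qed.

Lemma cLogV w : 0 < Re w -> cLog w^-1 = - cLog w.
Proof.
move=> h; have w0 := Re_neq0 h.
have c0 : cabs w != 0 by rewrite cabs_eq0.
rewrite cLogE ?Re_inv_gt0// cLogE//; apply: eqC; rewrite ?ReN ?ImN /=.
  by rewrite cabsV lnV// posrE cabs_gt0.
rewrite -atanN; congr atan; rewrite Re_inv Im_inv; field.
by rewrite c0 gt_eqF.
Qed.

Lemma cLog_real x : 0 < x -> cLog x%:C = (ln x)%:C.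
Proof.
by move=> x0; rewrite cLogE//= cabsR gtr0_norm// mul0r atan0.
Qed.

Lemma cLog1 : cLog (1 : C) = 0.
Proof. by rewrite -[1]/((1 : R)%:C) cLog_real// ln1. Qed.

(** On the right half-plane log |w| is half of ln |w|^2 and the argument is atan (Im w / Re w), so
    real calculus suffices for both components. *)
Lemma cd_cLog g x l : cd g x l -> 0 < Re (g x) -> cd (fun y => cLog (g y)) x (l / g x).
Proof.
move=> hg g0; move/cdP: (hg) => [h1 h2].
have cR : {for x, continuous (fun y => Re (g y))}.
  by apply/differentiable_continuous/derivable1_diffP; case: h1.
have nr : \forall y \near x, 0 < Re (g y).
  by apply: (cvgr_gt _ cR).
apply: (@cd_near _ (fun y => (ln (Re (g y) ^+ 2 + Im (g y) ^+ 2) / 2) +i* (atan (Im (g y) / Re (g y))))).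
  near=> y; have y0 : 0 < Re (g y) by near: y.
  rewrite cLogE//; apply: eqC => //=; rewrite -cabs_sqr lnXn ?cabs_gt0 ?Re_neq0//.
  by rewrite mulr2n; lra.
pose q y := Re (g y) ^+ 2 + Im (g y) ^+ 2.
have q0 : 0 < q x by rewrite ltr_pwDl ?exprn_gt0// sqr_ge0.
apply/cdP; rewrite ReM ImM Re_inv Im_inv cabs_sqr /=; split.
  have e1 : is_derive x 1 q (2 * Re (g x) * Re l + 2 * Im (g x) * Im l).
    apply: is_derive_eq; rewrite /GRing.scale /=; ring.
  have e2 := is_derive1_comp (is_derive1_ln q0) e1.
  have -> : (fun y => ln (Re (g y) ^+ 2 + Im (g y) ^+ 2) / 2) = (fun y => (@ln R \o q) y * 2^-1) by [].
  apply: is_derive_eq; rewrite /GRing.scale /= /q; field; rewrite -/(q x).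
  by rewrite gt_eqF.
have r0 : Re (g x) != 0 by rewrite gt_eqF.
have e0 : is_derive x 1 (fun y => (Re (g y))^-1) (- (Re (g x)) ^- 2 * Re l).
  exact: (is_deriveV r0).
pose p y := Im (g y) / Re (g y).
have e1 : is_derive x 1 p (Im l / Re (g x) - Im (g x) * Re l / Re (g x) ^+ 2).
  by apply: is_derive_eq; rewrite /GRing.scale /=; field.
have e2 := is_derive1_comp (is_derive1_atan (p x)) e1.
have -> : (fun y => atan (Im (g y) / Re (g y))) = @atan R \o p by [].
have q1 : Re (g x) ^+ 2 + Im (g x) ^+ 2 != 0 by rewrite gt_eqF.
apply: is_derive_eq; rewrite /GRing.scale /= /p; field.
by rewrite r0 q1.
Unshelve. all: by end_near. Qed.

End ComplexLogPow.

(** * The binomial series *)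

Section rf.
Variable K : numFieldType.
Implicit Types s : K.

(* (s)_n / n!, the Taylor coefficients of (1 - t)^(-s). *)
Definition rf s n := (\prod_(0 <= i < n) (s + i%:R)) / n`!%:R.

Lemma fact_neq0 n : n`!%:R != 0 :> K.
Proof. by rewrite pnatr_eq0 -lt0n fact_gt0. Qed.

Lemma natS_neq0 n : n.+1%:R != 0 :> K.
Proof. by rewrite pnatr_eq0. Qed.

Lemma rf0 s : rf s 0 = 1.
Proof. by rewrite /rf big_geq// fact0 divr1. Qed.

Lemma rfS s n : n.+1%:R * rf s n.+1 = (s + n%:R) * rf s n.
Proof.
rewrite /rf big_nat_recr//= factS natrM.
by field; rewrite ?nat1r ?natr1 ?natS_neq0 ?fact_neq0.
Qed.

Lemma rfSE s n : rf s n.+1 = (s + n%:R) * rf s n / n.+1%:R.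
Proof. by rewrite -rfS mulrC mulKf// natS_neq0. Qed.

(** Coefficient form of d/dt (1 - t)^(-s) = s (1 - t)^(-s-1). *)
Lemma rf_first s n : s * rf (s + 1) n = n.+1%:R * rf s n.+1.
Proof.
elim: n => [|n IH]; first by rewrite rfS !rf0 addr0.
apply: (mulfI (natS_neq0 n)).
rewrite mulrCA (rfS (s + 1) n) mulrCA IH (rfS s n.+1) -natr1; ring.
Qed.

(** Coefficient form of (1 - t)^(-s) = (1 - t) (1 - t)^(-s-1). *)
Lemma rf_shift s n : rf s n.+1 = rf (s + 1) n.+1 - rf (s + 1) n.
Proof.
apply: (mulfI (natS_neq0 n)); rewrite mulrBr -rf_first rfS -natr1.
ring.
Qed.

Lemma rf0n n : rf 0 n.+1 = 0.
Proof. by rewrite /rf big_nat_recl//= addr0 mul0r mul0r. Qed.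

Lemma rf1 n : rf 1 n = 1.
Proof.
elim: n => [|n IH]; first by rewrite rf0.
by rewrite rfSE IH mulr1 nat1r divff// natS_neq0.
Qed.

(** Chu-Vandermonde, the coefficient form of (1 - t)^(-a) (1 - t)^(-b) = (1 - t)^(-a-b). In the
    induction the weight n + 1 is split as i + (n + 1 - i), and [rfS] acts on each factor. *)
Lemma rf_vdm a b n : \sum_(0 <= i < n.+1) rf a i * rf b (n - i)%N = rf (a + b) n.
Proof.
elim: n => [|n IH]; first by rewrite big_nat1 !rf0 mul1r.
apply: (mulfI (natS_neq0 n)); rewrite rfS -IH.
rewrite !big_distrr/=.
have -> : \sum_(0 <= i < n.+2) n.+1%:R * (rf a i * rf b (n.+1 - i)) =
  \sum_(0 <= i < n.+2) (i%:R * rf a i * rf b (n.+1 - i)) +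
  \sum_(0 <= i < n.+2) (rf a i * ((n.+1 - i)%:R * rf b (n.+1 - i))).
  rewrite -big_split/=; apply: eq_big_nat => i /andP[_ i1].
  by rewrite -{1}(subnKC (i1 : (i <= n.+1)%N)) natrD; ring.
rewrite [X in X + _]psumSl mul0r mul0r add0r.
rewrite [X in _ + X]psumS subnn mul0r mulr0 addr0 -big_split /=.
apply: eq_big_nat => i /andP[_ i1].
rewrite subSS (subSn (i1 : (i <= n)%N)) !rfS natrB//; ring.
Qed.
End rf.

Section BinomialSeries.
Variable R : realType.
Local Notation C := R[i].
Implicit Types (s z w t : C) (x r : R).
Local Notation Re := complex.Re.
Local Notation Im := complex.Im.

Lemma rf_ge0 r n : 0 <= r -> 0 <= rf r n.
Proof. by move=> r0; rewrite /rf divr_ge0// prodr_ge0// => i _; rewrite addr_ge0. Qed.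

Lemma rf_le r r' n : 0 <= r -> r <= r' -> rf r n <= rf r' n.
Proof.
move=> r0 rr'; rewrite /rf ler_wpM2r ?invr_ge0//.
by apply: ler_prod => i _; rewrite addr_ge0//= lerD2r.
Qed.

Lemma cabs_rf s n : cabs (rf s n) <= rf (cabs s) n.
Proof.
elim: n => [|n IH]; first by rewrite !rf0 cabs1.
rewrite !rfSE cabsM cabsM cabsV cabs_nat ler_wpM2r ?invr_ge0// ler_pM ?cabs_ge0//.
by rewrite (le_trans (cabsD _ _))// cabs_nat.
Qed.

(** Multiplied by 1 - r, the partial sum for m + 1 falls short of the one for m by a non-negative
    boundary term. *)
Lemma rf_sum r m N : 0 <= r -> r < 1 ->
  \sum_(0 <= n < N) rf m%:R n * r ^+ n <= (1 - r)^-1 ^+ m.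
Proof.
move=> r0 r1; have d : 0 < 1 - r by rewrite subr_gt0.
elim: m N => [|m IH] N.
  case: N => [|N]; first by rewrite big_geq.
  rewrite psumSl rf0 expr0 mulr1 [X in _ + X]big1 ?addr0// => i _.
  by rewrite rf0n mul0r.
have E M : \sum_(0 <= n < M.+1) rf m%:R n * r ^+ n =
    \sum_(0 <= n < M.+1) rf m.+1%:R n * r ^+ n - r * \sum_(0 <= n < M) rf m.+1%:R n * r ^+ n.
  elim: M => [|M IHM]; first by rewrite !big_nat1 big_geq// mulr0 subr0 !rf0.
  rewrite psumS IHM [in RHS]psumS [X in _ = _ - _ * X]psumS rf_shift natr1 exprS; ring.
rewrite exprS ler_pdivlMl//.
case: N => [|N]; first by rewrite big_geq// mulr0 exprn_ge0// invr_ge0 ltW.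
apply: le_trans (IH N.+1); rewrite E mulrBl mul1r lerB// ler_wpM2l//.
by apply: psum_le => // n; rewrite mulr_ge0 ?rf_ge0 ?exprn_ge0.
Qed.

Lemma rf_bnd s t r m : cabs s <= m%:R -> r < 1 -> cabs t <= r ->
  absbnd (fun n => rf s n * t ^+ n) ((1 - r)^-1 ^+ m).
Proof.
move=> sm r1 tr N; have r0 : 0 <= r by exact: le_trans (cabs_ge0 _) tr.
apply: le_trans (rf_sum m N r0 r1); apply: ler_sum => n _.
rewrite cabsM cabsX ler_pM ?exprn_ge0 ?cabs_ge0//.
  by apply: le_trans (cabs_rf _ _) _; apply: rf_le; rewrite ?cabs_ge0.
by apply: lerXn2r; rewrite ?nnegrE ?cabs_ge0.
Qed.

Lemma ex_natbnd r : exists m : nat, r <= m%:R.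
Proof.
exists (Num.bound `|r|); by rewrite (le_trans (ler_norm r))// ltW// archi_boundP.
Qed.

Lemma Re_1B t : cabs t < 1 -> 0 < Re (1 - t).
Proof.
move=> h; rewrite ReB /= subr_gt0 (le_lt_trans _ h)//.
by rewrite (le_trans (ler_norm _))// cabs_Re.
Qed.

Lemma cd_1Bray t x : cd (fun y : R => 1 - y%:C * t : C) x (- t).
Proof.
have h := @cdM _ _ _ x _ _ (cdR (is_derive_id x 1)) (@cd_cst _ t x).
apply: cd_eq (cdD (@cd_cst _ (1 : C) x) (cdN h)) _.
by rewrite /= mul1r mulr0 addr0 add0r.
Qed.

Lemma cabs_ray t x : cabs t < 1 -> 0 <= x <= 1 -> cabs (x%:C * t) < 1.
Proof.
move=> t1 /andP[x0 x1]; rewrite cabsM cabsR ger0_norm// (le_lt_trans _ t1)//.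
by rewrite ler_piMl// cabs_ge0.
Qed.

(** The series along the ray y t must converge beyond y = 1, since it is differentiated on the
    closed segment from 0 to 1. *)
Lemma ray_radius t : cabs t < 1 -> exists r r', [/\ 1 < r, r' < 1 & cabs t * r <= r'].
Proof.
move=> t1; have t0 := cabs_ge0 t.
exists (2 / (1 + cabs t)), ((2 * cabs t) / (1 + cabs t)).
have d : 0 < 1 + cabs t by lra.
split.
- by rewrite ltr_pdivlMr//; lra.
- by rewrite ltr_pdivrMr//; lra.
- by rewrite mulrCA mulrA.
Qed.

Lemma ray_end1 t : 1 - (1 : R)%:C * t = 1 - t.
Proof. by rewrite rmorph1 mul1r. Qed.
Lemma ray_end0 t : 1 - (0 : R)%:C * t = 1.
Proof. by rewrite rmorph0 mul0r subr0. Qed.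

(** Along the ray y t the sum f satisfies (1 - y t) f' = s t f, so f (y) (1 - y t)^s is constant on
    [0, 1]. Working on a ray needs derivatives in a real variable only. *)
Lemma binomial_series s t : cabs t < 1 ->
  hassum (fun n => rf s n * t ^+ n) (cpow (1 - t) (- s)).
Proof.
move=> t1.
have [m sm] := ex_natbnd (cabs s).
have [r [r' [r1 r'1 tr]]] := ray_radius t1.
pose c k := rf s k * t ^+ k.
have cB N : \sum_(0 <= k < N) cabs (c k) * r ^+ k <= (1 - r')^-1 ^+ m.
  apply: le_trans (@rf_bnd s (r%:C * t) r' m sm r'1 _ N).
    apply: ler_sum => k _; rewrite /c !cabsM !cabsX cabsM cabsR gtr0_norm; last lra.
    by rewrite exprMn mulrAC mulrA mulrAC.
  by rewrite cabsM cabsR gtr0_norm 1?mulrC//; lra.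
pose f (y : R) := csum (fun k => c k * y%:C ^+ k).
pose e (y : R) := cexp (s * cLog (1 - y%:C * t)).
have df x : 0 <= x <= 1 -> (1 - x%:C * t) * csum (fun k => c k * (k%:R * x%:C ^+ k.-1)) = s * t * f x.
  move=> /andP[x0 x1].
  have xr : `|x| < r by rewrite ger0_norm//; lra.
  have xr0 : x < r by lra.
  have [B' hB'] := absbnd_deriv x0 xr0 cB.
  have sA : hassum (fun k => c k * (k%:R * x%:C ^+ k.-1)) (csum (fun k => c k * (k%:R * x%:C ^+ k.-1))).
    apply: (@absbnd_hassum _ _ B') => N; apply: le_trans (hB' N); apply: ler_sum => k _.
    by rewrite cabsM [cabs (_%:R * _)]cabsM cabsX cabs_nat cabsR ger0_norm.
  have sB : hassum (fun k => c k * x%:C ^+ k) (f x).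
    apply: (@absbnd_hassum _ _ ((1 - r')^-1 ^+ m)) => N; apply: le_trans (cB N); apply: ler_sum => k _.
    by rewrite cabsM cabsX cabsR ler_wpM2l ?cabs_ge0// lerXn2r ?nnegrE ?(ltW xr)// ltW// (le_lt_trans x0).
  set A := csum _ in sA *.
  have e1 := hassumS sA; rewrite /= mul0r mulr0 subr0 in e1.
  have e2 := hassumD (hassumZ (c := s * t) sB) (hassumZ (c := x%:C * t) sA).
  have E : A = s * t * f x + x%:C * t * A.
    apply: (hassum_unique e1); apply: cvg_trans e2; apply: near_eq_cvg; near=> N.
    apply: eq_bigr => k _ /=.
    have hc : c k.+1 * k.+1%:R = (s + k%:R) * t * c k.
      by rewrite /c exprS mulrC mulrA rfS; ring.
    rewrite [RHS]mulrA hc; case: k {hc} => [|k]; first by rewrite mul0r; ring.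
    by rewrite /= exprS; ring.
  by rewrite {1}mulrBl mul1r {1}E; ring.
have main : f 1 * e 1 = f 0 * e 0.
  apply: (@cd_cst_seg _ (fun y => f y * e y)) => x hx.
  have xr : `|x| < r by case/andP: hx => x0 x1; rewrite ger0_norm//; lra.
  have d1 := cd_pseries xr cB.
  have u0 : 0 < Re (1 - x%:C * t) by apply: Re_1B; exact: cabs_ray.
  have d2 := cd_cexp (cdZ (c := s) (cd_cLog (@cd_1Bray t x) u0)).
  apply: cd_eq (cdM d1 d2) _; rewrite -/(f x) -/(e x).
  have := df x hx; set F' := csum _ => h.
  have u1 := Re_neq0 u0.
  have -> : F' = s * t * f x / (1 - x%:C * t) by rewrite -h mulrC mulKf.
  by field.
have l1 : e 1 = cexp (s * cLog (1 - t)).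
  by rewrite /e; congr (cexp (s * cLog _)); exact: ray_end1.
have l0 : e 0 = 1.
  rewrite -cexp0 -(mulr0 s) -cLog1 /e; congr (cexp (s * cLog _)); exact: ray_end0.
have f0 : f 0 = 1.
  rewrite /f (@csum_fin _ _ 1%N) ?big_nat1 ?expr0 /c ?rf0 ?expr0 ?mulr1//.
  by case=> // k _; rewrite expr0n /= mulr0.
have h : f 1 * cexp (s * cLog (1 - t)) = 1.
  exact: etrans (congr1 (fun z => f 1 * z) (esym l1)) (etrans main (etrans (congr1 (fun z => z * e 0) f0) (etrans (mul1r _) l0))).
have f1 : f 1 = cpow (1 - t) (- s).
  by rewrite /cpow mulNr cexpN -(mulfK (cexp_neq0 (s * cLog (1 - t))) (f 1)) h mul1r.
rewrite -f1.
have sB : hassum (fun k => c k * (1 : R)%:C ^+ k) (f 1).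
  apply: (@absbnd_hassum _ _ ((1 - r')^-1 ^+ m)) => N; apply: le_trans (cB N); apply: ler_sum => k _.
  by rewrite cabsM cabsX cabsR ler_wpM2l ?cabs_ge0// lerXn2r ?nnegrE ?normr1// ltW//; lra.
apply: cvg_trans sB; apply: near_eq_cvg; near=> N; apply: eq_bigr => k _.
by rewrite expr1n mulr1.
Unshelve. all: by end_near. Qed.

Lemma log_series t : cabs t < 1 ->
  hassum (fun n => t ^+ n.+1 / n.+1%:R) (- cLog (1 - t)).
Proof.
move=> t1.
have [r [r' [r1 r'1 tr]]] := ray_radius t1.
(* At k = 0 the quotient is 0, since the inverse of 0 is 0; the series thus starts at k = 1. *)
pose c k := t ^+ k / k%:R : C.
have r'0 : 0 <= r' by apply: le_trans tr; rewrite mulr_ge0 ?cabs_ge0//; lra.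
have cB N : \sum_(0 <= k < N) cabs (c k) * r ^+ k <= (1 - r')^-1.
  apply: le_trans (@rf_sum r' 1 N r'0 r'1); apply: ler_sum => k _.
  rewrite rf1 mul1r /c cabsM cabsX cabsV cabs_nat mulrAC -exprMn.
  have h : (cabs t * r) ^+ k <= r' ^+ k.
    by apply: lerXn2r; rewrite ?nnegrE// mulr_ge0 ?cabs_ge0//; lra.
  case: k h => [|k] h; first by rewrite invr0 mulr0.
  rewrite (le_trans _ h)// ler_piMr ?exprn_ge0 ?mulr_ge0 ?cabs_ge0//; first lra.
  by rewrite invf_le1 ?ltr0n// ler1n.
pose f (y : R) := csum (fun k => c k * y%:C ^+ k).
have df x : 0 <= x <= 1 -> csum (fun k => c k * (k%:R * x%:C ^+ k.-1)) = t / (1 - x%:C * t).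
  move=> hx; have xt := cabs_ray t1 hx.
  have xr0 : x < r by case/andP: hx => x0 x1; lra.
  have [B' hB'] := absbnd_deriv (proj1 (andP hx)) xr0 cB.
  have sA : hassum (fun k => c k * (k%:R * x%:C ^+ k.-1)) (csum (fun k => c k * (k%:R * x%:C ^+ k.-1))).
    apply: (@absbnd_hassum _ _ B') => N; apply: le_trans (hB' N); apply: ler_sum => k _.
    by rewrite cabsM [cabs (_%:R * _)]cabsM cabsX cabs_nat cabsR ger0_norm//; case/andP: hx.
  set A := csum _ in sA *.
  have e1 := hassumS sA; rewrite /= mul0r mulr0 subr0 in e1.
  have u0 := Re_neq0 (Re_1B xt).
  have e2 := hassumZ (c := t) (@binomial_series 1 (x%:C * t) xt).
  rewrite cpowN -[X in cpow _ X]/(1%:R) (cpow_nat 1 u0) expr1 in e2.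
  apply: (hassum_unique e1); apply: cvg_trans e2; apply: near_eq_cvg; near=> N.
  apply: eq_bigr => k _ /=.
  by rewrite rf1 mul1r exprMn /c mulrA mulfVK ?natS_neq0// exprS; ring.
have main : f 1 + cLog (1 - 1%:C * t) = f 0 + cLog (1 - 0%:C * t).
  apply: (@cd_cst_seg _ (fun y => f y + cLog (1 - y%:C * t))) => x hx.
  have xr : `|x| < r by case/andP: hx => x0 x1; rewrite ger0_norm//; lra.
  have d1 := cd_pseries xr cB.
  have u0 : 0 < Re (1 - x%:C * t) by apply: Re_1B; exact: cabs_ray.
  have d2 := cd_cLog (@cd_1Bray t x) u0.
  by apply: cd_eq (cdD d1 d2) _; rewrite df// mulNr subrr.
have l1 : cLog (1 - 1%:C * t) = cLog (1 - t) by congr cLog; exact: ray_end1.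
have l0 : cLog (1 - 0%:C * t) = 0 by rewrite -cLog1; congr cLog; exact: ray_end0.
have f0 : f 0 = 0.
  rewrite /f (@csum_fin _ _ 0%N) ?big_geq// => k _.
  by rewrite /c; case: k => [|k]; rewrite ?invr0 ?mulr0 ?mul0r// expr0n /= mulr0.
have f1 : f 1 = - cLog (1 - t).
  apply/eqP; rewrite -addr_eq0; apply/eqP.
  exact: etrans (congr1 (fun z => f 1 + z) (esym l1)) (etrans main (etrans (congr1 (fun z => z + _) f0) (etrans (add0r _) l0))).
rewrite -f1.
have sB : hassum (fun k => c k * (1 : R)%:C ^+ k) (f 1).
  apply: (@absbnd_hassum _ _ (1 - r')^-1) => N; apply: le_trans (cB N); apply: ler_sum => k _.
  by rewrite cabsM cabsX cabsR ler_wpM2l ?cabs_ge0// lerXn2r ?nnegrE ?normr1// ltW//; lra.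
have c0 : c 0%N = 0 by rewrite /c invr0 mulr0.
have := hassumS sB; rewrite c0 mul0r subr0.
apply: cvg_trans; apply: near_eq_cvg; near=> N; apply: eq_bigr => k _.
by rewrite expr1n mulr1.
Unshelve. all: by end_near. Qed.

End BinomialSeries.

(** * Reciprocal Gamma function *)

Section ReciprocalGammaProduct.
Variable R : realType.
Local Notation C := R[i].
Implicit Types (s z w t e : C) (x r : R).
Local Notation Re := complex.Re.
Local Notation Im := complex.Im.

(** A unit u rotates f 1 - f 0 onto the positive real axis; the real mean value theorem then applies
    to Re (u f). *)
Lemma cd_mvi (f f' : R -> C) (M : R) : (forall x, 0 <= x <= 1 -> cd f x (f' x)) ->
  (forall x, 0 <= x <= 1 -> cabs (f' x) <= M) -> cabs (f 1 - f 0) <= M.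
Proof.
move=> df bf; set D := f 1 - f 0.
have M0 : 0 <= M by apply: le_trans (cabs_ge0 _) (bf 0 _); rewrite lexx ler01.
have [D0|D0] := eqVneq D 0; first by rewrite D0 cabs0.
pose u := D^*%C / (cabs D)%:C.
have cD : cabs D != 0 by rewrite cabs_eq0.
have cu : cabs u = 1.
  rewrite /u cabsM cabsV cabsR ger0_norm ?cabs_ge0//.
  have -> : cabs D^*%C = cabs D by case: (D) => a b; rewrite /cabs /= sqrrN.
  by rewrite divff.
have uD : u * D = (cabs D)%:C.
  have h : D^*%C * D = (cabs D ^+ 2)%:C.
    rewrite cabs_sqr; case: (D) => a b; apply: eqC; rewrite /= ?expr2; ring.
  rewrite /u mulrAC h expr2 rmorphM /= mulfK//.
  by rewrite -(inj_eq (@complexI R)) in cD.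
have d x : 0 <= x <= 1 -> cd (fun y => u * f y) x (u * f' x) by move=> /df /cdZ.
have [||c c01] := @MVT_segment R (fun y => Re (u * f y)) (fun y => Re (u * f' y)) 0 1 ler01.
- move=> x; rewrite in_itv/= => /andP[/ltW h1 /ltW h2].
  have /cdP[h _] : cd (fun y => u * f y) x (u * f' x) by apply: d; rewrite h1 h2.
  exact: h.
- apply: derivable_within_continuous => x; rewrite in_itv/= => /d/cdP[[h _] _]; exact: h.
rewrite subr0 mulr1 -ReB -mulrBr -/D uD /= => ->.
rewrite (le_trans (ler_norm _))// (le_trans (cabs_Re _))// cabsM cu mul1r bf//.
Qed.

Lemma cd_ray w x : cd (fun y : R => y%:C * w : C) x w.
Proof.
have h := @cdM _ _ _ x _ _ (cdR (is_derive_id x 1)) (@cd_cst _ w x).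
by apply: cd_eq h _; rewrite /= mul1r mulr0 addr0.
Qed.

Lemma cexp_bnd1 w : cabs (cexp w - 1) <= cabs w * expR (cabs w).
Proof.
have h := @cd_mvi (fun y => cexp (y%:C * w)) (fun y => w * cexp (y%:C * w)) (cabs w * expR (cabs w)).
have e1 : cexp (1%:C * w) = cexp w by congr cexp; rewrite rmorph1 mul1r.
have e0 : cexp (0%:C * w) = 1 by rewrite -cexp0; congr cexp; rewrite rmorph0 mul0r.
rewrite -[in leLHS]e1 -e0; apply: h => x hx; first exact: cd_cexp (@cd_ray w x).
rewrite cabsM ler_wpM2l ?cabs_ge0// cabs_cexp ler_expR.
rewrite (le_trans (ler_norm _))// (le_trans (cabs_Re _))// cabsM cabsR.
by case/andP: hx => x0 x1; rewrite ger0_norm// ler_piMl// cabs_ge0.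
Qed.

Lemma cexp_bnd2 w : cabs (cexp w - 1 - w) <= cabs w ^+ 2 * expR (cabs w).
Proof.
have h := @cd_mvi (fun y => cexp (y%:C * w) - y%:C * w) (fun y => w * cexp (y%:C * w) - w) (cabs w ^+ 2 * expR (cabs w)).
have e1 : cexp (1%:C * w) - 1%:C * w = cexp w - w by rewrite rmorph1 mul1r.
have e0 : cexp (0%:C * w) - 0%:C * w = 1 by rewrite rmorph0 mul0r subr0 cexp0.
have -> : cexp w - 1 - w = (cexp (1%:C * w) - 1%:C * w) - (cexp (0%:C * w) - 0%:C * w).
  by rewrite e1 e0 addrAC.
apply: h => x hx; first exact: (cdD (cd_cexp (@cd_ray w x)) (cdN (@cd_ray w x))).
have -> : w * cexp (x%:C * w) - w = w * (cexp (x%:C * w) - 1) by rewrite mulrBr mulr1.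
rewrite cabsM expr2 -mulrA ler_wpM2l ?cabs_ge0// (le_trans (cexp_bnd1 _))//.
have hw : cabs (x%:C * w) <= cabs w.
  by case/andP: hx => x0 x1; rewrite cabsM cabsR ger0_norm// ler_piMl// cabs_ge0.
by rewrite ler_pM ?cabs_ge0 ?expR_ge0// ler_expR.
Qed.

Definition lnr n : R := ln (n.+2%:R) - ln (n.+1%:R).

Lemma natS2 (K : numFieldType) n : n.+2%:R = n.+1%:R + 1 :> K.
Proof. by rewrite natr1. Qed.

Lemma RinvC n : ((n%:R : R)^-1)%:C = n%:R^-1 :> C.
Proof. by rewrite fmorphV rmorph_nat. Qed.

Lemma lnr_bnd n : n.+2%:R^-1 <= lnr n <= n.+1%:R^-1.
Proof.
have p1 : 0 < n.+1%:R :> R by rewrite ltr0n.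
have p2 : 0 < n.+2%:R :> R by rewrite ltr0n.
have e : lnr n = ln (n.+2%:R / n.+1%:R) by rewrite /lnr ln_div ?posrE.
have e' : - lnr n = ln (n.+1%:R / n.+2%:R) by rewrite /lnr ln_div ?posrE// opprB.
apply/andP; split; last first.
  have -> : n.+1%:R^-1 = n.+2%:R / n.+1%:R - 1 :> R by rewrite natS2; field; lra.
  rewrite e -{1}[_ / _](subrKC 1) le_ln1Dx// ltrBrDl subrr divr_gt0//.
rewrite -lerN2 e'.
have -> : - n.+2%:R^-1 = n.+1%:R / n.+2%:R - 1 :> R.
  by rewrite natS2; field; lra.
rewrite -{1}[_ / _](subrKC 1) le_ln1Dx// ltrBrDl subrr divr_gt0//.
Qed.

(* Partial Gauss products of Q s = 1 / Gamma (s + 1). *)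
Definition Qs s n := rf (s + 1) n.+1 * cexp (- (s * (ln (n.+1%:R : R))%:C)).
Definition rho s n := (1 + s / n.+2%:R) * cexp (- (s * (lnr n)%:C)).

Lemma QsS s n : Qs s n.+1 = Qs s n * rho s n.
Proof.
rewrite /Qs /rho /lnr rfSE.
have -> : - (s * (ln (n.+2%:R : R))%:C) = - (s * (ln (n.+1%:R : R))%:C) + - (s * (ln (n.+2%:R : R) - ln (n.+1%:R))%:C).
  by rewrite rmorphB /=; ring.
rewrite cexpD.
have -> : (s + 1 + n.+1%:R) * rf (s + 1) n.+1 / n.+2%:R = rf (s + 1) n.+1 * (1 + s / n.+2%:R).
  by rewrite -addrA nat1r mulrAC mulrC mulrDl divff ?natS_neq0// [s / _ + _]addrC.
ring.
Qed.

Lemma Qs0 s : Qs s 0 = 1 + s.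
Proof. by rewrite /Qs ln1 mulr0 oppr0 cexp0 mulr1 rfSE rf0 addr0 mulr1 divr1 addrC. Qed.

(** Constant of [rho_bnd]: 1 comes from the linear parts, and S exp S once from the remainder of the
    exponential and once from the cross term. *)
Definition kap (S : R) : R := 1 + S * 2 * expR S.
Definition isq n : R := n.+1%:R ^- 2.

Lemma kap_ge1 S : 0 <= S -> 1 <= kap S.
Proof. by move=> h; rewrite /kap lerDl !mulr_ge0// expR_ge0. Qed.

Lemma isq_ge0 n : 0 <= isq n.
Proof. by rewrite invr_ge0 exprn_ge0. Qed.

Lemma isq_sum N : \sum_(0 <= k < N) isq k <= 2.
Proof.
(* The sharper bound is the one that passes through the induction, since 1 / (k + 1)^2 <= 1 / k - 1
   / (k + 1). *)
suff h M : \sum_(0 <= k < M.+1) isq k <= 2 - M.+1%:R^-1.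
  case: N => [|N]; first by rewrite big_geq.
  by rewrite (le_trans (h N))// gerBl invr_ge0.
elim: M => [|M IH]; first by rewrite big_nat1 /isq expr1n invr1; lra.
rewrite psumS (le_trans (lerD IH (lexx _)))// /isq.
have p1 : 0 < M.+1%:R :> R by rewrite ltr0n.
have -> : 2 - M.+2%:R^-1 = 2 - M.+1%:R^-1 + (M.+1%:R * M.+2%:R)^-1 :> R.
  by rewrite natS2; field; lra.
rewrite lerD2l expr2 lef_pV2 ?posrE ?mulr_gt0 ?ltr0n// ler_wpM2r// ler_nat//.
Qed.

(** With a = s / (n + 2) and b = - s [lnr n], [rho] is (1 + a) exp b, and a + b is of order |s| / (n
    + 1)^2. The factor |s| is kept outside so that difference quotients at s = 0 are dominated
    too. *)
Lemma rho_bnd S s n : cabs s <= S -> cabs (rho s n - 1) <= cabs s * (kap S * isq n).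
Proof.
move=> sS; have [l1 l2] := andP (lnr_bnd n).
have p1 : 0 < n.+1%:R :> R by rewrite ltr0n.
have p2 : 0 < n.+2%:R :> R by rewrite ltr0n.
have n1 : n.+1%:R^-1 <= 1 :> R by rewrite invf_le1// ler1n.
have l0 : 0 <= lnr n by apply: le_trans l1; rewrite invr_ge0.
have S0 : 0 <= S by apply: le_trans sS; exact: cabs_ge0.
pose a := s / n.+2%:R; pose b := - (s * (lnr n)%:C).
have -> : rho s n - 1 = (cexp b - 1 - b) + (a + b) + a * (cexp b - 1) by rewrite /rho -/a -/b; ring.
have ib : cabs b <= cabs s * n.+1%:R^-1.
  by rewrite /b cabsN cabsM cabsR ger0_norm// ler_wpM2l ?cabs_ge0.
have ib' : cabs b <= S by rewrite (le_trans ib)// (le_trans _ sS)// ler_piMr ?cabs_ge0.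
have ia : cabs a <= cabs s * n.+1%:R^-1.
  rewrite /a cabsM cabsV cabs_nat ler_wpM2l ?cabs_ge0// lef_pV2 ?posrE//.
  by rewrite ler_nat.
have eb : expR (cabs b) <= expR S by rewrite ler_expR.
rewrite (le_trans (cabsD _ _))// cabsM.
have -> : cabs s * (kap S * isq n) = (cabs s * isq n + cabs s * isq n * S * expR S) + cabs s * isq n * S * expR S.
  by rewrite /kap; ring.
have isqE : isq n = n.+1%:R^-1 * n.+1%:R^-1 by rewrite /isq expr2 invfM.
have B2 : cabs b * cabs b * expR (cabs b) <= cabs s * isq n * S * expR S.
  apply: ler_pM => //; rewrite ?mulr_ge0 ?cabs_ge0 ?expR_ge0//.
  apply: (le_trans (ler_pM (cabs_ge0 _) (cabs_ge0 _) ib ib)).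
  rewrite mulrACA -isqE mulrAC ler_wpM2l// mulr_ge0 ?cabs_ge0 ?isq_ge0//.
apply: lerD; last first.
  have := cexp_bnd1 b => h.
  apply: le_trans (ler_wpM2l (cabs_ge0 a) h) _; rewrite mulrA.
  apply: ler_pM => //; rewrite ?mulr_ge0 ?cabs_ge0 ?expR_ge0//.
  apply: (le_trans (ler_pM (cabs_ge0 _) (cabs_ge0 _) ia ib)).
  rewrite mulrACA -isqE mulrAC ler_wpM2l// mulr_ge0 ?cabs_ge0 ?isq_ge0//.
rewrite (le_trans (cabsD _ _))// addrC; apply: lerD; last first.
  by apply: le_trans (cexp_bnd2 b) _; rewrite expr2.
have -> : a + b = s * (n.+2%:R^-1 - lnr n)%:C.
  have -> : (n.+2%:R^-1 - lnr n)%:C = (n.+2%:R^-1)%:C - (lnr n)%:C by rewrite rmorphB.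
  by rewrite RinvC mulrBr.
rewrite cabsM cabsR ler_wpM2l ?cabs_ge0// distrC ger0_norm ?subr_ge0//.
apply: (@le_trans _ _ (n.+1%:R^-1 - n.+2%:R^-1)); first by rewrite lerB.
rewrite isqE.
have -> : n.+1%:R^-1 - n.+2%:R^-1 = n.+1%:R^-1 * n.+2%:R^-1 :> R.
  by rewrite natS2; field; lra.
by rewrite ler_wpM2l ?invr_ge0// lef_pV2 ?posrE// ler_nat.
Qed.

Definition Qbnd (S : R) : R := (1 + S) * expR (S * (kap S * 2)).

Lemma Qs_bnd S s n : cabs s <= S -> cabs (Qs s n) <= Qbnd S.
Proof.
move=> sS; have S0 : 0 <= S by apply: le_trans sS; exact: cabs_ge0.
have k0 : 0 <= kap S by apply: le_trans (kap_ge1 S0).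
have h : cabs (Qs s n) <= (1 + S) * expR (S * (kap S * \sum_(0 <= k < n) isq k)).
  elim: n => [|n IH].
    by rewrite big_geq// !mulr0 expR0 mulr1 Qs0 (le_trans (cabsD _ _))// cabs1 lerD2l.
  rewrite QsS cabsM psumS !mulrDr expRD mulrA.
  apply: ler_pM => //; rewrite ?cabs_ge0//.
  have -> : rho s n = 1 + (rho s n - 1) by rewrite addrC subrK.
  rewrite (le_trans (cabsD _ _))// cabs1 (le_trans _ (expR_ge1Dx _))// lerD2l.
  apply: le_trans (rho_bnd n sS) _; apply: ler_wpM2r => //.
  by rewrite mulr_ge0// isq_ge0.
apply: le_trans h _; rewrite ler_wpM2l ?addr_ge0// ler_expR !ler_wpM2l//; exact: isq_sum.
Qed.

Definition Dq s k := Qs s k.+1 - Qs s k.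

Lemma Dq_bnd S s k : cabs s <= S -> cabs (Dq s k) <= cabs s * (Qbnd S * kap S * isq k).
Proof.
move=> sS; rewrite /Dq QsS -{2}[Qs s k]mulr1 -mulrBr cabsM.
apply: (le_trans (ler_pM (cabs_ge0 _) (cabs_ge0 _) (Qs_bnd k sS) (rho_bnd k sS))).
by rewrite mulrCA !mulrA.
Qed.

Lemma Qbnd_ge0 S : 0 <= S -> 0 <= Qbnd S.
Proof. by move=> h; rewrite mulr_ge0 ?addr_ge0// expR_ge0. Qed.

Lemma Dq_sum S : 0 <= S -> forall N, \sum_(0 <= k < N) Qbnd S * kap S * isq k <= Qbnd S * kap S * 2.
Proof.
move=> S0 N; rewrite -big_distrr /= ler_wpM2l ?isq_sum// mulr_ge0 ?Qbnd_ge0//.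
exact: le_trans (kap_ge1 S0).
Qed.

(** The limit of the Gauss products, telescoped from [Qs s 0] into a series so that [tannery]
    applies to it. *)
Definition Q s := 1 + s + csum (Dq s).

Lemma Qs_cvg s : Qs s @ \oo --> Q s.
Proof.
have h : absbnd (Dq s) (cabs s * (Qbnd (cabs s) * kap (cabs s) * 2)).
  move=> N; apply: (@le_trans _ _ (\sum_(0 <= k < N) cabs s * (Qbnd (cabs s) * kap (cabs s) * isq k))).
    by apply: ler_sum => k _; exact: Dq_bnd.
  by rewrite -big_distrr /= ler_wpM2l ?cabs_ge0//; apply: Dq_sum; exact: cabs_ge0.
have hc : (fun _ : nat => 1 + s) @ \oo --> 1 + s by exact: cvgC_cst.
have h2 : (fun N => 1 + s + \sum_(0 <= k < N) Dq s k) @ \oo --> Q s.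
  exact: cvgCD hc (absbnd_hassum h).
apply: cvg_trans h2; apply: near_eq_cvg; near=> N.
rewrite telescope_sumr// Qs0; ring.
Unshelve. all: by end_near. Qed.

Lemma dnbhsCP (a : C) (P : C -> Prop) : (\forall b \near a^', P b) <->
  exists r : R, 0 < r /\ forall e, e != 0 -> cabs e < r -> P (a + e).
Proof.
split.
  rewrite /dnbhs /within /= => /(@nbhs_ballP _ (R[i]^o)) [e /= e0 h].
  have e1 : e = (Re e)%:C by rewrite RRe_real// gtr0_real.
  exists (Re e); split; first by rewrite -ltcR -e1.
  move=> d d0 de; apply: h; last by rewrite -subr_eq0 addrAC subrr add0r.
  by rewrite /ball /= opprD addrA subrr sub0r normrN cabsE e1 ltcR.
move=> [r [r0 h]]; rewrite /dnbhs /within /=; apply/(@nbhs_ballP _ (R[i]^o)).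
exists r%:C; first by rewrite /= ltcR.
move=> b; rewrite /ball /= cabsE ltcR => br ba.
have := h (b - a); rewrite subr_eq0 [a + _]addrC subrK; apply => //.
by rewrite cabsB.
Qed.

Lemma near_dnbhsC (r : R) : 0 < r -> \forall e \near (0 : C)^', e != 0 /\ cabs e < r.
Proof. by move=> r0; apply/dnbhsCP; exists r; split => // e e0 er; rewrite add0r. Qed.

Lemma dnbhsC_shift (f : C -> C) (a l : C) : f @ a^' --> l <-> (fun e => f (a + e)) @ (0 : C)^' --> l.
Proof.
split=> /cvgCP h; apply/cvgCP => e /h /dnbhsCP[r [r0 hr]]; apply/dnbhsCP; exists r; split => // d d0 dr.
  by rewrite add0r; exact: hr.
by have := hr d d0 dr; rewrite add0r.
Qed.

Lemma cvg_lin (f : C -> C) (l : C) (K r : R) : 0 < r ->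
  (forall e, e != 0 -> cabs e < r -> cabs (f e - l) <= cabs e * K) -> f @ (0 : C)^' --> l.
Proof.
move=> r0 h; apply/cvgCP => d d0.
have K0 : 0 < `|K| + 1 by rewrite ltr_wpDl.
have m0 : 0 < Num.min r (d / (`|K| + 1)) by rewrite lt_min r0 divr_gt0.
move: (near_dnbhsC m0); apply: filterS => e [e0]; rewrite lt_min => /andP[er ed].
apply: le_lt_trans (h e e0 er) _.
apply: (@le_lt_trans _ _ (cabs e * `|K|)); first by rewrite ler_wpM2l ?cabs_ge0// ler_norm.
rewrite ltr_pdivlMr// in ed; apply: le_lt_trans ed.
by rewrite ler_wpM2l ?cabs_ge0// lerDl.
Qed.

Definition dC (f : C -> C) (a l : C) := (fun e => e^-1 * (f (a + e) - f a)) @ (0 : C)^' --> l.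

Lemma dC_cont f a l : dC f a l -> (fun e => f (a + e)) @ (0 : C)^' --> f a.
Proof.
move=> h; have hid : (fun e : C => e) @ (0 : C)^' --> (0 : C).
  by apply: (@cvg_lin _ _ 1 1) => // e _ _; rewrite subr0 mulr1.
have h2 : (fun e => e * (e^-1 * (f (a + e) - f a)) + f a) @ (0 : C)^' --> 0 * l + f a.
  have hc : (fun _ : C => f a) @ (0 : C)^' --> f a by exact: cvgC_cst.
  exact: (cvgCD (cvgCM hid h) hc).
rewrite mul0r add0r in h2; apply: cvg_trans h2; apply: near_eq_cvg.
move: (near_dnbhsC (@ltr01 R)); apply: filterS => e [e0 _].
by rewrite mulVKf// subrK.
Qed.

Lemma dC_cst c a : dC (fun=> c) a 0.
Proof.
apply: (@cvg_lin _ _ 0 1) => // e _ _.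
by rewrite subrr mulr0 subr0 cabs0 mulr0.
Qed.

Lemma dC_id a : dC id a 1.
Proof.
apply: (@cvg_lin _ _ 0 1) => // e e0 _.
by rewrite addrAC subrr add0r mulVf// subrr cabs0 mulr0.
Qed.

Arguments dC_cst : clear implicits.
Arguments dC_id : clear implicits.
Lemma dCM f g a l m : dC f a l -> dC g a m -> dC (fun s => f s * g s) a (l * g a + f a * m).
Proof.
have hc : (fun _ : C => f a) @ (0 : C)^' --> f a by exact: cvgC_cst.
move=> hf hg; have h := cvgCD (cvgCM hf (dC_cont hg)) (cvgCM hc hg).
have E : (fun e => e^-1 * (f (a + e) * g (a + e) - f a * g a)) =
   (fun e => e^-1 * (f (a + e) - f a) * g (a + e) + f a * (e^-1 * (g (a + e) - g a))).
  by apply/funext => e; ring.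
by rewrite /dC E; exact: h.
Qed.

Lemma dCD f g a l m : dC f a l -> dC g a m -> dC (fun s => f s + g s) a (l + m).
Proof.
move=> hf hg; have h := cvgCD hf hg.
have E : (fun e => e^-1 * (f (a + e) + g (a + e) - (f a + g a))) =
   (fun e => e^-1 * (f (a + e) - f a) + e^-1 * (g (a + e) - g a)).
  by apply/funext => e; ring.
by rewrite /dC E; exact: h.
Qed.

Lemma dCV f a l : f a != 0 -> dC f a l -> dC (fun s => (f s)^-1) a (- l / f a ^+ 2).
Proof.
move=> fa hf; have hc := dC_cont hf.
have hc' : (fun _ : C => (f a)^-1) @ (0 : C)^' --> (f a)^-1 by exact: cvgC_cst.
have h : (fun e => - (e^-1 * (f (a + e) - f a)) * ((f (a + e))^-1 * (f a)^-1)) @ (0 : C)^' -->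
    - l * ((f a)^-1 * (f a)^-1) by exact: (cvgCM (cvgCN hf) (cvgCM (cvgCV fa hc) hc')).
have -> : - l / f a ^+ 2 = - l * ((f a)^-1 * (f a)^-1) by rewrite expr2 invfM.
apply: cvg_trans h; apply: near_eq_cvg.
have n0 : \forall e \near (0 : C)^', f (a + e) != 0.
  move/cvgCP : hc => /(_ (cabs (f a))); rewrite cabs_gt0 => /(_ fa).
  by apply: filterS => e; apply: contraTneq => ->; rewrite sub0r cabsN ltxx.
apply: filterS n0 => e fe.
have -> : (f (a + e))^-1 - (f a)^-1 = - (f (a + e) - f a) * ((f (a + e))^-1 / f a).
  by field; rewrite fe fa.
ring.
Qed.

Lemma dC_near f g a l : f a = g a -> (\forall e \near (0 : C)^', f (a + e) = g (a + e)) -> dC f a l -> dC g a l.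
Proof.
by move=> fg h; apply: cvgC_near; apply: filterS h => e ->; rewrite fg.
Qed.

Lemma dC_shift f a b l : dC f (a + b) l -> dC (fun s => f (s + b)) a l.
Proof.
rewrite /dC; have -> // : (fun e => e^-1 * (f (a + b + e) - f (a + b))) = (fun e => e^-1 * (f (a + e + b) - f (a + b))).
by apply/funext => e; rewrite addrAC.
Qed.

Lemma dC_cexp0 c : dC (fun s => cexp (s * c)) 0 c.
Proof.
apply: (@cvg_lin _ _ (cabs c ^+ 2 * expR (cabs c)) 1) => // e e0 e1.
rewrite add0r mul0r cexp0.
have -> : e^-1 * (cexp (e * c) - 1) - c = e^-1 * (cexp (e * c) - 1 - e * c) by field.
rewrite cabsM cabsV ler_pdivrMl ?cabs_gt0//.
apply: le_trans (cexp_bnd2 _) _; rewrite cabsM exprMn {1}expr2 -!mulrA !ler_wpM2l ?exprn_ge0 ?cabs_ge0//.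
by rewrite ler_expR ler_piMl ?cabs_ge0// ltW.
Qed.

Arguments dC_cexp0 : clear implicits.

Lemma rho0 n : rho 0 n = 1.
Proof. by rewrite /rho mul0r addr0 mul0r oppr0 cexp0 mulr1. Qed.

Lemma drho n : dC (rho^~ n) 0 (n.+2%:R^-1 - (lnr n)%:C).
Proof.
have h1 := dCD (dC_cst 1 0) (dCM (dC_id 0) (dC_cst (n.+2%:R^-1) 0)).
have h2 := dC_cexp0 (- (lnr n)%:C).
have := dCM h1 h2; rewrite !mul0r !(mulr0, addr0, add0r, mul1r, cexp0, mulr1).
by under eq_fun do rewrite mulrN.
Qed.

Arguments drho : clear implicits.

Lemma Qs_at0 n : Qs 0 n = 1.
Proof. by elim: n => [|n IH]; rewrite ?QsS ?IH ?rho0 ?mulr1// Qs0 addr0. Qed.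

Lemma Qs_cvg0 n : (Qs^~ n : C -> C) @ (0 : C)^' --> (1 : C).
Proof.
elim: n => [|n IH].
  apply: (@cvg_lin _ _ 1 1) => // e _ _.
  by rewrite Qs0 addrAC subrr add0r mulr1.
have h : (rho^~ n : C -> C) @ (0 : C)^' --> (1 : C).
  have := dC_cont (drho n); rewrite rho0.
  by under eq_fun do rewrite add0r.
have h2 : (fun s => Qs s n * rho s n) @ (0 : C)^' --> 1 * (1 : C) by exact: (cvgCM IH h).
rewrite mulr1 in h2; apply: cvg_trans h2; apply: near_eq_cvg; near=> e; by rewrite QsS.
Unshelve. all: by end_near.
Qed.

Lemma Q0 : Q 0 = 1.
Proof.
have h := @Qs_cvg 0; apply: (cvgC_unique h).
have -> : Qs 0 = fun _ : nat => 1 :> C by apply/funext => n; rewrite Qs_at0.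
exact: cvgC_cst.
Qed.

(** By [Dq_bnd] each increment carries a factor |e|, so the termwise difference quotients have a
    summable bound independent of e. The point 0 suffices: the recurrence of 1/Gamma carries the
    derivative to the other integers. *)
Lemma Q_diff0 : exists l, dC Q 0 l.
Proof.
pose g k := (k.+2%:R^-1 - (lnr k)%:C : C).
have [] := @tannery R C (0 : C)^' _ (fun e k => e^-1 * Dq e k) g
   (fun k => Qbnd 1 * kap 1 * isq k) _ (Dq_sum ler01).
- move: (near_dnbhsC (@ltr01 R)); apply: filterS => e [e0 e1] k.
  rewrite cabsM cabsV ler_pdivrMl ?cabs_gt0//; apply: Dq_bnd; exact: ltW.
- move=> k; have h : (fun e => Qs e k * (e^-1 * (rho (0 + e) k - rho 0 k))) @ (0 : C)^' --> 1 * g k.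
    exact: (cvgCM (Qs_cvg0 k) (drho k)).
  rewrite mul1r rho0 in h; apply: cvg_trans h; apply: near_eq_cvg; near=> e.
  by rewrite /Dq QsS add0r; ring.
move=> _ h; exists (1 + csum g).
have hc : (fun _ : C => 1) @ (0 : C)^' --> (1 : C) by exact: cvgC_cst.
have h2 : (fun e => 1 + csum (fun k => e^-1 * Dq e k)) @ (0 : C)^' --> 1 + csum g by exact: (cvgCD hc h).
apply: cvg_trans h2; apply: near_eq_cvg.
move: (near_dnbhsC (@ltr01 R)); apply: filterS => e [e0 e1].
rewrite Q0 add0r /Q.
have -> : csum (fun k => e^-1 * Dq e k) = e^-1 * csum (Dq e).
  apply: hassum_csum; apply: hassumZ; apply: absbnd_hassum => N.
  apply: (@le_trans _ _ (\sum_(0 <= k < N) Qbnd 1 * kap 1 * isq k)); last exact: Dq_sum.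
  apply: ler_sum => k _; apply: le_trans (Dq_bnd k (ltW e1)) _.
  have k0 : 0 <= kap 1 by rewrite (le_trans _ (kap_ge1 ler01)).
  apply: ler_piMl; last exact: ltW.
  by rewrite mulr_ge0 ?isq_ge0// mulr_ge0// Qbnd_ge0.
have -> : 1 + e + csum (Dq e) - 1 = e + csum (Dq e) by ring.
by rewrite mulrDr mulVf.
Unshelve. all: by end_near. Qed.

End ReciprocalGammaProduct.
Arguments dC_id {R} a.
Arguments dC_cst {R} c a.
Arguments dC_cexp0 {R} c.
Arguments drho {R} n.
Arguments Qs_cvg {R} s.

(** * Recurrence, zeros and derivatives of 1/Gamma *)

Section ReciprocalGamma.
Variable R : realType.
Local Notation C := R[i].
Implicit Types (s z w t e : C) (x r : R).
Local Notation Re := complex.Re.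
Local Notation Im := complex.Im.

Lemma cvg_invn : (fun n : nat => n.+1%:R^-1 : C) @ \oo --> (0 : C).
Proof.
apply/cvgC_cabs; have := @cvg_harmonic R.
apply: cvg_trans; apply: near_eq_cvg; near=> n.
by rewrite subr0 cabsV cabs_nat.
Unshelve. all: by end_near. Qed.

(** At finite n the two sides differ by the factor 1 + (s + 1) / (n + 1), which tends to 1. *)
Lemma Q_rec s : (s + 1) * Q (s + 1) = Q s.
Proof.
have hc : (fun _ : nat => s + 1) @ \oo --> s + 1 by exact: cvgC_cst.
have h1 : (fun n => (s + 1) * Qs (s + 1) n) @ \oo --> (s + 1) * Q (s + 1).
  exact: (cvgCM hc (Qs_cvg (s + 1))).
have h2 : (fun n => Qs s n * (1 + (s + 1) * n.+1%:R^-1)) @ \oo --> Q s * (1 + (s + 1) * 0).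
  apply: (cvgCM (Qs_cvg s)).
  have hc1 : (fun _ : nat => 1) @ \oo --> (1 : C) by exact: cvgC_cst.
  exact: (cvgCD hc1 (cvgCM hc cvg_invn)).
rewrite mulr0 addr0 mulr1 in h2; apply: (cvgC_unique h1).
apply: cvg_trans h2; apply: near_eq_cvg; near=> n.
symmetry; rewrite /Qs mulrA rf_first rfS.
have -> : - ((s + 1) * (ln (n.+1%:R : R))%:C) = - (s * (ln (n.+1%:R : R))%:C) + - (ln (n.+1%:R : R))%:C by ring.
rewrite cexpD (cexpN (ln n.+1%:R)%:C) cexp_real lnK ?posrE ?ltr0n// rmorph_nat.
by field; rewrite nat1r natS_neq0.
Unshelve. all: by end_near. Qed.

Lemma rgammaE s : rgamma s = s * Q s.
Proof.
apply: cvgC_lim.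
have hc : (fun _ : nat => s) @ \oo --> s by exact: cvgC_cst.
have h : (fun n => s * Qs s n) @ \oo --> s * Q s by exact: (cvgCM hc (Qs_cvg s)).
rewrite -(@cvg_shiftS (R[i]^o)).
apply: cvg_trans h; apply: near_eq_cvg; near=> n.
rewrite /Qs mulrA rf_first /rf [RHS]/=.
have -> : cpow n.+1%:R s = (cexp (- (s * (ln (n.+1%:R : R))%:C)))^-1.
  rewrite /cpow -(rmorph_nat (real_complex R)) cLog_real ?ltr0n//.
  by rewrite cexpN invrK.
rewrite invfM invrK factS natrM; field.
by rewrite fact_neq0 /= -natrD natS_neq0.
Unshelve. all: by end_near. Qed.

Lemma rgammaS s : rgamma (s + 1) = Q s.
Proof. by rewrite rgammaE Q_rec. Qed.

Lemma rgamma_rec s : rgamma s = s * rgamma (s + 1).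
Proof. by rewrite rgammaS rgammaE. Qed.

Lemma rgamma1 : rgamma (1 : C) = 1.
Proof. by rewrite -[X in rgamma X]add0r rgammaS Q0. Qed.

Lemma rgammaN_nat n : rgamma (- n%:R : C) = 0.
Proof.
elim: n => [|n IH]; first by rewrite oppr0 rgamma_rec mul0r.
by rewrite rgamma_rec -natr1 opprD subrK IH mulr0.
Qed.

(** No factor of the product vanishes, and beyond some K the moduli are at least 1 - b_k with the
    b_k summing to at most 1/2. Hence |[Qs t N]| >= |[Qs t K]| / 2 for N >= K, which excludes the
    limit 0. *)
Lemma rgamma_neq0 s : (forall n, s != - n%:R) -> rgamma s != 0.
Proof.
suff h t : (forall n : nat, t + 1 + n%:R != 0) -> Q t != 0.
  move=> hs; rewrite rgammaE mulf_neq0//.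
    by have := hs 0%N; rewrite oppr0.
  by apply: h => n; rewrite -addrA nat1r addr_eq0.
move=> ht.
have tq n : rho t n != 0.
  rewrite mulf_neq0 ?cexp_neq0//.
  have -> : 1 + t / n.+2%:R = (t + 1 + n.+1%:R) / n.+2%:R.
    by rewrite -addrA nat1r mulrDl divff ?natS_neq0// addrC.
  by rewrite mulf_neq0 ?ht// invr_eq0 natS_neq0.
have Qn0 n : Qs t n != 0.
  elim: n => [|n IH]; last by rewrite QsS mulf_neq0.
  by rewrite Qs0 addrC; have := ht 0%N; rewrite addr0.
pose S := cabs t.
have k0 : 0 <= S * kap S by rewrite mulr_ge0 ?cabs_ge0// (le_trans _ (kap_ge1 _)) ?cabs_ge0.
have r1 n : 1 - S * kap S * isq R n <= cabs (rho t n).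
  have := @rho_bnd _ S t n (lexx _) => h.
  have : cabs (1 : C) - cabs (1 - rho t n) <= cabs (rho t n).
    by rewrite lerBlDl -[in leLHS](subrK (rho t n) 1) cabsD.
  rewrite cabs1 cabsB; move: h; rewrite mulrA -/S; lra.
have [K hK] := @bnd_tail _ (fun n => S * kap S * isq R n) (S * kap S * 2)
   (fun n => mulr_ge0 k0 (isq_ge0 _ n))
   (fun N => ltac:(rewrite -big_distrr /=; exact: ler_wpM2l k0 _ _ (isq_sum R N))) (2^-1) (ltac:(by rewrite invr_gt0)).
(* This is the inequality prod (1 - b_k) >= 1 - sum b_k, started at K. *)
have low N : (K <= N)%N -> cabs (Qs t K) * (1 - \sum_(K <= k < N) S * kap S * isq R k) <= cabs (Qs t N).
  elim: N => [|N IH]; first by rewrite leqn0 => /eqP ->; rewrite big_geq// subr0 mulr1.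
  rewrite leq_eqVlt => /predU1P[->|]; first by rewrite big_geq// subr0 mulr1.
  rewrite ltnS => KN; rewrite big_nat_recr//= QsS (cabsM (Qs t N)).
  have := IH KN; set A := \sum_(K <= k < N) _; set b := S * kap S * isq R N => h.
  have b0 : 0 <= b by rewrite mulr_ge0// isq_ge0.
  have A0 : 0 <= A by rewrite sumr_ge0// => i _; rewrite mulr_ge0// isq_ge0.
  have A1 : A + b <= 2^-1 by have := hK N.+1; rewrite big_nat_recr.
  apply: (@le_trans _ _ (cabs (Qs t K) * (1 - A) * (1 - b))).
    rewrite -mulrA ler_wpM2l ?cabs_ge0//; nra.
  apply: ler_pM => //; rewrite ?mulr_ge0 ?cabs_ge0//; lra || exact: r1.
have Qt := Qs_cvg t.
apply/eqP => Qt0; rewrite Qt0 in Qt.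
have q0 : 0 < cabs (Qs t K) / 2 by rewrite divr_gt0// cabs_gt0.
move/cvgCP : Qt => /(_ _ q0)[N _ hN].
have := hN (N + K)%N (leq_addr _ _); rewrite subr0 => /= h1.
have := low (N + K)%N (leq_addl _ _) => h2; have := hK (N + K)%N => h3.
have : cabs (Qs t K) * (1 - 2^-1) <= cabs (Qs t K) * (1 - \sum_(K <= k < N + K) S * kap S * isq R k).
  by rewrite ler_wpM2l ?cabs_ge0//; lra.
by lra.
Qed.

(** Starting from the point 1, 1/Gamma (s) = s / Gamma (s + 1) is used with a division by s to go up
    and with a product by s to go down. *)
Lemma drgamma_int (m : int) : exists l, dC (@rgamma R) m%:~R l.
Proof.
have [g hg] := Q_diff0 R.
have h1 : dC (@rgamma R) 1 g.
  have -> : @rgamma R = fun s => Q (s - 1) by apply/funext => s; rewrite -rgammaS subrK.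
  by apply: dC_shift; rewrite subrr.
have up n : exists l, dC (@rgamma R) (n.+1%:R) l.
  elim: n => [|n [l hl]]; first by exists g.
  have n0 : (n.+1%:R : C) != 0 by exact: natS_neq0.
  have hi := @dCV _ id n.+1%:R 1 n0 (dC_id _).
  have hm := dCM hl hi.
  exists (l / n.+1%:R + rgamma n.+1%:R * (- 1 / n.+1%:R ^+ 2)).
  have h2 : dC (fun s => rgamma (s + 1)) n.+1%:R (l / n.+1%:R + rgamma n.+1%:R * (- 1 / n.+1%:R ^+ 2)).
    apply: dC_near hm; first by rewrite rgamma_rec mulrAC mulfV ?mul1r.
    have : \forall e \near (0 : C)^', e != 0 /\ cabs e < 1 by exact: near_dnbhsC.
    apply: filterS => e [e0 e1]; have ne : n.+1%:R + e != 0.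
      apply: contraTneq e1 => /eqP; rewrite addrC addr_eq0 => /eqP ->.
      by rewrite cabsN cabs_nat -leNgt ler1n.
    by rewrite rgamma_rec mulrAC mulfV ?mul1r.
  move: h2; set L := _ / _ + _ => h2; clearbody L.
  have -> : @rgamma R = fun s => (fun z => rgamma (z + 1)) (s + -1) by apply/funext => s; rewrite subrK.
  apply: (@dC_shift _ (fun z => rgamma (z + 1)) _ (-1)); have -> : n.+2%:R + -1 = n.+1%:R :> C by rewrite -natr1 addrK.
  exact: h2.
have dn n : exists l, dC (@rgamma R) (1 - n%:R) l.
  elim: n => [|n [l hl]]; first by exists g; rewrite subr0.
  have h2 : dC (fun s => rgamma (s + 1)) (1 - n.+1%:R) l.
    by apply: dC_shift; rewrite -natr1 opprD addrA subrK.
  have h3 := dCM (dC_id (1 - n.+1%:R)) h2.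
  move: h3; set L := 1 * _ + _ => h3; clearbody L; exists L.
  have -> : @rgamma R = fun s => s * rgamma (s + 1) by apply/funext => s; exact: rgamma_rec.
  exact: h3.
case: m => [[|n]|n].
- by have := dn 1%N; rewrite subrr.
- exact: up.
- have := dn n.+2; rewrite NegzE mulrNz -[n.+2]add1n natrD opprD addrA subrr add0r.
  by rewrite pmulrn.
Qed.

(* The derivative of 1/Gamma at the integer m, where it exists by [drgP]. *)
Definition drg (m : int) : C := xget 0 (dC (@rgamma R) m%:~R).

Lemma drgP m : dC (@rgamma R) m%:~R (drg m).
Proof. by have [l hl] := drgamma_int m; apply: (@xgetPex _ 0 (dC (@rgamma R) m%:~R)); exists l. Qed.

Arguments drgP : clear implicits.
Lemma drg_rec m : drg m = rgamma (m%:~R + 1) + m%:~R * drg (m + 1).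
Proof.
have h1 := drgP m.
have h2 : dC (fun s => rgamma (s + 1)) m%:~R (drg (m + 1)).
  by apply: dC_shift; have := drgP (m + 1); rewrite intrD.
have h3 := dCM (dC_id m%:~R) h2.
have E : @rgamma R = fun s => s * rgamma (s + 1) by apply/funext => s; exact: rgamma_rec.
rewrite {1}E in h1; rewrite mul1r in h3.
exact: cvgC_unique h1 h3.
Qed.

(** The zeros of 1/Gamma at 0, -1, -2, ... are simple: differentiating the recurrence there leaves
    only -(n + 1) times the derivative at -n, and the derivative at 0 is 1. It supplies the leading
    coefficient of K of integer order. *)
Lemma drgN_neq0 n : drg (- n%:Z) != 0.
Proof.
elim: n => [|n IH].
  by rewrite oppr0 drg_rec mul0r addr0 add0r rgamma1 oner_eq0.
have E : - n.+1%:Z + 1 = - n%:Z by rewrite -addn1 PoszD opprD subrK.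
rewrite drg_rec E.
have -> : (- n.+1%:Z)%:~R + 1 = - n%:R :> C by rewrite -[1]/(1%:~R) -intrD E mulrNz.
by rewrite rgammaN_nat add0r mulf_neq0// mulrNz oppr_eq0 -pmulrn natS_neq0.
Qed.

(** By the recurrence, the modulus does not increase with k once |a + k + 1| >= 1; the earlier
    values are finitely many. *)
Lemma rgamma_bnd a : exists B, forall k : nat, cabs (rgamma (a + k%:R + 1 : C)) <= B.
Proof.
have [K hK] := ex_natbnd (cabs a + 1).
suff [B hB] : exists B, forall k, (K <= k)%N -> cabs (rgamma (a + k%:R + 1 : C)) <= B.
  exists (B + \sum_(i < K) cabs (rgamma (a + i%:R + 1))) => k.
  have B0 : 0 <= B by apply: le_trans (hB K _) => //; exact: cabs_ge0.
  have [Kk|kK] := leqP K k.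
    by rewrite (le_trans (hB _ Kk))// lerDl sumr_ge0// => i _; exact: cabs_ge0.
  rewrite (bigD1 (Ordinal kK))//= addrCA lerDl addr_ge0// sumr_ge0// => i _; exact: cabs_ge0.
exists (cabs (rgamma (a + K%:R + 1))) => k; elim: k => [|k IH].
  by rewrite leqn0 => /eqP ->.
rewrite leq_eqVlt => /predU1P[->//|]; rewrite ltnS => Kk.
apply: le_trans (IH Kk); rewrite [in leRHS]rgamma_rec cabsM.
have -> : a + k.+1%:R + 1 = a + k%:R + 1 + 1 by rewrite -natr1 addrA.
rewrite ler_peMl ?cabs_ge0//.
have h := cabs_subr (k.+1%:R : C) (- a); rewrite cabs_nat cabsN opprK in h.
have -> : a + k%:R + 1 = k.+1%:R + a by rewrite -natr1; ring.
apply: le_trans h; have : (K%:R : R) <= k.+1%:R by rewrite ler_nat ltnW// ltnS.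
by move: hK; lra.
Qed.

(** This domination in k allows I_a to be differentiated termwise in the order. Finitely many k are
    bounded by differentiability, and the recurrence of 1/Gamma propagates the bound. *)
Lemma drg_unif (m : int) : exists B, \forall e \near (0 : C)^',
  forall k : nat, cabs (e^-1 * (rgamma (m%:~R + e + k%:R + 1) - rgamma (m%:~R + k%:R + 1))) <= B.
Proof.
have [C0 hC0] := rgamma_bnd m%:~R.
have C00 : 0 <= C0 by apply: le_trans (hC0 0%N); exact: cabs_ge0.
pose D e k := cabs (e^-1 * (rgamma (m%:~R + e + k%:R + 1) - rgamma (m%:~R + k%:R + 1))).
have pt k : exists B, 0 <= B /\ \forall e \near (0 : C)^', D e k <= B.
  have [l hl] := drgamma_int (m + k%:Z + 1).
  exists (cabs l + 1); split; first by rewrite addr_ge0// cabs_ge0.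
  move/cvgCP : hl => /(_ 1 ltr01); apply: filterS => e h.
  rewrite /D; have -> : m%:~R + e + k%:R + 1 = (m + k%:Z + 1)%:~R + e by rewrite !intrD -pmulrn; ring.
  have -> : m%:~R + k%:R + 1 = (m + k%:Z + 1)%:~R :> C by rewrite !intrD -pmulrn.
  rewrite -lerBlDl; apply: le_trans (ltW h); exact: cabs_subr.
have fin K : exists B, 0 <= B /\ \forall e \near (0 : C)^', forall k, (k < K)%N -> D e k <= B.
  elim: K => [|K [B [B0 hB]]]; first by exists 0; split => //; near=> e.
  have [B' [B'0 hB']] := pt K; exists (B + B'); split; first by rewrite addr_ge0.
  move: hB hB'; apply: filterS2 => e h1 h2 k; rewrite ltnS leq_eqVlt => /predU1P[->|/h1 h].
    by rewrite (le_trans h2)// lerDr.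
  by rewrite (le_trans h)// lerDl.
have [K hK] := ex_natbnd (cabs (m%:~R : C) + 2).
have [B [B0 hB]] := fin K.+1.
exists (B + C0); move: hB (@near_dnbhsC R 2^-1 (ltac:(by rewrite invr_gt0))).
apply: filterS2 => e h [e0 e1] k; rewrite -/(D e k).
have [/h hk|] := ltnP k K.+1; first by rewrite (le_trans hk)// lerDl.
elim: k => // k IH; rewrite ltnS => Kk.
have {}IH : D e k <= B + C0.
  move: Kk; rewrite leq_eqVlt => /predU1P[<-|/IH//].
  by rewrite (le_trans (h _ _))// lerDl.
pose q : C := m%:~R + k%:R + 1.
(* From |q| >= 2 and |e| < 1/2 the recurrence has factors at most 2/3 and 1/3, so the bound B + C0
   reproduces itself. *)
have q2 : 2 <= cabs q.
  have := cabs_subr (k.+1%:R : C) (- m%:~R); rewrite cabs_nat cabsN opprK.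
  have -> : k.+1%:R + m%:~R = q :> C by rewrite /q -natr1; ring.
  have : (K%:R : R) <= k.+1%:R by rewrite ler_nat ltnW.
  by move: hK; lra.
have qe : 3 / 2 <= cabs (q + e).
  by have := cabs_subr q (- e); rewrite cabsN opprK; lra.
have q0 : q != 0 by rewrite -cabs_eq0 gt_eqF//; lra.
have qe0 : q + e != 0 by rewrite -cabs_eq0 gt_eqF//; lra.
have Dk : D e k = cabs (e^-1 * (rgamma (q + e) - rgamma q)).
  rewrite /D; have -> : m%:~R + e + k%:R + 1 = q + e by rewrite /q; ring.
  by [].
have -> : D e k.+1 = cabs (e^-1 * (rgamma (q + e) - rgamma q) / (q + e) - rgamma q / (q * (q + e))).
  rewrite /D (rgamma_rec (q + e)) (rgamma_rec q).
  have -> : m%:~R + e + k.+1%:R + 1 = q + e + 1 by rewrite /q -natr1; ring.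
  have -> : m%:~R + k.+1%:R + 1 = q + 1 by rewrite /q -natr1; ring.
  by congr cabs; field; rewrite e0 q0 qe0.
apply: le_trans (cabsD _ _) _; rewrite cabsN !cabsM [cabs (_ * _)^-1]cabsV !cabsM !cabsV.
rewrite Dk !cabsM !cabsV in IH.
have i1 : (cabs (q + e))^-1 <= 2 / 3.
  by rewrite -[2 / 3]invrK lef_pV2 ?posrE; [rewrite invf_div|lra|rewrite invr_gt0; lra].
have i2 : (cabs q * cabs (q + e))^-1 <= 1 / 3.
  have i3 : (cabs q)^-1 <= 2^-1 by rewrite lef_pV2 ?posrE//; lra.
  rewrite invfM; apply: le_trans (ler_pM _ _ i3 i1) _; rewrite ?invr_ge0 ?cabs_ge0//; lra.
have j1 := ler_pM _ _ IH i1; have j2 := ler_pM _ _ (hC0 k) i2.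
have -> : B + C0 = (B + C0) * (2/3) + (B + C0) * (1/3) by lra.
apply: lerD.
  by apply: j1; rewrite ?invr_ge0 ?cabs_ge0// mulr_ge0 ?invr_ge0 ?cabs_ge0.
apply: le_trans (j2 _ _) _; rewrite ?cabs_ge0// ?invr_ge0 ?mulr_ge0 ?cabs_ge0//.
by rewrite ler_wpM2r//; lra.
Unshelve. all: by end_near. Qed.
End ReciprocalGamma.

(** * Expansions in t of functions of x / (1 - t) *)

Section EulerDerivative.
Variable R : realType.
Local Notation C := R[i].
Implicit Types (s z w t : C) (x r : R) (f g : R -> C) (phi psi : nat -> R -> C) (F : C -> C).
Local Notation Re := complex.Re.
Local Notation Im := complex.Im.

(* theta f = g on (0, +oo), with theta = x d/dx. *)
Definition hasD f g := forall x, 0 < x -> cd f x (x%:C^-1 * g x).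

Lemma near_pos x : 0 < x -> \forall y \near x, 0 < y.
Proof. by move=> x0; exact: lt_nbhsr. Qed.

Lemma hasD_ext f f' g g' : (forall x, 0 < x -> f x = f' x) ->
  (forall x, 0 < x -> g x = g' x) -> hasD f g -> hasD f' g'.
Proof.
move=> hf hg h x x0; rewrite -hg//; apply: (cd_near _ (h x x0)).
by apply: filterS (near_pos x0) => y /hf.
Qed.

Lemma posC_neq0 x : 0 < x -> x%:C != 0 :> C.
Proof. by move=> x0; rewrite -cabs_eq0 cabsR normr_eq0 gt_eqF. Qed.

Lemma hasD_unique f g g' : hasD f g -> hasD f g' -> forall x, 0 < x -> g x = g' x.
Proof.
move=> h h' x x0; have := cd_unique (h x x0) (h' x x0).
by apply: mulfI; rewrite invr_eq0 posC_neq0.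
Qed.

Lemma hasD_cst a : hasD (fun=> a) (fun=> 0).
Proof. by move=> x _; rewrite mulr0; exact: cd_cst. Qed.

Lemma hasDD f f' g g' : hasD f f' -> hasD g g' -> hasD (fun x => f x + g x) (fun x => f' x + g' x).
Proof. by move=> h1 h2 x x0; rewrite mulrDr; exact: cdD (h1 x x0) (h2 x x0). Qed.

Lemma hasDZ a f f' : hasD f f' -> hasD (fun x => a * f x) (fun x => a * f' x).
Proof. by move=> h x x0; rewrite mulrCA; exact: cdZ (h x x0). Qed.

Arguments hasDZ a {f f'} _.
Lemma hasDB f f' g g' : hasD f f' -> hasD g g' -> hasD (fun x => f x - g x) (fun x => f' x - g' x).
Proof.
move=> h1 h2; apply: hasD_ext (hasDD h1 (hasDZ (-1) h2)) => x _; by rewrite mulN1r.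
Qed.

Lemma hasDM f f' g g' : hasD f f' -> hasD g g' ->
  hasD (fun x => f x * g x) (fun x => f' x * g x + f x * g' x).
Proof.
move=> h1 h2 x x0; apply: cd_eq (cdM (h1 x x0) (h2 x x0)) _; ring.
Qed.

Lemma hasD_sum (I : Type) (l : seq I) (f f' : I -> R -> C) : (forall i, hasD (f i) (f' i)) ->
  hasD (fun x => \sum_(i <- l) f i x) (fun x => \sum_(i <- l) f' i x).
Proof.
move=> h x x0; apply: cd_eq (@cd_sum _ _ l f x _ (fun i => h i x x0)) _.
by rewrite big_distrr.
Qed.

Lemma hasD_id : hasD (fun x => x%:C) (fun x => x%:C).
Proof.
by move=> x x0; rewrite mulVf ?posC_neq0//; exact: (cdR (is_derive_id x 1)).
Qed.

Arguments hasD_sum {I} l {f f'} _.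
Arguments hasD_cst a : clear implicits.
Definition half x : C := (x / 2)%:C.

Lemma hasD_ln : hasD (fun x => cLog (half x)) (fun=> 1).
Proof.
move=> x x0; have h := @cdM _ _ _ x _ _ (cdR (is_derive_id x 1)) (@cd_cst _ (2^-1)%:C x).
have h2 : cd half x (2^-1)%:C.
  apply: cd_near (cd_eq h _); last by rewrite mulr0 addr0 mul1r.
  by near=> y; rewrite /half rmorphM.
have x20 : 0 < Re (half x) by rewrite /= divr_gt0.
apply: cd_eq (cd_cLog h2 x20) _; rewrite /half mulr1 -fmorphV -rmorphM -fmorphV; congr (_%:C).
by rewrite invfM invrK mulrCA mulVf ?mulr1// .
Unshelve. all: by end_near. Qed.

Lemma hasD_pow s : hasD (fun x => cpow (half x) s) (fun x => s * cpow (half x) s).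
Proof.
move=> x x0; apply: cd_eq (cd_cexp (cdZ (c := s) (hasD_ln x0))) _.
by rewrite /cpow; ring.
Qed.

Lemma hasD_powx s : hasD (fun x => cpow x%:C s) (fun x => s * cpow x%:C s).
Proof.
move=> x x0; have h := cd_cLog (cdR (is_derive_id x 1)) (x0 : 0 < Re x%:C).
apply: cd_eq (cd_cexp (cdZ (c := s) h)) _.
by rewrite /cpow -[1%:C]/(1 : C); ring.
Qed.

Arguments hasD_pow s : clear implicits.
Arguments hasD_powx s : clear implicits.
(* The coefficients of (1 - t) d/dt applied to sum_n phi_n t^n. *)
Definition thv phi n x := n.+1%:R * phi n.+1 x - n%:R * phi n x.
Definition tow phi := forall n, hasD (phi n) (thv phi n).

Lemma tow_thv phi : tow phi -> tow (thv phi).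
Proof. by move=> h n; exact: hasDB (hasDZ _ (h n.+1)) (hasDZ _ (h n)). Qed.

(** The relation expresses (n + 1) phi_(n+1) through phi_n and theta phi_n, so vanishing spreads
    from index 0 upwards. *)
Lemma tow0 phi : tow phi -> (forall x, 0 < x -> phi 0%N x = 0) -> forall n x, 0 < x -> phi n x = 0.
Proof.
move=> h h0; elim => // n IH x x0.
have h1 : hasD (phi n) (fun=> 0) by apply: hasD_ext (hasD_cst 0) => // y y0; rewrite IH.
have := hasD_unique (h n) h1 x0; rewrite /thv IH// mulr0 subr0 => /eqP.
by rewrite mulf_eq0 (negbTE (natS_neq0 _ _)) => /eqP.
Qed.

Definition addv phi psi n x := phi n x + psi n x.
Definition sclv s phi n x := s * phi n x.
Definition mulv phi psi n x := conv (phi^~ x) (psi^~ x) n.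

Lemma tow_add phi psi : tow phi -> tow psi -> tow (addv phi psi).
Proof.
move=> h1 h2 n; apply: hasD_ext (hasDD (h1 n) (h2 n)) => // x _.
by rewrite /thv /addv; ring.
Qed.

Lemma tow_scl s phi : tow phi -> tow (sclv s phi).
Proof.
move=> h1 n; apply: hasD_ext (hasDZ s (h1 n)) => // x _.
by rewrite /thv /sclv; ring.
Qed.

Arguments tow_scl s {phi} _.
(** (1 - t) d/dt is a derivation, hence compatible with Cauchy products; on coefficients this is the
    splitting of the weight m into i + (m - i). *)
Lemma tow_mul phi psi : tow phi -> tow psi -> tow (mulv phi psi).
Proof.
move=> h1 h2 n.
have h := hasD_sum (index_iota 0 n.+1) (fun i => hasDM (h1 i) (h2 (n - i)%N)).
apply: hasD_ext h => // x _.
rewrite /thv /mulv /conv big_split /=.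
have -> : \sum_(0 <= i < n.+1) (i.+1%:R * phi i.+1 x - i%:R * phi i x) * psi (n - i)%N x =
  \sum_(0 <= i < n.+2) i%:R * phi i x * psi (n.+1 - i)%N x -
  \sum_(0 <= i < n.+1) i%:R * phi i x * psi (n - i)%N x.
  rewrite [X in _ = X - _]psumSl !mul0r add0r -sumrB; apply: eq_bigr => i _.
  by rewrite subSS; ring.
have -> : \sum_(0 <= i < n.+1) phi i x * ((n - i).+1%:R * psi (n - i).+1 x - (n - i)%:R * psi (n - i)%N x) =
  \sum_(0 <= i < n.+2) (n.+1 - i)%:R * (phi i x * psi (n.+1 - i)%N x) -
  \sum_(0 <= i < n.+1) (n - i)%:R * (phi i x * psi (n - i)%N x).
  rewrite [X in _ = X - _]psumS subnn mul0r addr0 -sumrB; apply: eq_big_nat => i /andP[_ i1].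
  by rewrite (subSn (i1 : (i <= n)%N)); ring.
have S m : \sum_(0 <= i < m.+1) i%:R * phi i x * psi (m - i)%N x +
   \sum_(0 <= i < m.+1) (m - i)%:R * (phi i x * psi (m - i)%N x) =
   m%:R * \sum_(0 <= i < m.+1) phi i x * psi (m - i)%N x.
  rewrite -big_split big_distrr /=; apply: eq_big_nat => i /andP[_ i1].
  by rewrite -[in RHS](subnKC (i1 : (i <= m)%N)) natrD addKn; ring.
by rewrite -!S; ring.
Qed.

(** [phi n x] are the Taylor coefficients of F (x / (1 - t)) at t = 0. The absolute bound is
    recorded because Cauchy products need it; the radius may depend on x. *)
Definition AT F phi := tow phi /\ forall x, 0 < x -> exists r B, [/\ 0 < r, r < 1 &
  forall t, cabs t <= r -> absbnd (fun n => phi n x * t ^+ n) B /\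
     hassum (fun n => phi n x * t ^+ n) (F (x%:C / (1 - t)))].

Lemma AT_ext F G phi : (forall z, 0 < Re z -> F z = G z) -> AT F phi -> AT G phi.
Proof.
move=> FG [h1 h2]; split; first exact: h1.
move=> x x0; have [r [B [r0 r1 h]]] := h2 x x0.
exists r, B; split; [exact: r0|exact: r1|] => t tr; have [? ?] := h t tr; split; first by [].

rewrite -FG// Re_rmul mulr_gt0// Re_inv_gt0// Re_1B// (le_lt_trans tr)//.
Qed.

Lemma AT_scl F phi s : AT F phi -> AT (fun z => s * F z) (sclv s phi).
Proof.
move=> [h1 h2]; split; first exact: tow_scl.
move=> x x0; have [r [B [r0 r1 h]]] := h2 x x0.
exists r, (cabs s * B); split; [exact: r0|exact: r1|] => t tr; have [b1 b2] := h t tr.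
have E : (fun n => sclv s phi n x * t ^+ n) = (fun n => s * (phi n x * t ^+ n)).
  by apply/funext => n; rewrite /sclv mulrA.
rewrite E; split; last exact: hassumZ.
move=> N; under eq_bigr do rewrite cabsM.
by rewrite -big_distrr /= ler_wpM2l ?cabs_ge0.
Qed.

Lemma AT_add F G phi psi : AT F phi -> AT G psi -> AT (fun z => F z + G z) (addv phi psi).
Proof.
move=> [h1 h2] [h3 h4]; split; first exact: tow_add.
move=> x x0; have [r [B [r0 r1 h]]] := h2 x x0; have [r' [B' [r'0 r'1 h']]] := h4 x x0.
exists (Num.min r r'), (B + B'); split; [by rewrite lt_min r0|by rewrite gt_min r1|].
move=> t; rewrite le_min => /andP[/h [b1 b2] /h' [b3 b4]].
have E : (fun n => addv phi psi n x * t ^+ n) = (fun n => phi n x * t ^+ n + psi n x * t ^+ n).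
  by apply/funext => n; rewrite /addv mulrDl.
rewrite E; split; last exact: hassumD.
move=> N; apply: le_trans (lerD (b1 N) (b3 N)); rewrite -big_split /=.
by apply: ler_sum => k _; exact: cabsD.
Qed.

Lemma conv_pow (u v : nat -> C) t : conv (fun n => u n * t ^+ n) (fun n => v n * t ^+ n) =
  fun n => conv u v n * t ^+ n.
Proof.
apply/funext => n; rewrite /conv big_distrl /=; apply: eq_big_nat => i /andP[_ i1].
have -> : t ^+ n = t ^+ i * t ^+ (n - i) by rewrite -exprD subnKC.
ring.
Qed.

Lemma AT_mul F G phi psi : AT F phi -> AT G psi -> AT (fun z => F z * G z) (mulv phi psi).
Proof.
move=> [h1 h2] [h3 h4]; split; first exact: tow_mul.
move=> x x0; have [r [B [r0 r1 h]]] := h2 x x0; have [r' [B' [r'0 r'1 h']]] := h4 x x0.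
exists (Num.min r r'), (B * B'); split; [by rewrite lt_min r0|by rewrite gt_min r1|].
move=> t; rewrite le_min => /andP[/h [b1 b2] /h' [b3 b4]].
have := absbndM b1 b3; rewrite conv_pow (hassum_csum b2) (hassum_csum b4).
by [].
Qed.

(** All factors lie in the right half-plane, so the principal logarithm is additive here. *)
Lemma half_div x t : cabs t < 1 -> 0 < x ->
  cLog (x%:C / (1 - t) / 2%:R) = cLog (half x) - cLog (1 - t).
Proof.
move=> t1 x0; have h := Re_1B t1; have x2 : 0 < x / 2 by rewrite divr_gt0.
have -> : x%:C / (1 - t) / 2%:R = half x * (1 - t)^-1.
  by rewrite /half rmorphM /= fmorphV rmorph_nat mulrAC.
by rewrite cLog_scale ?Re_inv_gt0// cLogV// cLog_real.
Qed.

Definition powv s n x := rf s n * cpow (half x) s.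

Lemma AT_pow s : AT (fun z => cpow (z / 2%:R) s) (powv s).
Proof.
split.
  move=> n; apply: hasD_ext (hasDZ (rf s n) (hasD_pow s)) => // x _.
  by rewrite /thv /powv [in RHS]mulrA rfS; ring.
move=> x x0; have [m hm] := ex_natbnd (cabs s).
have h2 : 0 < 2^-1 :> R by rewrite invr_gt0.
have h21 : 2^-1 < 1 :> R by rewrite invf_lt1// ltr1n.
exists 2^-1, ((1 - 2^-1)^-1 ^+ m * cabs (cpow (half x) s)); split; [exact: h2|exact: h21|] => t t2.
have t1 : cabs t < 1 by exact: le_lt_trans t2 h21.
have E : (fun n => powv s n x * t ^+ n) = (fun n => cpow (half x) s * (rf s n * t ^+ n)).
  by apply/funext => n; rewrite /powv; ring.
rewrite E; split.
  move=> N; under eq_bigr do rewrite cabsM.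
  rewrite -big_distrr /= mulrC ler_wpM2r ?cabs_ge0//.
  exact: (rf_bnd hm h21 t2 N).
have -> : cpow (x%:C / (1 - t) / 2%:R) s = cpow (half x) s * cpow (1 - t) (- s).
  rewrite /cpow half_div// -cexpD; congr cexp; ring.
apply: hassumZ; exact: binomial_series.
Qed.

(** Coefficients of log (x / 2) - log (1 - t); only the constant one depends on x. *)
Definition logv n x : C := if n is n'.+1 then n'.+1%:R^-1 else cLog (half x).

Lemma AT_log : AT (fun z => cLog (z / 2%:R)) logv.
Proof.
split.
  case=> [|n].
    by apply: hasD_ext hasD_ln => // x _; rewrite /thv /= invr1 mulr1 mul0r subr0.
  apply: hasD_ext (hasD_cst n.+1%:R^-1) => // x _.
  by rewrite /thv /= !divff ?subrr// natS_neq0.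
move=> x x0.
have h2 : 0 < 2^-1 :> R by rewrite invr_gt0.
have h21 : 2^-1 < 1 :> R by rewrite invf_lt1// ltr1n.
exists 2^-1, (cabs (cLog (half x)) + (1 - 2^-1)^-1); split; [exact: h2|exact: h21|] => t t2.
have t1 : cabs t < 1 by exact: le_lt_trans t2 h21.
have B : absbnd (fun n => logv n x * t ^+ n) (cabs (cLog (half x)) + (1 - 2^-1)^-1).
  case=> [|N]; first by rewrite big_geq// addr_ge0 ?cabs_ge0// invr_ge0; lra.
  rewrite psumSl expr0 mulr1 lerD2l.
  apply: (le_trans _ (@rf_sum _ 2^-1 1 N.+1 (ltW h2) h21)).
  apply: (@le_trans _ _ (\sum_(0 <= k < N) 2^-1 ^+ k.+1)).
    apply: ler_sum => k _; rewrite cabsM cabsV cabs_nat cabsX.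
    rewrite -[leRHS]mul1r ler_pM ?invr_ge0 ?exprn_ge0 ?cabs_ge0//; first by rewrite invf_le1// ler1n.
    by apply: lerXn2r; rewrite ?nnegrE ?cabs_ge0// ltW.
  rewrite psumSl rf1 mul1r expr0 -[leLHS]add0r lerD//.
  by apply: ler_sum => k _; rewrite rf1 mul1r.
split; first exact: B.
rewrite half_div//.
have hl := absbnd_hassum B; have hS := hassumS hl.
rewrite expr0 mulr1 in hS.
have h3 := log_series t1.
suff -> : cLog (half x) - cLog (1 - t) = csum (fun n => logv n x * t ^+ n) by [].
have : csum (fun n => logv n x * t ^+ n) - logv 0 x = - cLog (1 - t).
  apply: hassum_unique hS _; apply: cvg_trans h3; apply: near_eq_cvg; near=> N.
  by apply: eq_bigr => k _ /=; rewrite mulrC.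
by move=> <-; rewrite /= addrC subrK.
Unshelve. all: by end_near. Qed.

End EulerDerivative.

(** * Entire series in even powers *)

Section EvenSeries.
Variable R : realType.
Local Notation C := R[i].
Implicit Types (s z w t : C) (x r : R) (f g : R -> C) (phi psi : nat -> R -> C) (F : C -> C) (c d : nat -> C).
Local Notation Re := complex.Re.
Local Notation Im := complex.Im.

(** Decay like 1 / k!, the form in which the Bessel coefficients and their derivatives in the order
    are bounded. *)
Definition ent c := exists B : R, forall k, cabs (c k) * k`!%:R <= B.

Lemma exp_psum (X : R) N : 0 <= X -> \sum_(0 <= k < N) X ^+ k / k`!%:R <= expR X.
Proof.
move=> X0; rewrite /expR.
apply: (@nondecreasing_cvgn_le _ (series (exp_coeff X))).
  move=> m n mn; apply: (@psum_le _ (exp_coeff X)) => // k; exact: exp_coeff_ge0.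
exact: is_cvg_series_exp_coeff.
Qed.

Lemma ent_bnd c X : ent c -> 0 <= X -> exists B, forall N, \sum_(0 <= k < N) cabs (c k) * X ^+ k <= B.
Proof.
move=> [B hB] X0; exists (B * expR X) => N.
have B0 : 0 <= B by apply: le_trans (hB 0%N); rewrite mulr_ge0 ?cabs_ge0.
apply: (@le_trans _ _ (B * \sum_(0 <= k < N) X ^+ k / k`!%:R)); last by rewrite ler_wpM2l// exp_psum.
rewrite big_distrr /=; apply: ler_sum => k _.
have p : 0 < k`!%:R :> R by rewrite ltr0n fact_gt0.
rewrite mulrCA [leLHS]mulrC ler_wpM2l ?exprn_ge0// ler_pdivlMr//.
Qed.

Definition evenE c x : C := csum (fun k => c k * half x ^+ (2 * k)).

Lemma half_sq x k : half x ^+ (2 * k) = ((x / 2) ^+ 2)%:C ^+ k.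
Proof. by rewrite /half exprM rmorphXn. Qed.

Lemma evenE_abs c x : (forall X, 0 <= X -> exists B, forall N, \sum_(0 <= k < N) cabs (c k) * X ^+ k <= B) ->
  exists B, absbnd (fun k => c k * half x ^+ (2 * k)) B.
Proof.
move=> h; have [B hB] := h ((x / 2) ^+ 2) (sqr_ge0 _).
exists B => N; apply: le_trans (hB N); apply: ler_sum => k _.
by rewrite half_sq cabsM cabsX cabsR ger0_norm// sqr_ge0.
Qed.

Lemma hasD_even c : (forall X, 0 <= X -> exists B, forall N, \sum_(0 <= k < N) cabs (c k) * X ^+ k <= B) ->
  hasD (evenE c) (evenE (fun k => (2 * k)%:R * c k)).
Proof.
move=> h x x0; pose u y : R := (y / 2) ^+ 2.
have u0 : 0 <= u x by exact: sqr_ge0.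
have u1 : 0 <= u x + 1 by lra.
have [B hB] := h (u x + 1) u1.
have ur : `|u x| < u x + 1 by rewrite ger0_norm//; lra.
have h1 := cd_pseries ur hB.
have du : is_derive x 1 u (x / 2).
  by apply: is_derive_eq; rewrite /GRing.scale /=; field.
have h2 : cd (fun y => csum (fun k => c k * (u y)%:C ^+ k)) x ((x / 2)%:C * csum (fun k => c k * (k%:R * (u x)%:C ^+ k.-1))).
  move/cdP : h1 => [e1 e2]; apply/cdP; rewrite Re_rmul Im_rmul; split.
    by rewrite mulrC; exact: (is_derive1_comp e1 du).
  by rewrite mulrC; exact: (is_derive1_comp e2 du).
have -> : evenE c = fun y => csum (fun k => c k * (u y)%:C ^+ k).
  by apply/funext => y; rewrite /evenE; congr csum; apply/funext => k; rewrite half_sq.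
apply: cd_eq h2 _.
have x20 : 0 < x / 2 by rewrite divr_gt0.
have [B' hB'] := absbnd_deriv u0 (ltr_pwDr ltr01 (lexx _)) hB.
have sA : hassum (fun k => c k * (k%:R * (u x)%:C ^+ k.-1)) (csum (fun k => c k * (k%:R * (u x)%:C ^+ k.-1))).
  apply: (@absbnd_hassum _ _ B') => N; apply: le_trans (hB' N); apply: ler_sum => k _.
  by rewrite cabsM [cabs (_%:R * _)]cabsM cabsX cabs_nat cabsR ger0_norm.
have E : evenE (fun k => (2 * k)%:R * c k) x = 2%:R * (u x)%:C * csum (fun k => c k * (k%:R * (u x)%:C ^+ k.-1)).
  apply: hassum_csum; have h3 := hassumZ (c := 2%:R * (u x)%:C) sA; apply: cvg_trans h3; apply: near_eq_cvg; near=> N.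
  apply: eq_bigr => k _; rewrite half_sq -/(u x) natrM.
  case: k => [|k]; first by rewrite !(mul0r, mulr0).
  by rewrite exprS /=; ring.
rewrite E mulrA; congr (_ * _).
rewrite -(rmorph_nat (real_complex R)) -fmorphV -!rmorphM; congr (_%:C).
by rewrite /u; field; rewrite gt_eqF.
Unshelve. all: by end_near. Qed.

(** The n-th coefficient in t of the series at x / (1 - t), the k-th term contributing (1 -
    t)^(-2k). *)
Definition evenv c n x := evenE (fun k => c k * rf (2 * k)%:R n) x.

(** One term of [rf_sum] at r = 1/2 is at most the whole sum, which is bounded by 2^(2k). *)
Lemma rf_even_bnd (k n : nat) : rf (2 * k)%:R n <= 2 ^+ n * 4 ^+ k :> R.
Proof.
have h2 : 0 <= 2^-1 :> R by rewrite invr_ge0.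
have h21 : 2^-1 < 1 :> R by rewrite invf_lt1// ltr1n.
have := @rf_sum R 2^-1 (2 * k) n.+1 h2 h21.
have -> : (1 - 2^-1)^-1 = 2 :> R by field.
rewrite exprM -[2 ^+ 2]natrX => h.
rewrite mulrC -ler_pdivrMr ?exprn_gt0// -exprVn; apply: le_trans h.
by rewrite psumS lerDr sumr_ge0// => i _; rewrite mulr_ge0 ?rf_ge0 ?exprn_ge0.
Qed.

Lemma ent_rf_bnd c n X : ent c -> 0 <= X ->
  exists B, forall N, \sum_(0 <= k < N) cabs (c k * rf (2 * k)%:R n) * X ^+ k <= B.
Proof.
move=> hc X0; have [|B hB] := @ent_bnd c (4 * X) hc; first by rewrite mulr_ge0.
exists (2 ^+ n * B) => N; apply: (le_trans _ (ler_wpM2l _ (hB N))); last by rewrite exprn_ge0.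
rewrite big_distrr /=; apply: ler_sum => k _.
rewrite cabsM exprMn.
have h := le_trans (cabs_rf _ _) (_ : rf (cabs (2 * k)%:R) n <= _).
have {}h : cabs (rf (2 * k)%:R n : C) <= 2 ^+ n * 4 ^+ k.
  by apply: le_trans (cabs_rf _ _) _; rewrite cabs_nat rf_even_bnd.
have -> : 2 ^+ n * (cabs (c k) * (4 ^+ k * X ^+ k)) = cabs (c k) * (2 ^+ n * 4 ^+ k) * X ^+ k by ring.
by rewrite ler_wpM2r ?exprn_ge0// ler_wpM2l ?cabs_ge0.
Qed.

Lemma AT_even c : ent c -> AT (fun z => csum (fun k => c k * (z / 2%:R) ^+ (2 * k))) (evenv c).
Proof.
move=> hc; split.
  move=> n; apply: hasD_ext (hasD_even (fun X => @ent_rf_bnd c n X hc)) => // x x0.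
  have [B1 a1] := evenE_abs x (fun X => @ent_rf_bnd c n X hc).
  have [B2 a2] := evenE_abs x (fun X => @ent_rf_bnd c n.+1 X hc).
  apply: hassum_csum.
  have h := hassumD (hassumZ (c := n.+1%:R) (absbnd_hassum a2)) (hassumZ (c := - n%:R) (absbnd_hassum a1)).
  rewrite mulNr in h; apply: cvg_trans h; apply: near_eq_cvg; near=> N.
  apply: eq_bigr => k _.
  have := rfS (2 * k)%:R n : _ = _ :> C => e.
  have -> : n.+1%:R * (c k * rf (2 * k)%:R n.+1 * half x ^+ (2 * k)) = c k * (n.+1%:R * rf (2 * k)%:R n.+1) * half x ^+ (2 * k) by ring.
  by rewrite e; ring.
move=> x x0; have [|B hB] := @ent_bnd c (4 * (x / 2) ^+ 2) hc; first by rewrite mulr_ge0// sqr_ge0.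
have q1 : 4^-1 < 1 :> R by rewrite invf_lt1// ltr1n.
have B0 : 0 <= B by have := hB 0%N; rewrite big_geq.
(* For |t| <= 1/4 the coefficient bound 2^n 4^k leaves 2^(-n) 4^k: the factor 4^k is absorbed by
   evaluating [B] at four times (x/2)^2, and the sum over n contributes the 2. *)
exists 4^-1, (2 * B); split; [by rewrite invr_gt0|exact: q1|] => t t4.
have t1 : cabs t < 1 by exact: le_lt_trans t4 q1.
have t2 : cabs t <= 2^-1 by rewrite (le_trans t4)// lef_pV2 ?posrE// ler_nat.
have h21 : 2^-1 < 1 :> R by rewrite invf_lt1// ltr1n.
pose a k n := c k * half x ^+ (2 * k) * (rf (2 * k)%:R n * t ^+ n).
pose M k := cabs (c k) * (4 * (x / 2) ^+ 2) ^+ k.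
have aM k : absbnd (a k) (M k).
  move=> N; rewrite /a; under eq_bigr do rewrite (cabsM (c k * _)).
  rewrite -big_distrr /=; have := @rf_bnd R (2 * k)%:R t 2^-1 (2 * k) _ h21 t2 N.
  rewrite cabs_nat lexx => /(_ isT) h.
  apply: le_trans (ler_wpM2l (cabs_ge0 _) h) _.
  have -> : (1 - 2^-1)^-1 = 2 :> R by field.
  rewrite /M cabsM half_sq cabsX cabsR ger0_norm ?sqr_ge0// exprM -[2 ^+ 2]natrX [in leRHS]exprMn.
  by rewrite -!mulrA ler_wpM2l ?cabs_ge0// mulrC.
have E n : csum (fun k => a k n) = evenv c n x * t ^+ n.
  have [B1 a1] := evenE_abs x (fun X => @ent_rf_bnd c n X hc).
  apply: hassum_csum; have h := hassumZ (c := t ^+ n) (absbnd_hassum a1).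
  rewrite mulrC in h; apply: cvg_trans h; apply: near_eq_cvg; near=> N.
  by apply: eq_bigr => k _; rewrite /a; ring.
split.
  move=> N; apply: (@le_trans _ _ (\sum_(0 <= n < N) B * 2^-1 ^+ n)).
    apply: ler_sum => n _; rewrite -E; apply: absbnd_le => K.
    apply: (@le_trans _ _ (\sum_(0 <= k < K) cabs (c k) * (4 * (x / 2) ^+ 2) ^+ k * 2^-1 ^+ n)).
      apply: ler_sum => k _; rewrite /a cabsM cabsM half_sq cabsX cabsR ger0_norm ?sqr_ge0//.
      have -> : cabs (c k) * (4 * (x / 2) ^+ 2) ^+ k * 2^-1 ^+ n = cabs (c k) * (x / 2) ^+ 2 ^+ k * (4 ^+ k * 2^-1 ^+ n).
        by rewrite [(4 * _) ^+ k]exprMn; ring.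
      apply: ler_wpM2l; first by rewrite mulr_ge0 ?cabs_ge0// exprn_ge0// sqr_ge0.
      rewrite cabsM cabsX.
      have h : cabs (rf (2 * k)%:R n : C) <= 2 ^+ n * 4 ^+ k.
        by apply: le_trans (cabs_rf _ _) _; rewrite cabs_nat rf_even_bnd.
      have h' : cabs t ^+ n <= 4^-1 ^+ n by apply: lerXn2r; rewrite ?nnegrE ?cabs_ge0.
      apply: le_trans (ler_pM (cabs_ge0 _) _ h h') _; first by rewrite exprn_ge0// cabs_ge0.
      have -> : 4^-1 = 2^-1 * 2^-1 :> R by field.
      by rewrite exprMn mulrAC mulrA -exprMn divff// expr1n mul1r mulrC.
    by rewrite -big_distrl /= ler_wpM2r// exprn_ge0.
  rewrite -big_distrr /= mulrC ler_wpM2r//.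
  have := @rf_sum R 2^-1 1 N _ h21; rewrite invr_ge0 ler0n => /(_ isT).
  have -> : (1 - 2^-1)^-1 ^+ 1 = 2 :> R by field.
  by move=> h; apply: le_trans h; apply: ler_sum => k _; rewrite rf1 mul1r.
have := fubini_col aM hB.
have -> : (fun n => csum (fun k => a k n)) = (fun n => evenv c n x * t ^+ n) by apply/funext.
have -> // : csum (fun k => csum (a k)) = csum (fun k => c k * (x%:C / (1 - t) / 2%:R) ^+ (2 * k)).
congr csum; apply/funext => k; apply: hassum_csum.
have u0 := Re_neq0 (Re_1B t1).
have -> : c k * (x%:C / (1 - t) / 2%:R) ^+ (2 * k) = c k * half x ^+ (2 * k) * cpow (1 - t) (- (2 * k)%:R).
  have -> : x%:C / (1 - t) / 2%:R = half x * (1 - t)^-1.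
    by rewrite /half rmorphM /= fmorphV rmorph_nat mulrAC.
  by rewrite exprMn exprVn cpowN cpow_nat// mulrA.
apply: hassumZ; exact: binomial_series.
Unshelve. all: by end_near. Qed.

End EvenSeries.

(** * Behaviour of the coefficients as x tends to 0 *)

Section SmallArgument.
Variable R : realType.
Local Notation C := R[i].
Implicit Types (a c d z w t : C) (s x r : R) (f g : R -> C) (phi psi : nat -> R -> C) (F : C -> C).
Local Notation Re := complex.Re.
Local Notation Im := complex.Im.

Definition wt (s x : R) : C := ((x / 2) `^ s)%:C.

(* phi_n ~ c rf (-s) n (x/2)^(-s): what F z ~ c (z/2)^(-s) predicts for F (x / (1 - t)). *)
Definition Asy phi (s : R) (c : C) := forall n, (fun x => wt s x * phi n x) @ 0^'+ --> c * rf (- s%:C) n.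

Lemma wt0 x : wt 0 x = 1.
Proof. by rewrite /wt powRr0. Qed.

Lemma wtD s s' x : 0 < x -> wt (s + s') x = wt s x * wt s' x.
Proof.
move=> x0; rewrite /wt powRD ?rmorphM//; apply/implyP => _.
by rewrite gt_eqF ?divr_gt0.
Qed.

Lemma wt_cpow s x : 0 < x -> cpow (half x) s%:C = wt s x.
Proof.
move=> x0; have x2 : 0 < x / 2 by rewrite divr_gt0.
by rewrite /cpow cLog_real// -rmorphM cexp_real /wt /powR gt_eqF.
Qed.

Lemma near_right : \forall x \near (0 : R)^'+, 0 < x.
Proof. exact: nbhs_right_gt. Qed.

Lemma half_right : (fun x : R => x / 2) @ 0^'+ --> (0 : R)^'+.
Proof.
move=> P [e /= e0 he]; exists e => // x /= xe x0; apply: he; last by rewrite divr_gt0.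
rewrite /= sub0r normrN in xe; rewrite /ball_ /= sub0r normrN normrM (le_lt_trans _ xe)//.
by rewrite ler_piMr// ger0_norm ?invr_ge0// invf_le1// ler1n.
Qed.

Lemma wt_cvg0 s : 0 < s -> wt s @ 0^'+ --> (0 : C).
Proof.
move=> s0; have h : (fun x => (x / 2) `^ s) @ 0^'+ --> (0 : R).
  exact: (@cvg_comp _ _ _ (fun x : R => x / 2) (fun y => y `^ s) _ _ _ half_right (powR_cvg0 s0)).
exact: (cvgCR h).
Qed.

Lemma Asy_add phi psi s c d : Asy phi s c -> Asy psi s d -> Asy (addv phi psi) s (c + d).
Proof.
move=> h1 h2 n; rewrite mulrDl.
have h : (fun x => wt s x * phi n x + wt s x * psi n x) @ 0^'+ --> c * rf (- s%:C) n + d * rf (- s%:C) n.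
  exact: (cvgCD (h1 n) (h2 n)).
by apply: cvg_trans h; apply: near_eq_cvg; near=> x; rewrite /addv mulrDr.
Unshelve. all: by end_near. Qed.

Lemma Asy_scl phi s c a : Asy phi s c -> Asy (sclv a phi) s (a * c).
Proof.
move=> h1 n; rewrite -mulrA.
have hc : (fun _ : R => a) @ 0^'+ --> a by exact: cvgC_cst.
have h : (fun x => a * (wt s x * phi n x)) @ 0^'+ --> a * (c * rf (- s%:C) n) by exact: (cvgCM hc (h1 n)).
by apply: cvg_trans h; apply: near_eq_cvg; near=> x; rewrite /sclv mulrCA.
Unshelve. all: by end_near. Qed.

Lemma Asy_weak phi s s' c : s < s' -> Asy phi s c -> Asy phi s' 0.
Proof.
move=> ss h n; rewrite mul0r; have d0 : 0 < s' - s by rewrite subr_gt0.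
have h1 : (fun x => wt (s' - s) x * (wt s x * phi n x)) @ 0^'+ --> 0 * (c * rf (- s%:C) n).
  exact: (cvgCM (wt_cvg0 d0) (h n)).
rewrite mul0r in h1; apply: cvg_trans h1; apply: near_eq_cvg.
by move: near_right; apply: filterS => x x0; rewrite mulrA -wtD// subrK.
Qed.

(** The weights multiply, and [rf_vdm] recombines the Cauchy product of the two leading factors. *)
Lemma Asy_mul phi psi s s' c d : Asy phi s c -> Asy psi s' d -> Asy (mulv phi psi) (s + s') (c * d).
Proof.
move=> h1 h2 n.
have h : (fun x => \sum_(0 <= i < n.+1) (wt s x * phi i x) * (wt s' x * psi (n - i)%N x)) @ 0^'+ -->
   \sum_(0 <= i < n.+1) (c * rf (- s%:C) i) * (d * rf (- s'%:C) (n - i)%N).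
  apply: (@cvgC_sum _ _ _ _ _ _ (fun i x => (wt s x * phi i x) * (wt s' x * psi (n - i)%N x))) => i.
  exact: (cvgCM (h1 i) (h2 _)).
have -> : c * d * rf (- (s + s')%:C) n = \sum_(0 <= i < n.+1) (c * rf (- s%:C) i) * (d * rf (- s'%:C) (n - i)%N).
  by rewrite rmorphD opprD -rf_vdm big_distrr; apply: eq_bigr => i _ /=; ring.
apply: cvg_trans h; apply: near_eq_cvg.
move: near_right; apply: filterS => x x0; rewrite wtD// /mulv /conv big_distrr /=.
by apply: eq_bigr => i _; ring.
Qed.

Lemma Asy_pow (s : R) : Asy (@powv R s%:C) (- s) 1.
Proof.
move=> n; rewrite mul1r rmorphN opprK.
have hc : (fun _ : R => rf s%:C n) @ 0^'+ --> (rf s%:C n : C) by exact: cvgC_cst.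
apply: cvg_trans hc; apply: near_eq_cvg.
move: near_right; apply: filterS => x x0; rewrite /powv wt_cpow//.
by rewrite mulrCA -wtD// addNr wt0 mulr1.
Qed.

Lemma even_cvg (c : nat -> C) : (forall X, 0 <= X -> exists B, forall N, \sum_(0 <= k < N) cabs (c k) * X ^+ k <= B) ->
  evenE c @ 0^'+ --> c 0%N.
Proof.
move=> h.
have [B hB] := h 1 ler01.
have [] := @tannery R R (0 : R)^'+ _ (fun x k => c k * half x ^+ (2 * k)) (fun k => if k is 0%N then c 0%N else 0)
  (fun k => cabs (c k) * 1 ^+ k) B hB.
- near=> x => k; rewrite cabsM ler_wpM2l ?cabs_ge0// expr1n cabsX cabsR exprn_ile1//.
  have x0 : 0 < x by near: x; exact: near_right.
  have x1 : x <= 1 by near: x; apply: nbhs_right_le.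
  by rewrite ger0_norm ?divr_ge0 ?ltW// ; lra.
- case=> [|k].
    have hc : (fun _ : R => c 0%N) @ 0^'+ --> c 0%N by exact: cvgC_cst.
    by apply: cvg_trans hc; apply: near_eq_cvg; near=> x; rewrite expr0 mulr1.
  have hx : @half R @ 0^'+ --> (0 : C).
    have := half_right => hr; have h0 : (fun x : R => x / 2) @ 0^'+ --> (0 : R).
      by apply: cvg_trans hr _; exact: cvg_within.
    exact: (cvgCR h0).
  have hp j : (fun x : R => half x ^+ j.+1) @ 0^'+ --> (0 : C).
    elim: j => [|j IH].
      by apply: cvg_trans hx; apply: near_eq_cvg; near=> x; rewrite expr1.
    have hh : (fun x : R => half x * half x ^+ j.+1) @ 0^'+ --> 0 * (0 : C) by exact: (cvgCM hx IH).
    rewrite mul0r in hh; apply: cvg_trans hh; apply: near_eq_cvg; near=> x; by rewrite [in RHS]exprS.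
  have hc : (fun _ : R => c k.+1) @ 0^'+ --> c k.+1 by exact: cvgC_cst.
  have hh : (fun x : R => c k.+1 * half x ^+ (2 * k.+1)) @ 0^'+ --> c k.+1 * 0.
    by have := hp (2 * k + 1)%N; rewrite (_ : (2 * k + 1).+1 = 2 * k.+1)%N; [exact: (cvgCM hc)|rewrite mulnS addn1].
  by rewrite mulr0 in hh.
move=> _; rewrite (@csum_fin _ _ 1%N); last by case.
by rewrite big_nat1.
Unshelve. all: by end_near. Qed.

Lemma Asy_even (c : nat -> C) : ent c -> Asy (evenv c) 0 (c 0%N).
Proof.
move=> hc n; have h := even_cvg (fun X => @ent_rf_bnd _ c n X hc).
rewrite /= mulr0n -[X in rf X]oppr0 in h.
have -> : - (0 : R)%:C = 0 :> C by rewrite rmorph0 oppr0.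
rewrite oppr0 in h; apply: cvg_trans h; apply: near_eq_cvg; near=> x.
by rewrite wt0 mul1r.
Unshelve. all: by end_near. Qed.

(** A logarithm is negligible against every positive power. With s = q + q, one factor (x/2)^q
    absorbs the logarithm, because ln y < y at y = (x/2)^(-q) gives (x/2)^q |ln (x/2)| <= 1/q, and
    the other one tends to 0. *)
Lemma Asy_log s : 0 < s -> Asy (@logv R) s 0.
Proof.
move=> s0; case=> [|n]; rewrite mul0r; last first.
  have hc : (fun _ : R => n.+1%:R^-1) @ 0^'+ --> (n.+1%:R^-1 : C) by exact: cvgC_cst.
  have h : (fun x => wt s x * n.+1%:R^-1) @ 0^'+ --> (0 : C) * n.+1%:R^-1 by exact: (cvgCM (wt_cvg0 s0) hc).
  by rewrite mul0r in h.
pose q := s / 2; have q0 : 0 < q by rewrite divr_gt0.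
have hw := wt_cvg0 q0.
apply/cvgC_cabs.
have hb : (fun x => cabs (wt q x - 0) * q^-1) @ 0^'+ --> (0 : R) * q^-1.
  by apply: cvgM; [exact/cvgC_cabs|exact: cvg_cst].
rewrite mul0r in hb.
apply: (squeeze_cvgr _ (cvg_cst (0 : R)) hb); near=> x.
have x0 : 0 < x by near: x; exact: near_right.
have x2 : x < 2 by near: x; apply: nbhs_right_lt.
have y0 : 0 < x / 2 by rewrite divr_gt0.
have y1 : x / 2 < 1 by rewrite ltr_pdivrMr//; lra.
rewrite cabs_ge0 /= !subr0 /logv cLog_real// -rmorphM !cabsR.
have -> : s = q + q by rewrite /q; field.
rewrite powRD; last by apply/implyP => _; rewrite gt_eqF.
rewrite !normrM -mulrA ler_wpM2l//.
have p0 : 0 < (x / 2) `^ q by rewrite powR_gt0.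
have lneg : ln (x / 2) < 0 by rewrite ln_lt0// y0.
rewrite ger0_norm ?powR_ge0// ltr0_norm//.
have := ln_sublinear (_ : 0 < ((x / 2) `^ q)^-1); rewrite invr_gt0 => /(_ p0).
rewrite lnV ?posrE// ln_powR => h.
rewrite -(ler_pM2l q0) divff ?gt_eqF//.
have : (x / 2) `^ q * (- (q * ln (x / 2))) <= (x / 2) `^ q * ((x / 2) `^ q)^-1.
  by rewrite ler_wpM2l ?powR_ge0// ltW.
by rewrite divff ?gt_eqF// => h3; apply: le_trans h3; rewrite le_eqVlt; apply/orP; left; apply/eqP; ring.
Unshelve. all: by end_near. Qed.

End SmallArgument.

(** * Bessel functions *)

Section BesselSeries.
Variable R : realType.
Local Notation C := R[i].
Implicit Types (a b s z w t nu : C) (x r : R) (f g : R -> C) (phi psi : nat -> R -> C) (F : C -> C) (c d : nat -> C).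
Local Notation Re := complex.Re.
Local Notation Im := complex.Im.

Definition cI a k : C := rgamma (a + k%:R + 1) / k`!%:R.
(** The derivative of [cI a k] with respect to the order a, at a = m. *)
Definition dcI (m : int) k : C := drg R (m + k%:Z + 1) / k`!%:R.
Definition ser c z : C := csum (fun k => c k * (z / 2%:R) ^+ (2 * k)).

Lemma ent_cI a : ent (cI a).
Proof.
have [B hB] := rgamma_bnd a; exists B => k.
by rewrite /cI cabsM cabsV cabs_nat divfK// fact_neq0.
Qed.

Lemma drg_bnd (m : int) : exists B : R, forall k : nat, cabs (drg R (m + k%:Z + 1)) <= B.
Proof.
have [B hB] := drg_unif R m; exists B => k.
have h := @drgP R (m + k%:Z + 1).
apply: (cvgC_cabs_le h); apply: filterS hB => e /(_ k).
have -> : m%:~R + e + k%:R + 1 = (m + k%:Z + 1)%:~R + e by rewrite !intrD -pmulrn; ring.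
by have -> : m%:~R + k%:R + 1 = (m + k%:Z + 1)%:~R :> C by rewrite !intrD -pmulrn.
Qed.

Lemma ent_dcI m : ent (dcI m).
Proof.
have [B hB] := drg_bnd m; exists B => k.
by rewrite /dcI cabsM cabsV cabs_nat divfK// fact_neq0.
Qed.

Lemma ent_ser c z : ent c -> hassum (fun k => c k * (z / 2%:R) ^+ (2 * k)) (ser c z).
Proof.
move=> hc; have [|B hB] := @ent_bnd R c (cabs (z / 2%:R) ^+ 2) hc; first by rewrite sqr_ge0.
apply: (@absbnd_hassum _ _ B) => N; apply: le_trans (hB N); apply: ler_sum => k _.
by rewrite cabsM cabsX exprM.
Qed.

Arguments ent_ser {c} z _.
Arguments ent_cI a : clear implicits.
Lemma besselIE a z : besselI a z = cpow (z / 2%:R) a * ser (cI a) z.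
Proof.
rewrite /besselI; congr (_ * csum _); apply/funext => k; rewrite /cI; ring.
Qed.

Lemma ItilE a z : Itil a z = ser (cI a) z.
Proof. by rewrite /Itil besselIE mulrA cpow_mul addNr cpow0 mul1r. Qed.

Lemma rgamma_nat n : rgamma (n%:R + 1 : C) = n`!%:R^-1.
Proof.
elim: n => [|n IH]; first by rewrite add0r rgamma1 fact0 invr1.
have := rgamma_rec (n%:R + 1 : C); rewrite IH natr1 => h.
apply: (mulfI (natS_neq0 _ n)); rewrite -h factS natrM invfM mulrA divff ?mul1r// natS_neq0.
Qed.

Lemma big_addn_0 (V : nmodType) (n N : nat) (f : nat -> V) : \sum_(n <= k < N) f k = \sum_(0 <= k < N - n) f (k + n)%N.
Proof. by rewrite -{1}[n]add0n big_addn. Qed.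

(** The first n coefficients of order -n vanish at the zeros of 1/Gamma; the remaining ones are
    those of order n, shifted by n. *)
Lemma ser_negint n z : ser (cI (- n%:R)) z = (z / 2%:R) ^+ (2 * n) * ser (cI n%:R) z.
Proof.
have h1 := ent_ser z (ent_cI (- n%:R)).
have h2 := hassumZ (c := (z / 2%:R) ^+ (2 * n)) (ent_ser z (ent_cI n%:R)).
apply: (cvgC_unique h1).
rewrite -(@cvg_shiftn n (R[i]^o)).
apply: cvg_trans h2; apply: near_eq_cvg; near=> N.
rewrite [RHS]/= (big_cat_nat (leq0n n) (leq_addl N n)) [in RHS]/=.
rewrite [X in _ = X + _]big1_seq ?add0r; last first.
  move=> k; rewrite mem_index_iota => /andP[_ kn].
  have -> : cI (- n%:R) k = 0.
    rewrite /cI; have -> : - n%:R + k%:R + 1 = - (n - k.+1)%:R :> C.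
      by rewrite natrB// -natr1; ring.
    by rewrite rgammaN_nat mul0r.
  by rewrite mul0r.
rewrite [RHS]big_addn_0 addnK; apply: eq_bigr => k _.
have -> : cI (- n%:R) (k + n) = cI n%:R k.
  rewrite /cI; have -> : - n%:R + (k + n)%:R + 1 = k%:R + 1 :> C by rewrite natrD; ring.
  have -> : n%:R + k%:R + 1 = (k + n)%:R + 1 :> C by rewrite natrD; ring.
  by rewrite !rgamma_nat mulrC.
by rewrite mulnDr exprD; ring.
Unshelve. all: by end_near. Qed.

Lemma ser_int_sym (m : int) z : z != 0 ->
  cpow (z / 2%:R) (- m%:~R) * ser (cI (- m%:~R)) z = cpow (z / 2%:R) m%:~R * ser (cI m%:~R) z.
Proof.
move=> z0; have w0 : z / 2%:R != 0 by rewrite mulf_neq0// invr_eq0 pnatr_eq0.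
have h (n : nat) : cpow (z / 2%:R) (- n%:R) * ser (cI (- n%:R)) z = cpow (z / 2%:R) n%:R * ser (cI n%:R) z.
  rewrite ser_negint mulrA -(cpow_nat (2 * n) w0) cpow_mul; congr (cpow _ _ * _).
  by rewrite natrM; ring.
case: m => n; first by rewrite -pmulrn h.
have E : (Negz n)%:~R = - n.+1%:R :> C by rewrite NegzE mulrNz -pmulrn.
rewrite E opprK; exact: (esym (h n.+1)).
Qed.

(** Termwise differentiation in the order, dominated through [drg_unif] by B / k! times
    |z/2|^(2k). *)
Lemma dC_ser (m : int) z : dC (fun a => ser (cI a) z) m%:~R (ser (dcI m) z).
Proof.
have [B hB] := drg_unif R m.
have [B' hB'] : exists B' : R, forall N, \sum_(0 <= k < N) B / k`!%:R * cabs ((z / 2%:R) ^+ (2 * k)) <= B'.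
  have he : ent (fun k => (B / k`!%:R)%:C).
    by exists `|B| => k; rewrite cabsR normrM normfV normr_nat divfK// fact_neq0.
  have [B' hB'] := ent_bnd he (sqr_ge0 (cabs (z / 2%:R))).
  exists B' => N; apply: le_trans (hB' N); apply: ler_sum => k _.
  by rewrite cabsR cabsX exprM ler_wpM2r ?exprn_ge0 ?sqr_ge0 ?cabs_ge0// ler_norm.
have [] := @tannery R C (0 : C)^' _
  (fun e k => e^-1 * (rgamma (m%:~R + e + k%:R + 1) - rgamma (m%:~R + k%:R + 1)) / k`!%:R * (z / 2%:R) ^+ (2 * k))
  (fun k => dcI m k * (z / 2%:R) ^+ (2 * k))
  (fun k => B / k`!%:R * cabs ((z / 2%:R) ^+ (2 * k))) B' hB'.
- apply: filterS hB => e he k.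
  rewrite cabsM ler_wpM2r ?cabs_ge0// cabsM cabsV cabs_nat ler_wpM2r ?invr_ge0//; exact: he.
- move=> k; have h := @drgP R (m + k%:Z + 1).
  have hc : (fun _ : C => k`!%:R^-1 * (z / 2%:R) ^+ (2 * k)) @ (0 : C)^' --> k`!%:R^-1 * (z / 2%:R) ^+ (2 * k).
    exact: cvgC_cst.
  have h2 : (fun e => e^-1 * (rgamma ((m + k%:Z + 1)%:~R + e) - rgamma ((m + k%:Z + 1)%:~R)) * (k`!%:R^-1 * (z / 2%:R) ^+ (2 * k))) @ (0 : C)^' --> drg R (m + k%:Z + 1) * (k`!%:R^-1 * (z / 2%:R) ^+ (2 * k)).
    exact: (cvgCM h hc).
  rewrite mulrA in h2; apply: cvg_trans h2; apply: near_eq_cvg; near=> e.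
  have -> : m%:~R + e + k%:R + 1 = (m + k%:Z + 1)%:~R + e by rewrite !intrD -pmulrn; ring.
  have -> : m%:~R + k%:R + 1 = (m + k%:Z + 1)%:~R :> C by rewrite !intrD -pmulrn.
  by rewrite mulrA.
move=> _; apply: cvgC_near; near=> e.
have s1 := ent_ser z (ent_cI (m%:~R + e)); have s2 := ent_ser z (ent_cI m%:~R).
apply: hassum_csum.
have h := hassumZ (c := e^-1) (hassumD s1 (hassumZ (c := -1) s2)).
rewrite mulN1r in h; apply: cvg_trans h; apply: near_eq_cvg; near=> N.
by apply: eq_bigr => k _; rewrite /cI; ring.
Unshelve. all: by end_near. Qed.

Lemma dC_cexp a (c0 : C) : dC (fun s => cexp (s * c0)) a (c0 * cexp (a * c0)).
Proof.
have h := dC_cexp0 c0.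
have hc : (fun _ : C => cexp (a * c0)) @ (0 : C)^' --> cexp (a * c0) by exact: cvgC_cst.
have h2 : (fun e => e^-1 * (cexp ((0 + e) * c0) - cexp (0 * c0)) * cexp (a * c0)) @ (0 : C)^' --> c0 * cexp (a * c0).
  exact: (cvgCM h hc).
apply: cvg_trans h2; apply: near_eq_cvg; near=> e.
by rewrite add0r mul0r cexp0 mulrDl cexpD; ring.
Unshelve. all: by end_near. Qed.
Arguments dC_cexp : clear implicits.

Lemma dC_neg (f : C -> C) a l : dC f (- a) l -> dC (fun s => f (- s)) a (- l).
Proof.
move=> /cvgCP h; apply/cvgCP => d /h /dnbhsCP [r [r0 hr]]; apply/dnbhsCP; exists r; split => // e e0 er.
have := hr (- e); rewrite oppr_eq0 cabsN => /(_ e0 er); rewrite !add0r.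
have -> : (- e)^-1 * (f (- a - e) - f (- a)) - l = - (e^-1 * (f (- (a + e)) - f (- a)) - - l).
  have -> : - a - e = - (a + e) by rewrite opprD.
  by rewrite invrN; ring.
by rewrite cabsN.
Qed.

(** This is (-1)^m, in the exponential form in which it arises from the derivative of sin (a pi) at
    a = m. *)
Definition sgn (m : int) : C := cexp (m%:~R * ('i%C * pi%:C)).

Lemma cexp_ipi : cexp ('i%C * (pi : R)%:C) = -1.
Proof.
have -> : 'i%C * (pi : R)%:C = 0 +i* pi by apply: eqC => /=; ring.
by apply: eqC; rewrite ?Re_cexp ?Im_cexp /= expR0 mul1r ?cospi ?sinpi ?oppr0.
Qed.

Lemma sgn_sq m : sgn m * sgn m = 1.
Proof.
rewrite /sgn -cexpD -mulr2n -mulr_natl mulrA.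
have h (n : nat) : cexp (2%:R * n%:R * ('i%C * (pi : R)%:C)) = 1.
  by rewrite -natrM cexpMn cexp_ipi exprM sqrrN !expr1n.
case: m => n; first by rewrite -pmulrn h.
have E : (Negz n)%:~R = - n.+1%:R :> C by rewrite NegzE mulrNz -pmulrn.
by rewrite E mulrN mulNr cexpN h invr1.
Qed.

Lemma sgn_neq0 m : sgn m != 0.
Proof. exact: cexp_neq0. Qed.

Lemma sgnV m : (sgn m)^-1 = sgn m.
Proof. by apply: (mulIf (sgn_neq0 m)); rewrite mulVf ?sgn_neq0// sgn_sq. Qed.

Lemma csinE a : csin (a * pi%:C) = (cexp (a * ('i%C * pi%:C)) - cexp (a * - ('i%C * pi%:C))) / (2%:R * 'i%C).
Proof.
by rewrite /csin -complexiE; congr ((cexp _ - cexp _) / _); rewrite ?mulrN [in LHS]mulrCA.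
Qed.

Lemma i_neq0 : ('i%C : C) != 0.
Proof. by rewrite -cabs_eq0 /cabs /= expr0n expr1n add0r sqrtr1 oner_eq0. Qed.

Lemma two_i_neq0 : 2%:R * 'i%C != 0 :> C.
Proof. by rewrite mulf_neq0 ?i_neq0// pnatr_eq0. Qed.

Lemma csin_int m : csin (m%:~R * pi%:C : C) = 0.
Proof.
by rewrite csinE mulrN cexpN -/(sgn m) sgnV subrr mul0r.
Qed.

Lemma dC_csin (m : int) : dC (fun a => csin (a * pi%:C)) m%:~R (pi%:C * sgn m).
Proof.
have h1 := dC_cexp m%:~R ('i%C * pi%:C).
have h2 := dC_cexp m%:~R (- ('i%C * pi%:C)).
have h3 := dCM (dC_cst (-1) m%:~R) h2.
have h4 := dCM (dCD h1 h3) (dC_cst (2%:R * 'i%C)^-1 m%:~R).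
have E : (fun a => csin (a * pi%:C)) = (fun s => (cexp (s * ('i%C * pi%:C)) + -1 * cexp (s * - ('i%C * pi%:C))) * (2%:R * 'i%C)^-1).
  by apply/funext => a; rewrite csinE mulN1r.
rewrite E; move: h4; set L := (X in dC _ _ X -> _) => h4.
have -> : pi%:C * sgn m = L.
  rewrite /L mulrN cexpN -/(sgn m) sgnV !mulr0 addr0 mul0r add0r mulN1r mulNr opprK.
  by field; rewrite i_neq0.
exact: h4.
Qed.

Lemma dC_besselI (m : int) z : dC (fun a => besselI a z) m%:~R
  (cpow (z / 2%:R) m%:~R * (cLog (z / 2%:R) * ser (cI m%:~R) z + ser (dcI m) z)).
Proof.
have h1 := dC_cexp m%:~R (cLog (z / 2%:R)).
have h2 := dCM h1 (@dC_ser m z).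
have E : (fun a => besselI a z) = (fun s => cexp (s * cLog (z / 2%:R)) * ser (cI s) z).
  by apply/funext => s; rewrite besselIE.
rewrite E /cpow; move: h2; set L := (X in dC _ _ X -> _) => h2.
have -> : cexp (m%:~R * cLog (z / 2%:R)) * (cLog (z / 2%:R) * ser (cI m%:~R) z + ser (dcI m) z) = L by rewrite /L; ring.
exact: h2.
Qed.

(* (z/2)^m Klog m z is the derivative of I_a z in the order a at a = m. *)
Definition Klog (m : int) z := cLog (z / 2%:R) * ser (cI m%:~R) z + ser (dcI m) z.

(** L'Hospital's rule at a = m: since I_(-m) = I_m, numerator and denominator both vanish there, and
    dividing both by e turns them into difference quotients in the order. *)
Lemma besselK_int (m : int) z : z != 0 ->
  besselK m%:~R z = - (sgn m / 2%:R) * (cpow (z / 2%:R) m%:~R * Klog m z + cpow (z / 2%:R) (- m%:~R) * Klog (- m) z).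
Proof.
move=> z0; rewrite /besselK.
have -> : `[< exists n : int, m%:~R = n%:~R :> C >] by apply/asboolP; exists m.
apply: cvgC_lim; apply/dnbhsC_shift.
have h1 := @dC_besselI m z.
have h2 : dC (fun a => besselI a z) (- m%:~R) (cpow (z / 2%:R) (- m%:~R) * Klog (- m) z).
  have E : (- m)%:~R = - m%:~R :> C by rewrite mulrNz.
  rewrite -E; exact: dC_besselI.
have h3 := dC_neg h2; have h4 := @dC_csin m.
have p0 : (pi : R)%:C != 0 :> C by apply: posC_neq0; exact: pi_gt0.
have s0 := sgn_neq0 m.
have h5 : (fun e => (e^-1 * (csin ((m%:~R + e) * pi%:C) - csin (m%:~R * pi%:C)))^-1) @ (0 : C)^' --> (pi%:C * sgn m)^-1.
  exact: (cvgCV (mulf_neq0 p0 s0) h4).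
have hc : (fun _ : C => (pi : R)%:C / 2%:R) @ (0 : C)^' --> (pi : R)%:C / 2%:R by exact: cvgC_cst.
set A := cpow (z / 2%:R) m%:~R * Klog m z in h1 *.
set B := cpow (z / 2%:R) (- m%:~R) * Klog (- m) z in h3 *.
have h6 : (fun e => pi%:C / 2%:R * (e^-1 * (besselI (- (m%:~R + e)) z - besselI (- m%:~R) z) - e^-1 * (besselI (m%:~R + e) z - besselI m%:~R z)) * (e^-1 * (csin ((m%:~R + e) * pi%:C) - csin (m%:~R * pi%:C)))^-1) @ (0 : C)^' --> pi%:C / 2%:R * (- B - A) * (pi%:C * sgn m)^-1.
  exact: (cvgCM (cvgCM hc (cvgCB h3 h1)) h5).
have -> : - (sgn m / 2%:R) * (A + B) = pi%:C / 2%:R * (- B - A) * (pi%:C * sgn m)^-1.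
  have aux (p s : C) : p != 0 -> s != 0 -> - (s^-1 / 2%:R) * (A + B) = p / 2%:R * (- B - A) * (p * s)^-1.
    by move=> h h'; field; rewrite h h'.
  by rewrite -{1}sgnV; exact: aux.
apply: cvg_trans h6; apply: near_eq_cvg.
have := @near_dnbhsC R 1 ltr01; apply: filterS => e [e0 _].
rewrite /besselK_nonint csin_int subr0 !besselIE ser_int_sym//.
have aux (p X Y Z d : C) : p * (e^-1 * (X - Z) - e^-1 * (Y - Z)) * (e * d) = p * (X - Y) * d.
  by field.
by rewrite invfM invrK; exact: aux.
Qed.

End BesselSeries.

Arguments hasDZ {R} a {f f'} _.
Arguments hasD_sum {R I} l {f f'} _.
Arguments tow_scl {R} s {phi} _.

(** * Bessel's differential equation for the series and the logarithmic solution *)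

Section BesselEquation.
Variable R : realType.
Local Notation C := R[i].
Implicit Types (a b s z w t nu : C) (x : R) (f g r rr : R -> C) (phi psi : nat -> R -> C) (F : C -> C) (c d : nat -> C).
Local Notation Re := complex.Re.
Local Notation Im := complex.Im.

(** Convergence everywhere, which unlike [ent] is stable under the factor 2 k produced by theta. *)
Definition sm c := forall X : R, 0 <= X -> exists B, forall N, \sum_(0 <= k < N) cabs (c k) * X ^+ k <= B.

Lemma ent_sm c : ent c -> sm c.
Proof. by move=> h X; exact: ent_bnd. Qed.

Lemma sm_mulk c : sm c -> sm (fun k => (2 * k)%:R * c k).
Proof.
move=> h X X0; have [|B hB] := h (2 * X); first by rewrite mulr_ge0.
exists (2 * B) => N; apply: le_trans (ler_wpM2l _ (hB N)) => //.
rewrite big_distrr /=; apply: ler_sum => k _; rewrite cabsM cabs_nat exprMn natrM.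
have hk : k%:R <= 2 ^+ k :> R by rewrite -natrX ler_nat ltnW// ltn_expl.
have -> : 2 * (cabs (c k) * (2 ^+ k * X ^+ k)) = 2 * 2 ^+ k * (cabs (c k) * X ^+ k) by ring.
by rewrite -mulrA ler_wpM2r ?mulr_ge0 ?cabs_ge0 ?exprn_ge0// ler_wpM2l.
Qed.

Lemma sm_lin a b c d : sm c -> sm d -> sm (fun k => a * c k + b * d k).
Proof.
move=> hc hd X X0; have [B hB] := hc X X0; have [B' hB'] := hd X X0.
exists (cabs a * B + cabs b * B') => N.
apply: le_trans (lerD (ler_wpM2l (cabs_ge0 a) (hB N)) (ler_wpM2l (cabs_ge0 b) (hB' N))).
rewrite !big_distrr -big_split /=; apply: ler_sum => k _.
have -> : cabs a * (cabs (c k) * X ^+ k) + cabs b * (cabs (d k) * X ^+ k) = (cabs a * cabs (c k) + cabs b * cabs (d k)) * X ^+ k by ring.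
by rewrite ler_wpM2r ?exprn_ge0// (le_trans (cabsD _ _))// !cabsM.
Qed.
Arguments sm_lin a b {c d} _ _.

Lemma sm_sum c x : sm c -> hassum (fun k => c k * half x ^+ (2 * k)) (evenE c x).
Proof. by move=> h; have [B hB] := evenE_abs x h; exact: absbnd_hassum hB. Qed.

Arguments sm_sum {c} x _.
Lemma evenE_lin c d a b x : sm c -> sm d -> evenE (fun k => a * c k + b * d k) x = a * evenE c x + b * evenE d x.
Proof.
move=> hc hd; apply: hassum_csum.
have h := hassumD (hassumZ (c := a) (sm_sum x hc)) (hassumZ (c := b) (sm_sum x hd)).
by apply: cvg_trans h; apply: near_eq_cvg; near=> N; apply: eq_bigr => k _; ring.
Unshelve. all: by end_near. Qed.

Lemma evenE_shift c d x : sm c -> d 0%N = 0 -> (forall k, d k.+1 = 4%:R * c k) ->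
  evenE d x = x%:C ^+ 2 * evenE c x.
Proof.
move=> hc d0 dS.
have xE : x%:C ^+ 2 = 4%:R * half x ^+ 2.
  rewrite /half -!rmorphXn -(rmorph_nat (real_complex R)) -rmorphM; congr (_%:C).
  by field.
have h := hassumZ (c := x%:C ^+ 2) (sm_sum x hc).
apply: hassum_csum; rewrite /hassum -(@cvg_shiftS (R[i]^o)).
apply: cvg_trans h; apply: near_eq_cvg; near=> N.
rewrite /= psumSl d0 mul0r add0r; apply: eq_bigr => k _.
by rewrite dS xE mulnS exprD; ring.
Unshelve. all: by end_near. Qed.

Lemma serE c x : ser c x%:C = evenE c x.
Proof.
rewrite /ser /evenE /half; congr csum; apply/funext => k.
by rewrite rmorphM /= fmorphV rmorph_nat.
Qed.

Arguments evenE_lin {c d} a b x _ _.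
(* The (modified) Bessel equation with an inhomogeneity rr, which appears for the logarithmic solution. *)
Definition ODEr nu f rr := exists f1 f2, [/\ hasD f f1, hasD f1 f2 &
  forall x, 0 < x -> f2 x + nu * f1 x = x%:C ^+ 2 * f x + rr x].

Lemma ODEr_add nu f g r1 r2 : ODEr nu f r1 -> ODEr nu g r2 -> ODEr nu (fun x => f x + g x) (fun x => r1 x + r2 x).
Proof.
move=> [f1 [f2 [a1 a2 a3]]] [g1 [g2 [b1 b2 b3]]].
exists (fun x => f1 x + g1 x), (fun x => f2 x + g2 x).
split; [exact: hasDD a1 b1|exact: hasDD a2 b2|] => x x0.
have := a3 x x0; have := b3 x x0 => e1 e2.
have -> : f2 x + g2 x + nu * (f1 x + g1 x) = (f2 x + nu * f1 x) + (g2 x + nu * g1 x) by ring.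
by rewrite e1 e2; ring.
Qed.

Lemma ODEr_scl nu f r1 a : ODEr nu f r1 -> ODEr nu (fun x => a * f x) (fun x => a * r1 x).
Proof.
move=> [f1 [f2 [a1 a2 a3]]].
exists (fun x => a * f1 x), (fun x => a * f2 x).
split; [exact: hasDZ a1|exact: hasDZ a2|] => x x0.
have := a3 x x0 => e1.
have -> : a * f2 x + nu * (a * f1 x) = a * (f2 x + nu * f1 x) by ring.
by rewrite e1; ring.
Qed.
Arguments ODEr_scl {nu f r1} a _.

Lemma ODEr_ext nu f g r1 r2 : (forall x, 0 < x -> f x = g x) -> (forall x, 0 < x -> r1 x = r2 x) ->
  ODEr nu f r1 -> ODEr nu g r2.
Proof.
move=> fg rr [f1 [f2 [a1 a2 a3]]]; exists f1, f2; split; [|exact: a2|].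
  by apply: (hasD_ext fg _ a1).
by move=> x x0; rewrite a3// fg// rr.
Qed.

(** Conjugation by x^(-nu) turns theta (theta + nu) into (theta - nu) theta, which exchanges the two
    indicial roots. *)
Lemma ODEr_pow nu f r1 : ODEr (- nu) f r1 ->
  ODEr nu (fun x => cpow (half x) (- nu) * f x) (fun x => cpow (half x) (- nu) * r1 x).
Proof.
move=> [f1 [f2 [a1 a2 a3]]]; pose p x := cpow (half x) (- nu).
have hp := @hasD_pow R (- nu).
have b1 := hasDM hp a1; have b2 := hasDM hp a2.
exists (fun x => (- nu * p x) * f x + p x * f1 x).
exists (fun x => - nu * ((- nu * p x) * f x + p x * f1 x) + ((- nu * p x) * f1 x + p x * f2 x)).
split; first exact: b1.
  apply: (hasD_ext _ _ (hasDD (hasDZ (- nu) b1) b2)) => x _ //; rewrite /p; ring.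
move=> x x0; have := a3 x x0 => e1; rewrite -/(p x).
have -> : x%:C ^+ 2 * (p x * f x) + p x * r1 x = p x * (x%:C ^+ 2 * f x + r1 x) by ring.
rewrite -e1; ring.
Qed.

Lemma cI_rec a k : k.+1%:R * (k.+1%:R + a) * cI a k.+1 = cI a k.
Proof.
rewrite /cI (rgamma_rec (a + k%:R + 1)) factS natrM.
have -> : a + k.+1%:R + 1 = a + k%:R + 1 + 1 by rewrite -natr1; ring.
have -> : k.+1%:R + a = a + k%:R + 1 by rewrite -natr1; ring.
by field; rewrite fact_neq0 /= nat1r natS_neq0.
Qed.

Lemma ODE_I a : ODEr (2%:R * a) (evenE (cI a)) (fun=> 0).
Proof.
have s0 := ent_sm (ent_cI a); have s1 := sm_mulk s0.
exists (evenE (fun k => (2 * k)%:R * cI a k)), (evenE (fun k => (2 * k)%:R * ((2 * k)%:R * cI a k))).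
split; [exact: hasD_even|exact: hasD_even|] => x x0.
rewrite addr0 -(@evenE_shift (cI a) (fun k => 1 * ((2 * k)%:R * ((2 * k)%:R * cI a k)) + 2%:R * a * ((2 * k)%:R * cI a k)))//.
- by rewrite evenE_lin ?mul1r//; exact: sm_mulk.
- by rewrite muln0 !mul0r !mulr0 addr0.
- by move=> k; rewrite -(cI_rec a k) natrM; ring.
Qed.

(** The derivative in a of the recurrence [cI_rec] at a = m. *)
Lemma dcI_rec (m : int) k : k.+1%:R * (k.+1%:R + m%:~R) * dcI R m k.+1 = dcI R m k - k.+1%:R * cI m%:~R k.+1.
Proof.
have h := drg_rec R (m + k%:Z + 1).
have E : m + k%:Z + 1 + 1 = m + k.+1%:Z + 1 by rewrite -addn1 PoszD; ring.
have E2 : (m + k%:Z + 1)%:~R = k.+1%:R + m%:~R :> C by rewrite !intrD -pmulrn -natr1; ring.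
rewrite /dcI h E E2 /cI factS natrM.
have -> : m%:~R + k.+1%:R + 1 = k.+1%:R + m%:~R + 1 :> C by ring.
by field; rewrite fact_neq0 /= nat1r natS_neq0.
Qed.

Definition KL (m : int) x : C := cLog (half x) * evenE (cI m%:~R) x + evenE (dcI R m) x.

(** Since theta log = 1, the product with the logarithm leaves 2 theta P + 2 m P, where P is the
    series of order m. The equation of the differentiated series cancels 2 theta P. The remaining
    term cancels between the orders m and -m in K. *)
Lemma ODE_KL (m : int) : ODEr (2%:R * m%:~R) (KL m) (fun x => 2%:R * m%:~R * evenE (cI m%:~R) x).
Proof.
have s0 := ent_sm (ent_cI (m%:~R : C)); have s1 := sm_mulk s0.
have t0 := ent_sm (ent_dcI R m); have t1 := sm_mulk t0.
pose P := evenE (cI (m%:~R : C)); pose P1 := evenE (fun k => (2 * k)%:R * cI (m%:~R : C) k).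
pose P2 := evenE (fun k => (2 * k)%:R * ((2 * k)%:R * cI (m%:~R : C) k)).
pose Q := evenE (dcI R m); pose Q1 := evenE (fun k => (2 * k)%:R * dcI R m k).
pose Q2 := evenE (fun k => (2 * k)%:R * ((2 * k)%:R * dcI R m k)).
have p0 : hasD P P1 := hasD_even s0. have p1 : hasD P1 P2 := hasD_even s1.
have q0 : hasD Q Q1 := hasD_even t0. have q1 : hasD Q1 Q2 := hasD_even t1.
have hl := @hasD_ln R.
have d1 := hasDD (hasDM hl p0) q0.
have d2 := hasDD (hasDD (hasDZ 1 p0) (hasDM hl p1)) q1.
exists (fun x => 1 * P x + cLog (half x) * P1 x + Q1 x).
exists (fun x => 1 * P1 x + (1 * P1 x + cLog (half x) * P2 x) + Q2 x).
split; [exact: d1|exact: d2|] => x x0.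
have eP : P2 x + 2%:R * m%:~R * P1 x = x%:C ^+ 2 * P x.
  rewrite -(@evenE_shift (cI m%:~R) (fun k => 1 * ((2 * k)%:R * ((2 * k)%:R * cI m%:~R k)) + 2%:R * m%:~R * ((2 * k)%:R * cI m%:~R k)))//.
  - by rewrite evenE_lin ?mul1r//; exact: sm_mulk.
  - by rewrite muln0 !mul0r !mulr0 addr0.
  - by move=> k; rewrite -(cI_rec _ k) natrM; ring.
have eQ : Q2 x + 2%:R * m%:~R * Q1 x = x%:C ^+ 2 * Q x - 2%:R * P1 x.
  rewrite -(@evenE_shift (dcI R m) (fun k => 1 * (1 * ((2 * k)%:R * ((2 * k)%:R * dcI R m k)) + 2%:R * m%:~R * ((2 * k)%:R * dcI R m k)) + 2%:R * ((2 * k)%:R * cI m%:~R k)))//.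
  - have tt : sm (fun k => 1 * ((2 * k)%:R * ((2 * k)%:R * dcI R m k)) + 2%:R * m%:~R * ((2 * k)%:R * dcI R m k)).
      exact: (sm_lin 1 (2%:R * m%:~R) (sm_mulk t1) t1).
    rewrite (evenE_lin 1 2%:R x tt s1) (evenE_lin 1 (2%:R * m%:~R) x (sm_mulk t1) t1).
    by rewrite !mul1r addrK.
  - by rewrite muln0; ring.
  - move=> k; have h := dcI_rec m k.
    have -> : dcI R m k = k.+1%:R * (k.+1%:R + m%:~R) * dcI R m k.+1 + k.+1%:R * cI m%:~R k.+1 by rewrite h subrK.
    by rewrite natrM; ring.
rewrite /KL -/(P x) -/(Q x) -/P.
have -> : x%:C ^+ 2 * (cLog (half x) * P x + Q x) + 2%:R * m%:~R * P x =
  cLog (half x) * (x%:C ^+ 2 * P x) + (x%:C ^+ 2 * Q x - 2%:R * P1 x) + 2%:R * P1 x + 2%:R * m%:~R * P x by ring.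
by rewrite -eP -eQ; ring.
Qed.

End BesselEquation.

(** * The second factor of G: expansion, equation and behaviour at 0 *)

Section BesselSides.
Variable R : realType.
Local Notation C := R[i].
Implicit Types (a b s z w t nu : C) (x : R) (f g r rr : R -> C) (phi psi : nat -> R -> C) (F : C -> C) (c d : nat -> C).
Local Notation Re := complex.Re.
Local Notation Im := complex.Im.

Lemma evenv0 c x : evenv c 0 x = evenE c x.
Proof. by rewrite /evenv; congr (evenE _ x); apply/funext => k; rewrite rf0 mulr1. Qed.

Lemma mulv0 phi psi x : mulv phi psi 0 x = phi 0%N x * psi 0%N x.
Proof. by rewrite /mulv /conv big_nat1. Qed.

Lemma powv0 s x : powv s 0 x = cpow (half x) s.
Proof. by rewrite /powv rf0 mul1r. Qed.

Lemma halfE x : x%:C / 2%:R = half x.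
Proof. by rewrite /half rmorphM /= fmorphV rmorph_nat. Qed.

(** This package is all that the second factor contributes; [Ktil_side] has the same form, so I and
    K can be treated alike as second factors. The leading constant is wanted only for real nu >
    0. *)
Lemma Itil_side nu : exists phi, [/\ AT (Itil (nu / 2%:R)) phi, ODEr nu (phi 0%N) (fun=> 0) &
  forall v : R, 0 < v -> nu = v%:C -> exists2 c : C, c != 0 & Asy phi 0 c].
Proof.
exists (evenv (cI (nu / 2%:R))); split.
- apply: AT_ext (AT_even (ent_cI (nu / 2%:R))) => z _; by rewrite ItilE.
- have := ODE_I (nu / 2%:R); rewrite mulrC divfK ?pnatr_eq0// => h.
  by apply: ODEr_ext h => // x _; rewrite evenv0.
- move=> v v0 ->; exists (cI (v%:C / 2%:R) 0); last exact: Asy_even (ent_cI _).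
  rewrite /cI fact0 divr1 addr0; apply: rgamma_neq0 => n.
  rewrite halfE /half -(rmorph1 (real_complex R)) -rmorphD -(rmorphMn (real_complex R)) -rmorphN.
  rewrite (inj_eq (@complexI R)) gt_eqF// (@le_lt_trans _ _ 0)// ?oppr_le0//.
  by rewrite addr_gt0// divr_gt0.
Qed.

Lemma csin_neq0 (a : R) : ~ (exists n : int, a%:C = n%:~R :> C) -> csin (a%:C * pi%:C : C) != 0.
Proof.
move=> ha; pose m := Num.floor a; pose be := a - m%:~R.
have [b0 b1] : 0 <= be /\ be < 1.
  have := floor_itv a; rewrite -/m => /andP[h1 h2]; rewrite /be subr_ge0 h1; split => //.
  by rewrite ltrBlDr; move: h2; rewrite intrD addrC.
have mC : (m%:~R : R)%:C = m%:~R :> C by rewrite rmorph_int.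
have be0 : 0 < be.
  rewrite lt_neqAle b0 andbT eq_sym subr_eq0; apply/eqP => e; apply: ha; exists m.
  by rewrite e mC.
have aE : a%:C = m%:~R + be%:C :> C by rewrite /be -mC -rmorphD /= addrC subrK.
rewrite csinE aE ![(m%:~R + _) * _]mulrDl !cexpD [m%:~R * - _]mulrN cexpN -/(sgn R m) sgnV -mulrBr -mulrA.
rewrite mulf_neq0 ?sgn_neq0//.
have -> : (cexp (be%:C * ('i%C * pi%:C)) - cexp (be%:C * - ('i%C * pi%:C))) / (2%:R * 'i%C) = (sin (be * pi))%:C.
  have e1 : be%:C * ('i%C * pi%:C) = 0 +i* (be * pi) by apply: eqC => /=; ring.
  have e2 : be%:C * - ('i%C * pi%:C) = 0 +i* - (be * pi) by apply: eqC => /=; ring.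
  rewrite e1 e2; apply: (mulIf (two_i_neq0 R)); rewrite divfK ?two_i_neq0//.
  apply: eqC; rewrite ?ReB ?ImB ?Re_cexp ?Im_cexp /= expR0 ?cosN ?sinN; ring.
rewrite posC_neq0// sin_gt0_pi// mulr_gt0 ?pi_gt0//=.
by rewrite gtr_pMl// pi_gt0.
Qed.

Lemma twist_aux (k P p A B : C) : P * p = 1 -> k * (A + P * P * B) = P * (k * (p * A + P * B)).
Proof. by move=> h; rewrite -[A in LHS]mul1r -h; ring. Qed.

Lemma nonint_aux (P p k1 k2 A B : C) : P * p = 1 ->
  P * (k1 * (P * A - p * B) / k2) = k1 / k2 * (P * P * A + -1 * B).
Proof.
move=> h; have e : B = P * p * B by rewrite h mul1r.
by rewrite [in RHS]e; ring. Qed.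

Lemma comb_aux (k l P E F G H : C) : P * F = E ->
  k * (2%:R * (l * E) + G + P * H) = k * (l * E + G + P * (l * F + H)).
Proof. by move=> <-; ring. Qed.

Lemma tow_ext phi psi : tow phi -> tow psi -> (forall x, 0 < x -> phi 0%N x = psi 0%N x) ->
  forall n x, 0 < x -> phi n x = psi n x.
Proof.
move=> h1 h2 h n x x0; apply/eqP; rewrite -subr_eq0 -mulN1r; apply/eqP.
have td := tow_add h1 (tow_scl (-1) h2).
apply: (tow0 td _ n x0) => y y0.
by rewrite /addv /sclv h// mulN1r subrr.
Qed.

Lemma cancel_aux (k n P E F : C) : P * F = E -> k * (n * E + P * (- n * F)) = 0.
Proof. by move=> <-; ring. Qed.

Definition KLv (m : int) : nat -> R -> C := addv (mulv (@logv R) (evenv (cI m%:~R))) (evenv (dcI R m)).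

Lemma AT_KL (m : int) : AT (Klog m) (KLv m).
Proof.
exact: (AT_add (AT_mul (@AT_log R) (AT_even (ent_cI m%:~R))) (AT_even (ent_dcI R m))).
Qed.

Lemma KLv0 (m : int) x : KLv m 0 x = KL m x.
Proof. by rewrite /KLv /addv mulv0 !evenv0. Qed.

Lemma Asy_ext phi psi (s : R) (c : C) : (forall n x, 0 < x -> phi n x = psi n x) -> Asy phi s c -> Asy psi s c.
Proof.
move=> h h1 n; apply: cvg_trans (h1 n); apply: near_eq_cvg.
by move: (near_right R); apply: filterS => x x0; rewrite h.
Qed.

Lemma psi0E (k l p : C) (c d e : nat -> C) x :
  sclv k (addv (addv (sclv l (mulv (@logv R) (evenv c))) (evenv d)) (mulv (powv p) (evenv e))) 0%N x =
  k * (l * (cLog (half x) * evenE c x) + evenE d x + cpow (half x) p * evenE e x).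
Proof. by rewrite /sclv /addv !mulv0 !evenv0 powv0. Qed.

Lemma phi0E (k p : C) (m m' : int) x :
  sclv k (addv (KLv m) (mulv (powv p) (KLv m'))) 0%N x = k * (KL m x + cpow (half x) p * KL m' x).
Proof. by rewrite /sclv /addv mulv0 powv0 !KLv0. Qed.

(** The combination of the orders m and -m gives the equation but hides the size at 0: a logarithm
    stands next to x^(-nu), although the series of order -m starts late. A second form of the same
    coefficients exhibits the size. *)
Lemma Ktil_int_side (m : int) : exists phi, [/\ AT (Ktil m%:~R) phi, ODEr (2%:R * m%:~R) (phi 0%N) (fun=> 0) &
  forall v : R, 0 < v -> 2%:R * m%:~R = v%:C :> C -> exists2 c : C, c != 0 & Asy phi v c].
Proof.
pose nu : C := 2%:R * m%:~R.
pose phi := sclv (- (sgn R m / 2%:R)) (addv (KLv m) (mulv (powv (- nu)) (KLv (- m)))).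
have tphi : AT (Ktil m%:~R) phi.
  have h := AT_scl (- (sgn R m / 2%:R)) (AT_add (AT_KL m) (AT_mul (AT_pow (- nu)) (AT_KL (- m)))).
  apply: AT_ext h => z /Re_neq0 z0; rewrite /Ktil besselK_int//.
  have -> : - nu = - m%:~R + - m%:~R by rewrite /nu; ring.
  rewrite -cpow_mul.
  have h1 : cpow (z / 2%:R) (- m%:~R) * cpow (z / 2%:R) m%:~R = 1 by rewrite cpow_mul addNr cpow0.
  exact: twist_aux h1.
have sym x : 0 < x -> cpow (half x) (- nu) * evenE (cI (- m)%:~R) x = evenE (cI m%:~R) x.
  move=> x0; have := ser_int_sym m (posC_neq0 x0); rewrite halfE !serE => h.
  have -> : - nu = - m%:~R + - m%:~R by rewrite /nu; ring.
  rewrite mulrNz -cpow_mul -mulrA h mulrA cpow_mul addNr cpow0 mul1r//.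
exists phi; split => //.
  have h1 := ODE_KL R m.
  have h2 : ODEr (- nu) (KL (- m)) (fun x => - nu * evenE (cI (- m)%:~R) x).
    by have := ODE_KL R (- m); rewrite mulrNz mulrN.
  have h3 := ODEr_scl (- (sgn R m / 2%:R)) (ODEr_add h1 (ODEr_pow h2)).
  apply: ODEr_ext h3 => x x0.
    by rewrite /phi /sclv /addv mulv0 -!KLv0 powv0.
  exact: cancel_aux (sym x x0).
move=> v v0 nuv.
have mv : m%:~R = (v / 2)%:C :> C.
  by rewrite -[RHS]/(half v) -halfE -nuv mulrC mulKf// pnatr_eq0.
have m0 : 0 < m.
  have : (0 : C) < m%:~R by rewrite mv ltcR divr_gt0.
  by rewrite ltr0z.
case: m m0 @nu @phi tphi sym nuv mv => [[|n]|]// _ nu phi tphi sym nuv mv.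
(* By I_(-m) = I_m both logarithms join the series of order m and become negligible. What dominates
   is x^(-nu) times a series whose first coefficient is the non-zero derivative of 1/Gamma at -n.
   Agreement at index 0 spreads to all indices by [tow_ext]. *)
pose psi := sclv (- (sgn R n.+1 / 2%:R)) (addv (addv (sclv 2%:R (mulv (@logv R) (evenv (cI n.+1%:~R)))) (evenv (dcI R n.+1)))
   (mulv (powv (- nu)) (evenv (dcI R (- n.+1%:Z))))).
have apsi : Asy psi v (- (sgn R n.+1 / 2%:R) * (2%:R * 0 + 0 + 1 * dcI R (- n.+1%:Z) 0)).
  apply: Asy_scl; apply: Asy_add; first apply: Asy_add.
  - apply: Asy_scl; have := Asy_mul (Asy_log v0) (Asy_even (ent_cI n.+1%:~R)).
    by rewrite mul0r addr0.
  - exact: Asy_weak v0 (Asy_even (ent_dcI R n.+1)).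
  - have h := Asy_mul (@Asy_pow R (- v)) (Asy_even (ent_dcI R (- n.+1%:Z))).
    by rewrite opprK addr0 rmorphN /= -nuv in h.
have tow_psi : tow psi.
  apply: tow_scl; apply: tow_add; first apply: tow_add.
  - by apply: tow_scl; apply: tow_mul; [case: (@AT_log R)|case: (AT_even (ent_cI (n.+1%:~R : C)))].
  - by case: (AT_even (ent_dcI R n.+1)).
  - by apply: tow_mul; [case: (@AT_pow R (- nu))|case: (AT_even (ent_dcI R (- n.+1%:Z)))].
have eqv k x : 0 < x -> psi k x = phi k x.
  apply: (tow_ext tow_psi (proj1 tphi)) => y y0.
  apply: etrans (psi0E _ _ _ _ _ _ _) _; apply: etrans (comb_aux _ _ _ _ (sym y y0)) _.
  by symmetry; exact: phi0E.
exists (- (sgn R n.+1 / 2%:R) * (2%:R * 0 + 0 + 1 * dcI R (- n.+1%:Z) 0)); last exact: Asy_ext eqv apsi.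
rewrite mulr0 !add0r mul1r mulf_neq0 ?oppr_eq0//.
  by rewrite mulf_neq0 ?sgn_neq0// invr_eq0 pnatr_eq0.
rewrite /dcI fact0 divr1 addr0.
have -> : - n.+1%:Z + 1 = - n%:Z by rewrite -addn1 PoszD opprD subrK.
exact: drgN_neq0.
Qed.

Lemma Ktil_nonint a z : ~ (exists n : int, a = n%:~R) -> z != 0 ->
  Ktil a z = pi%:C / 2%:R / csin (a * pi%:C) * (cpow (z / 2%:R) (- (2%:R * a)) * ser (cI (- a)) z + -1 * ser (cI a) z).
Proof.
move=> ha z0; rewrite /Ktil /besselK asboolF// /besselK_nonint !besselIE.
have -> : - (2%:R * a) = - a + - a by ring.
rewrite -cpow_mul.
have h1 : cpow (z / 2%:R) (- a) * cpow (z / 2%:R) a = 1 by rewrite cpow_mul addNr cpow0.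
exact: nonint_aux h1.
Qed.

Lemma rgamma_nonint (a : R) : ~ (exists n : int, a%:C = n%:~R :> C) -> rgamma (- a%:C + 1 : C) != 0.
Proof.
move=> ha; apply: rgamma_neq0 => n; apply/eqP => e; apply: ha; exists (n%:Z + 1).
by rewrite intrD -pmulrn -[n%:R]opprK -e opprD opprK subrK.
Qed.

Lemma Ktil_side nu : exists phi, [/\ AT (Ktil (nu / 2%:R)) phi, ODEr nu (phi 0%N) (fun=> 0) &
  forall v : R, 0 < v -> nu = v%:C -> exists2 c : C, c != 0 & Asy phi v c].
Proof.
have nuE : nu = 2%:R * (nu / 2%:R) by rewrite mulrC divfK// pnatr_eq0.
have [[m hm]|ha] := pselect (exists n : int, nu / 2%:R = n%:~R).
  by rewrite hm in nuE *; rewrite nuE; exact: Ktil_int_side.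
pose a := nu / 2%:R.
pose kp := pi%:C / 2%:R / csin (a * pi%:C) : C.
pose phi := sclv kp (addv (mulv (powv (- nu)) (evenv (cI (- a)))) (sclv (-1) (evenv (cI a)))).
exists phi; split.
- have h := AT_scl kp (AT_add (AT_mul (AT_pow (- nu)) (AT_even (ent_cI (- a)))) (AT_scl (-1) (AT_even (ent_cI a)))).
  apply: AT_ext h => z /Re_neq0 z0; rewrite Ktil_nonint//.
  by rewrite -nuE.
- have h1 : ODEr (- nu) (evenE (cI (- a))) (fun=> 0).
    by have := ODE_I (- a); rewrite mulrN -nuE.
  have h2 : ODEr nu (evenE (cI a)) (fun=> 0) by have := ODE_I a; rewrite -nuE.
  have h3 := ODEr_scl kp (ODEr_add (ODEr_pow h1) (ODEr_scl (-1) h2)).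
  apply: ODEr_ext h3 => x x0; last by rewrite !mulr0 addr0 mulr0.
  by rewrite /phi /sclv /addv mulv0 !evenv0 powv0.
move=> v v0 nuv.
have aE : a = (v / 2)%:C by rewrite -[RHS]/(half v) -halfE -nuv.
exists (kp * (1 * cI (- a) 0 + -1 * 0)).
  rewrite mulr0 addr0 mul1r mulf_neq0//.
    rewrite /kp mulf_neq0// ?invr_eq0 ?aE ?csin_neq0 -?aE//.
    by rewrite mulf_neq0 ?invr_eq0 ?pnatr_eq0// posC_neq0// pi_gt0.
  by rewrite /cI fact0 divr1 addr0 aE rgamma_nonint// -aE.
apply: Asy_scl; apply: Asy_add.
  have h := Asy_mul (@Asy_pow R (- v)) (Asy_even (ent_cI (- a))).
  by rewrite opprK addr0 rmorphN /= -nuv in h.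
apply: Asy_scl; exact: Asy_weak v0 (Asy_even (ent_cI a)).
Qed.

End BesselSides.

(** * Formal coefficients and the operator identity *)

Section ShiftedConvolutions.
Variable R : realType.
Local Notation C := R[i].
Implicit Types (a b s z t nu mu : C) (x : R) (u v f g : nat -> C) (n m J : nat).

Lemma conv_poly u v N n : (n < N)%N ->
  conv u v n = ((\poly_(i < N) u i) * (\poly_(i < N) v i))`_n.
Proof.
move=> nN; rewrite coefM /conv big_mkord; apply: eq_bigr => i _.
by rewrite !coef_poly (leq_ltn_trans _ nN) ?leq_ord// (leq_ltn_trans _ nN) ?leq_subr.
Qed.

(** Coefficients up to n only see truncations at degree n, so associativity is inherited from
    polynomials. *)
Lemma convA u v f n : conv (conv u v) f n = conv u (conv v f) n.
Proof.
have nN := ltnSn n.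
have e (p q r : nat -> C) : (forall k, (k <= n)%N -> p k = q k) -> conv p r n = conv q r n.
  by move=> h; apply: eq_big_nat => k /andP[_ kn]; rewrite h.
have e' (p q r : nat -> C) : (forall k, (k <= n)%N -> p k = q k) -> conv r p n = conv r q n.
  by move=> h; apply: eq_big_nat => k /andP[_ kn]; rewrite h// leq_subr.
pose P (p : nat -> C) := \poly_(i < n.+1) p i.
have cP (p : {poly C}) k : (k <= n)%N -> (P (nth 0 p))`_k = p`_k by move=> kn; rewrite coef_poly ltnS kn.
have M (p q : {poly C}) : (P (nth 0 p) * q)`_n = (p * q)`_n.
  rewrite !coefM; apply: eq_bigr => i _; by rewrite cP// -ltnS.
have M' (p q : {poly C}) : (q * P (nth 0 p))`_n = (q * p)`_n by rewrite mulrC M mulrC.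
rewrite (e _ (nth 0 (P u * P v)) f); last by move=> k kn; exact: conv_poly.
rewrite (e' _ (nth 0 (P v * P f)) u); last by move=> k kn; exact: conv_poly.
by rewrite !(conv_poly _ _ nN) -/(P _) -/(P _) M M' mulrA.
Qed.

Definition sh f n : C := if n is n'.+1 then f n' else 0.

Lemma conv_rf_shift f b n :
  conv f (rf b) n = conv f (rf (b + 1)) n - sh (conv f (rf (b + 1))) n.
Proof.
case: n => [|n] /=; first by rewrite /conv !big_nat1 !rf0 subr0.
rewrite /conv [X in X = _]psumS [X in _ = X - _]psumS subnn !rf0 -addrAC -sumrB; congr (_ + _).
apply: eq_big_nat => i /andP[_ iN]; rewrite subSn// rf_shift; ring.
Qed.

(** Apply t d/dt to f (1 - t)^(-b). Writing f' as ((1 - t) f') / (1 - t) puts both resulting terms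
    at exponent b + 1, with the coefficients of [thv] in the second. *)
Lemma conv_rf_deriv f b n : n%:R * conv f (rf b) n =
  b * sh (conv f (rf (b + 1))) n + sh (conv (fun i => i.+1%:R * f i.+1 - i%:R * f i) (rf (b + 1))) n.
Proof.
case: n => [|n] /=; first by rewrite mul0r mulr0 addr0.
pose T1 := \sum_(0 <= i < n.+2) i%:R * f i * rf b (n.+1 - i)%N.
pose T2 := \sum_(0 <= i < n.+2) f i * ((n.+1 - i)%:R * rf b (n.+1 - i)%N).
have -> : n.+1%:R * conv f (rf b) n.+1 = T1 + T2.
  rewrite /T1 /T2 -big_split /conv big_distrr; apply: eq_big_nat => i /andP[_ iN] /=.
  by rewrite -[in LHS](subnKC (iN : (i <= n.+1)%N)) natrD addKn; ring.
have -> : T2 = b * conv f (rf (b + 1)) n.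
  rewrite /T2 psumS subnn mul0r mulr0 addr0 /conv big_distrr; apply: eq_big_nat => i /andP[_ iN] /=.
  by rewrite subSn// -rf_first; ring.
rewrite addrC; congr (_ + _).
rewrite /conv; under [RHS]eq_bigr do rewrite mulrBl.
rewrite sumrB.
have -> : T1 = \sum_(0 <= i < n.+1) i.+1%:R * f i.+1 * rf b (n - i)%N.
  by rewrite /T1 psumSl mul0r mul0r add0r; apply: eq_bigr => i _; rewrite subSS.
have -> : \sum_(0 <= i < n.+1) i%:R * f i * rf (b + 1) (n - i)%N = \sum_(0 <= i < n) i.+1%:R * f i.+1 * rf (b + 1) (n - i.+1)%N.
  by rewrite psumSl !mul0r add0r.
rewrite [LHS]psumS [X in _ = X - _]psumS subnn !rf0 addrAC -sumrB; congr (_ + _).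
apply: eq_big_nat => i /andP[_ iN].
by rewrite -(subnSK iN) rf_shift; ring.
Qed.

(* The coefficient of t^J in sum_m g_m t^m (1 - t)^(-(m + b)) sum_i f_i t^i. *)
Definition Sc g f b J := \sum_(0 <= m < J.+1) g m * conv f (rf (m%:R + b)) (J - m)%N.

Lemma sumsh (F : nat -> nat -> C) J : \sum_(0 <= m < J.+1) sh (F m) (J - m)%N = sh (fun K => \sum_(0 <= m < K.+1) F m (K - m)%N) J.
Proof.
case: J => [|J] /=; first by rewrite big_nat1.
rewrite psumS subnn addr0; apply: eq_big_nat => m /andP[_ mJ].
by rewrite subSn.
Qed.

Lemma sh_Sc g f b J : sh (Sc g f b) J = \sum_(0 <= m < J.+1) g m * sh (conv f (rf (m%:R + b))) (J - m)%N.
Proof.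
apply: etrans (esym (sumsh (fun m n => g m * conv f (rf (m%:R + b)) n) J)) _.
by apply: eq_bigr => m _; case: (J - m)%N => [|k] /=; rewrite ?mulr0.
Qed.

Lemma Sc_shift g f b J : Sc g f b J = Sc g f (b + 1) J - sh (Sc g f (b + 1)) J.
Proof.
rewrite sh_Sc -sumrB; apply: eq_bigr => m _.
by rewrite conv_rf_shift addrA mulrBr.
Qed.

Lemma Sc_deriv g f b J : J%:R * Sc g f b J = Sc (fun m => m%:R * g m) f b J +
  sh (Sc (fun m => (m%:R + b) * g m) f (b + 1)) J +
  sh (Sc g (fun i => i.+1%:R * f i.+1 - i%:R * f i) (b + 1)) J.
Proof.
rewrite !sh_Sc -!big_split big_distrr; apply: eq_big_nat => m /andP[_ mJ] /=.
rewrite -[X in X%:R * _](subnKC (mJ : (m <= J)%N)) natrD mulrDl -addrA; congr (_ + _); first by ring.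
rewrite mulrCA conv_rf_deriv addrA; ring.
Qed.

Lemma Sc_linl g g' f a a' b J : Sc (fun m => a * g m + a' * g' m) f b J = a * Sc g f b J + a' * Sc g' f b J.
Proof. by rewrite /Sc !big_distrr -big_split; apply: eq_bigr => m _ /=; ring. Qed.

Lemma convDZ f f' a a' v n : conv (fun m => a * f m + a' * f' m) v n = a * conv f v n + a' * conv f' v n.
Proof. by rewrite /conv !big_distrr -big_split; apply: eq_bigr => m _ /=; ring. Qed.

Lemma Sc_linr g f f' a a' b J : Sc g (fun m => a * f m + a' * f' m) b J = a * Sc g f b J + a' * Sc g f' b J.
Proof. by rewrite /Sc !big_distrr -big_split; apply: eq_bigr => m _ /=; rewrite convDZ; ring. Qed.

Lemma Sc_extl g g' f b J : (forall m, g m = g' m) -> Sc g f b J = Sc g' f b J.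
Proof. by move=> h; apply: eq_bigr => m _; rewrite h. Qed.

Lemma Sc_extr g f f' b J : (forall m, f m = f' m) -> Sc g f b J = Sc g f' b J.
Proof. by move=> h; apply: eq_bigr => m _; rewrite /conv; under eq_bigr do rewrite h. Qed.

(** Two more powers of z / x = t / (1 - t) give a shift by t^2 and raise the exponent by 2. *)
Lemma Sc_rec g g' f b J a : g' 0%N = 0 -> g' 1%N = 0 -> (forall m, g' m.+2 = a * g m) ->
  Sc g' f b J = a * sh (sh (Sc g f (b + 2%:R))) J.
Proof.
move=> h0 h1 h; case: J => [|[|J]].
- by rewrite /Sc big_nat1 h0 mul0r mulr0.
- by rewrite /Sc psumS big_nat1 h0 h1 !mul0r mulr0 addr0.
rewrite /Sc psumSl psumSl h0 h1 !mul0r !add0r /= big_distrr; apply: eq_bigr => m _ /=.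
have -> : m.+2%:R + b = m%:R + (b + 2%:R) by rewrite -addn2 natrD; ring.
by rewrite h mulrA.
Qed.

Lemma Sc_conv2 g f b J : Sc g (conv f (rf 2%:R)) b J = Sc g f (b + 2%:R) J.
Proof.
apply: eq_bigr => m _; rewrite convA; congr (_ * _); rewrite [in LHS]/conv [in RHS]/conv.
apply: eq_bigr => i _; congr (_ * _); rewrite [LHS]rf_vdm; congr rf; ring.
Qed.

End ShiftedConvolutions.

Section FormalOperator.
Variable R : realType.
Local Notation C := R[i].
Implicit Types (a b s z t nu mu : C) (x : R) (n m J k p : nat).

Lemma hasD_x2 (f f' : R -> C) : hasD f f' ->
  hasD (fun x => x%:C ^+ 2 * f x) (fun x => x%:C ^+ 2 * (f' x + 2%:R * f x)).
Proof.
move=> h; apply: hasD_ext (hasDM (hasDM (@hasD_id R) (@hasD_id R)) h) => x _; rewrite expr2; ring.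
Qed.

Lemma itsh_lin (f f' : nat -> C) a a' p J :
  iter p (@sh R) (fun n => a * f n + a' * f' n) J = a * iter p (@sh R) f J + a' * iter p (@sh R) f' J.
Proof.
elim: p J => [|p IH] J //; case: J => [|J] /=; first by rewrite !mulr0 addr0.
exact: IH.
Qed.

Lemma itsh_ext (f f' : nat -> C) p J : (forall n, f n = f' n) -> iter p (@sh R) f J = iter p (@sh R) f' J.
Proof. by move=> h; elim: p J => [|p IH] [|J] //=. Qed.

Lemma itsh_sh (f : nat -> C) p J : iter p (@sh R) (sh f) J = iter p.+1 (@sh R) f J.
Proof. by rewrite iterSr. Qed.

Lemma sh_idx (f : nat -> C) J : J%:R * sh f J = sh (fun n => n%:R * f n) J + sh f J.
Proof. by case: J => [|J] /=; rewrite ?mul0r ?addr0// -natr1; ring. Qed.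

Lemma hasD_itsh (f f' : nat -> R -> C) p J : (forall n, hasD (f n) (f' n)) ->
  hasD (fun x => iter p (@sh R) (f^~ x) J) (fun x => iter p (@sh R) (f'^~ x) J).
Proof.
move=> h; elim: p J => [|p IH] J; first exact: h.
case: J => [|J]; last exact: IH.
exact: (@hasD_cst R (0 : C)).
Qed.

Lemma hasD_Sc (g g' phi : nat -> R -> C) b J : (forall m, hasD (g m) (g' m)) -> tow phi ->
  hasD (fun x => Sc (g^~ x) (phi^~ x) b J) (fun x => Sc (g'^~ x) (phi^~ x) b J + Sc (g^~ x) ((thv phi)^~ x) b J).
Proof.
move=> hg hp.
have hc n b' : hasD (fun x => conv (phi^~ x) (rf b') n) (fun x => conv ((thv phi)^~ x) (rf b') n).
  have h := hasD_sum (index_iota 0 n.+1) (fun i => hasDM (hp i) (@hasD_cst R (rf b' (n - i)%N))).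
  apply: hasD_ext h => // x _; apply: eq_bigr => i _; by rewrite mulr0 addr0.
have h := hasD_sum (index_iota 0 J.+1) (fun m => hasDM (hg m) (hc (J - m)%N (m%:R + b))).
apply: hasD_ext h => // x _; by rewrite /Sc -big_split.
Qed.

(* Dop u = lam u, split through A = theta (theta + mu) u - x^2 u. *)
Definition solv mu nu lam (u : R -> C) := exists u1 u2 A1 A2 : R -> C,
  [/\ hasD u u1, hasD u1 u2, hasD (fun x => u2 x + mu * u1 x - x%:C ^+ 2 * u x) A1, hasD A1 A2 &
   forall x, 0 < x -> A2 x + (mu + 2%:R * nu) * A1 x + nu * (mu + nu) * (u2 x + mu * u1 x - x%:C ^+ 2 * u x) -
     x%:C ^+ 2 * (u2 x + mu * u1 x - x%:C ^+ 2 * u x) =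
     x%:C ^+ 2 * ((lam + (mu - nu) * (mu + nu + 2%:R) / 2%:R) * u x)].

(* Lettered variables stand for the sums X, Y, Z, W defined below, X being the
   candidate for Lambda; the first digit is the shift of the exponent of
   (1 - t)^(-1), the second one the shift of the index. *)
Lemma operator_identity mu nu j q (X00 X11 X20 X21 X22 X41 X42 X43 W00 W20 W21 W22 Z00 Z11 Z20 Z21 Z22 Y10 Y20 Y21 : C)
    (s0 := (mu + nu + 2%:R) / 2%:R) (DW := (q * Z22 - mu * W00) + (q * Y20 - nu * W00)) :
  j * X00 = Y10 + (s0 * X11 + Z11) ->
  j * X11 = X11 + (Y21 + ((s0 + 1) * X22 + Z22)) ->
  j * Y10 = (q * X42 - mu * Y20) + ((s0 + 1) * Y21 + W21) ->
  j * Z11 = Z11 + (W21 + ((s0 + 1) * Z22 + (q * X42 - nu * Z22))) ->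
  X00 = X20 - 2%:R * X21 + X22 -> X11 = X21 - X22 ->
  X21 = X41 - 2%:R * X42 + X43 ->
  W00 = W20 - 2%:R * W21 + W22 -> Z00 = Z20 - 2%:R * Z21 + Z22 -> Y10 = Y20 - Y21 -> Z11 = Z21 - Z22 ->
  2%:R * (q * (W22 + (q * X42 - nu * Z22) + 2%:R * Z22) - mu * DW + (q * (q * X42 - mu * Y20 + W20 + 2%:R * Y20) - nu * DW)) +
  (mu - nu) * (DW + (q * (Y20 + Z20 + 2%:R * X20) - nu * (W00 + (q * X20 - nu * Z00)))) +
  2%:R * (q * (q * X43 - mu * Y21 + W21 + (W21 + (q * X41 - nu * Z21)) + 2%:R * (Y21 + Z21) + 2%:R * (Y21 + Z21 + 2%:R * X21))) +
  (mu + 2%:R * nu) * (2%:R * (q * Z22 - mu * W00 + (q * Y20 - nu * W00)) + (mu - nu) * (W00 + (q * X20 - nu * Z00)) +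
     2%:R * (q * (Y21 + Z21 + 2%:R * X21))) +
  nu * (mu + nu) * (2%:R * W00 + (mu - nu) * Z00 + 2%:R * (q * X21)) - q * (2%:R * W00 + (mu - nu) * Z00 + 2%:R * (q * X21)) =
  q * (((2%:R * j + mu + 1) ^+ 2 - (mu + 1) ^+ 2 / 2%:R - (nu + 1) ^+ 2 / 2%:R + (mu - nu) * (mu + nu + 2%:R) / 2%:R) * X00).
Proof.
have emu : mu = 2%:R * s0 - nu - 2%:R by rewrite /s0; field.
rewrite -/s0; move: s0 emu => s emu jX0 jX1 jY1 jZ1 E1 E2 E4 E6 E7 E8 E9.
(* The constant term of the operator turns lambda_j into (2 j + mu + 1)^2 - (nu + 1)^2, so j enters
   only through j X00 and j (j X00), which the index relations eliminate. *)
have -> : q * (((2%:R * j + mu + 1) ^+ 2 - (mu + 1) ^+ 2 / 2%:R - (nu + 1) ^+ 2 / 2%:R + (mu - nu) * (mu + nu + 2%:R) / 2%:R) * X00) =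
   q * (4%:R * (j * (j * X00)) + 4%:R * (mu + 1) * (j * X00) + ((mu + 1) ^+ 2 - (nu + 1) ^+ 2) * X00) by field.
have -> : j * (j * X00) = j * Y10 + (s * (j * X11) + j * Z11) by rewrite jX0; ring.
rewrite jX0 jX1 jY1 jZ1 /DW E1 E2 E6 E7 E8 E9.
have E4' : X41 = X21 + 2%:R * X42 - X43 by rewrite E4; ring.
(* A common normal form, divisible by q = x^2. Replacing mu by 2 s - nu - 2 makes the second
   comparison polynomial. *)
transitivity (q * (8%:R * W21 + 8%:R * (q * X42) + 4%:R * Z22 + 4%:R * Y20 + (mu - nu) * (mu + nu + 2%:R) * X20 +
  2%:R * ((4%:R + 2%:R * nu) * Y21 + (4%:R + 2%:R * mu) * Z21 + (mu + nu + 2%:R) * (2%:R + nu) * X21))).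
  rewrite E4'; ring.
congr (q * _); rewrite emu; ring.
Qed.

Lemma level_twice (a b c d e f : C) : a = b - c -> b = d - e -> c = e - f -> a = d - 2%:R * e + f.
Proof. by move=> -> -> ->; ring. Qed.

Lemma Aop_combination (mu nu q Y W Z a b c d e f : C) : a = b - c -> b = d - e -> c = e - f ->
  (q * f - mu * Y + W + (W + (q * d - nu * Z))) + mu * (Y + Z) - q * a =
  2%:R * W + (mu - nu) * Z + 2%:R * (q * e).
Proof. by move=> -> -> ->; ring. Qed.

Section OperatorIdentity.
(** [g m x] stands for h_m x^(m - ka), from a Frobenius series of the first factor whose power
    t^(-ka) is split off. The hypotheses [g0], [g1] and [g2] are the Bessel equation of that factor,
    with indicial roots 0 and -mu; the uses are ka = 0 and ka = mu. *)
Variables (mu nu ka : C) (g phi : nat -> R -> C).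
Hypothesis hg : forall m, hasD (g m) (fun x => (m%:R - ka) * g m x).
Hypothesis g0 : forall x, 0 < x -> (- ka) * (- ka + mu) * g 0%N x = 0.
Hypothesis g1 : forall x, 0 < x -> (1 - ka) * (1 - ka + mu) * g 1%N x = 0.
Hypothesis g2 : forall m x, 0 < x -> (m.+2%:R - ka) * (m.+2%:R - ka + mu) * g m.+2 x = x%:C ^+ 2 * g m x.
Hypothesis tphi : tow phi.
Hypothesis ode : forall n x, 0 < x -> thv (thv phi) n x + nu * thv phi n x = x%:C ^+ 2 * conv (phi^~ x) (rf 2%:R) n.

Let s0 : C := (mu + nu + 2%:R) / 2%:R.
Let be k : C := s0 - ka + k%:R.
Let eg m x : C := (m%:R - ka) * g m x.
(* Sums with neither, the first, the second, or both factors differentiated. *)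
Definition SX k J x := Sc (g^~ x) (phi^~ x) (be k) J.
Definition SY k J x := Sc (eg^~ x) (phi^~ x) (be k) J.
Definition SZ k J x := Sc (g^~ x) ((thv phi)^~ x) (be k) J.
Definition SW k J x := Sc (eg^~ x) ((thv phi)^~ x) (be k) J.
Let T p (f : nat -> R -> C) J x := iter p (@sh R) (f^~ x) J.

Let be1 k : be k + 1 = be k.+1.
Proof. by rewrite /be -natr1 addrA. Qed.
Let be2 k : be k + 2%:R = be k.+2.
Proof. rewrite -!be1; ring. Qed.

Let T_lin2 p (f : nat -> C) (f1 f2 : nat -> R -> C) a1 a2 J x : (forall n, f n = a1 * f1 n x + a2 * f2 n x) ->
  iter p (@sh R) f J = a1 * T p f1 J x + a2 * T p f2 J x.
Proof. by move=> h; rewrite (itsh_ext _ _ h) itsh_lin. Qed.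

Let heg m : hasD (eg m) (fun x => (m%:R - ka) * eg m x).
Proof. exact: (hasDZ (m%:R - ka) (@hg m)). Qed.

Let sc_eeg (psi : nat -> C) b J x : 0 < x ->
  Sc (fun m => (m%:R - ka) * eg m x) psi b J = x%:C ^+ 2 * sh (sh (Sc (g^~ x) psi (b + 2%:R))) J - mu * Sc (eg^~ x) psi b J.
Proof.
move=> x0; have h := @Sc_rec R (g^~ x) (fun m => (m%:R - ka) * (m%:R - ka + mu) * g m x) psi b J (x%:C ^+ 2).
rewrite -h; first last.
- by move=> m; rewrite g2.
- by rewrite g1.
- by have := g0 x0; rewrite sub0r.
rewrite -[X in X - _]mul1r -mulNr -Sc_linl; apply: Sc_extl => m; rewrite /eg; ring.
Qed.

Let sc_tt (h : nat -> C) b J x : 0 < x ->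
  Sc h ((thv (thv phi))^~ x) b J = x%:C ^+ 2 * Sc h (phi^~ x) (b + 2%:R) J - nu * Sc h ((thv phi)^~ x) b J.
Proof.
move=> x0; rewrite -Sc_conv2 -mulNr -Sc_linr; apply: Sc_extr => n.
by rewrite -ode//; ring.
Qed.

Let dX k p J : hasD (T p (SX k) J) (fun x => T p (SY k) J x + T p (SZ k) J x).
Proof.
have h n := hasD_Sc (b := be k) (J := n) hg tphi.
apply: hasD_ext (@hasD_itsh _ _ p J h) => // x _.
by rewrite (@T_lin2 p _ (SY k) (SZ k) 1 1 J x) ?mul1r// => n; rewrite !mul1r.
Qed.

Let dY k p J : hasD (T p (SY k) J) (fun x => x%:C ^+ 2 * T p.+2 (SX k.+2) J x - mu * T p (SY k) J x + T p (SW k) J x).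
Proof.
have h n := hasD_Sc (b := be k) (J := n) heg tphi.
apply: hasD_ext (@hasD_itsh _ _ p J h) => // x x0.
rewrite (@T_lin2 p _ (fun n x => x%:C ^+ 2 * sh (sh ((SX k.+2)^~ x)) n - mu * SY k n x) (SW k) 1 1 J x); last first.
  by move=> n; rewrite sc_eeg// !mul1r be2.
rewrite !mul1r; congr (_ + _).
rewrite [LHS](@T_lin2 p _ (fun n x => sh (sh ((SX k.+2)^~ x)) n) (SY k) (x%:C ^+ 2) (- mu) J x); last by move=> n; rewrite mulNr.
by rewrite mulNr /T !itsh_sh.
Qed.

Let dZ k p J : hasD (T p (SZ k) J) (fun x => T p (SW k) J x + (x%:C ^+ 2 * T p (SX k.+2) J x - nu * T p (SZ k) J x)).
Proof.
have h n := hasD_Sc (b := be k) (J := n) hg (tow_thv tphi).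
apply: hasD_ext (@hasD_itsh _ _ p J h) => // x x0.
rewrite (@T_lin2 p _ (SW k) (fun n x => x%:C ^+ 2 * SX k.+2 n x - nu * SZ k n x) 1 1 J x); last first.
  by move=> n; rewrite sc_tt// !mul1r be2.
rewrite !mul1r; congr (_ + _).
by rewrite [LHS](@T_lin2 p _ (SX k.+2) (SZ k) (x%:C ^+ 2) (- nu) J x) ?mulNr// => n; rewrite mulNr.
Qed.

Let dW k p J : hasD (T p (SW k) J) (fun x => (x%:C ^+ 2 * T p.+2 (SZ k.+2) J x - mu * T p (SW k) J x) +
  (x%:C ^+ 2 * T p (SY k.+2) J x - nu * T p (SW k) J x)).
Proof.
have h n := hasD_Sc (b := be k) (J := n) heg (tow_thv tphi).
apply: hasD_ext (@hasD_itsh _ _ p J h) => // x x0.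
rewrite (@T_lin2 p _ (fun n x => x%:C ^+ 2 * sh (sh ((SZ k.+2)^~ x)) n - mu * SW k n x) (fun n x => x%:C ^+ 2 * SY k.+2 n x - nu * SW k n x) 1 1 J x); last first.
  by move=> n; rewrite sc_eeg// sc_tt// !mul1r be2.
rewrite !mul1r; congr (_ + _); last first.
  by rewrite [LHS](@T_lin2 p _ (SY k.+2) (SW k) (x%:C ^+ 2) (- nu) J x) ?mulNr// => n; rewrite mulNr.
rewrite [LHS](@T_lin2 p _ (fun n x => sh (sh ((SZ k.+2)^~ x)) n) (SW k) (x%:C ^+ 2) (- mu) J x); last by move=> n; rewrite mulNr.
by rewrite mulNr /T !itsh_sh.
Qed.

Let lvl p (f f' : nat -> R -> C) J x : (forall n, f n x = f' n x - sh (f'^~ x) n) -> T p f J x = T p f' J x - T p.+1 f' J x.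
Proof.
move=> h; rewrite [LHS](@T_lin2 p _ f' (fun n x => sh (f'^~ x) n) 1 (-1) J x); first by rewrite mul1r mulN1r /T itsh_sh.
by move=> n; rewrite h mul1r mulN1r.
Qed.

Let lX k p J x : T p (SX k) J x = T p (SX k.+1) J x - T p.+1 (SX k.+1) J x.
Proof. by apply: lvl => n; rewrite /SX Sc_shift be1. Qed.
Let lY k p J x : T p (SY k) J x = T p (SY k.+1) J x - T p.+1 (SY k.+1) J x.
Proof. by apply: lvl => n; rewrite /SY Sc_shift be1. Qed.
Let lZ k p J x : T p (SZ k) J x = T p (SZ k.+1) J x - T p.+1 (SZ k.+1) J x.
Proof. by apply: lvl => n; rewrite /SZ Sc_shift be1. Qed.
Let lW k p J x : T p (SW k) J x = T p (SW k.+1) J x - T p.+1 (SW k.+1) J x.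
Proof. by apply: lvl => n; rewrite /SW Sc_shift be1. Qed.

(** Multiplication by the index J - ka is t d/dt on t^(m - ka) (1 - t)^(-(m + be k)). Since (m -
    ka)(1 - t) + (m + be k) t = (m - ka) + (s0 + k) t, the coefficient s0 + k depends on neither m
    nor ka. *)
Let idx k (h eh : nat -> C) (f : nat -> R -> C) J x : (forall m, eh m = (m%:R - ka) * h m) ->
  (J%:R - ka) * Sc h (f^~ x) (be k) J = Sc eh (f^~ x) (be k.+1) J +
  sh (fun n => (s0 + k%:R) * Sc h (f^~ x) (be k.+1) n + Sc h ((thv f)^~ x) (be k.+1) n) J.
Proof.
move=> heh; rewrite mulrBl Sc_deriv be1.
have e1 : Sc (fun m => m%:R * h m) (f^~ x) (be k) J = 1 * Sc eh (f^~ x) (be k) J + ka * Sc h (f^~ x) (be k) J.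
  by rewrite -Sc_linl; apply: Sc_extl => m; rewrite heh; ring.
have e2 n : Sc (fun m => (m%:R + be k) * h m) (f^~ x) (be k.+1) n = 1 * Sc eh (f^~ x) (be k.+1) n + (s0 + k%:R) * Sc h (f^~ x) (be k.+1) n.
  by rewrite -Sc_linl; apply: Sc_extl => m; rewrite heh /be; ring.
have e3 := Sc_shift eh (f^~ x) (be k) J; rewrite be1 in e3.
rewrite e1 e3; case: J {e1 e3} => [|J] /=; first by rewrite !addr0 subr0 mul1r addrK.
by rewrite e2; rewrite -/(thv f _ x); have -> : Sc h (fun i => i.+1%:R * f i.+1 x - i%:R * f i x) (be k.+1) J = Sc h ((thv f)^~ x) (be k.+1) J by []; ring.
Qed.

Let jX k J x : (J%:R - ka) * T 0 (SX k) J x = T 0 (SY k.+1) J x + ((s0 + k%:R) * T 1 (SX k.+1) J x + T 1 (SZ k.+1) J x).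
Proof.
have -> := @idx k (g^~ x) (eg^~ x) phi J x (fun=> erefl).
by congr (_ + _); case: J => [|J] //=; rewrite mulr0 addr0.
Qed.

Let jY k J x : 0 < x -> (J%:R - ka) * T 0 (SY k) J x = (x%:C ^+ 2 * T 2 (SX k.+3) J x - mu * T 0 (SY k.+1) J x) +
   ((s0 + k%:R) * T 1 (SY k.+1) J x + T 1 (SW k.+1) J x).
Proof.
move=> x0; have -> := @idx k (eg^~ x) (fun m => (m%:R - ka) * eg m x) phi J x (fun=> erefl).
by rewrite sc_eeg// be2; congr (_ + _); case: J => [|J] //=; rewrite mulr0 addr0.
Qed.

Let jZ k J x : 0 < x -> (J%:R - ka) * T 0 (SZ k) J x = T 0 (SW k.+1) J x +
   ((s0 + k%:R) * T 1 (SZ k.+1) J x + (x%:C ^+ 2 * T 1 (SX k.+3) J x - nu * T 1 (SZ k.+1) J x)).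
Proof.
move=> x0; have -> := @idx k (g^~ x) (eg^~ x) (thv phi) J x (fun=> erefl).
congr (_ + _); case: J => [|J] /=; first by rewrite !mulr0 subr0 !addr0.
by rewrite (@sc_tt (g^~ x) (be k.+1) J x x0) be2.
Qed.

Let jS (f : nat -> R -> C) J x : (J%:R - ka) * T 1 f J x = T 1 (fun n y => (n%:R - ka) * f n y) J x + T 1 f J x.
Proof. by rewrite /T /= mulrBl sh_idx; case: J => [|J] /=; [rewrite mulr0 subr0|ring]. Qed.

(** At exponent level 2 the two Bessel equations contribute x^2 t^2 and x^2, while the subtracted
    x^2 becomes x^2 (1 - t)^2; only 2 x^2 t survives. *)
Lemma SX_Aop J x : 0 < x ->
  (x%:C ^+ 2 * T 2 (SX 2) J x - mu * SY 0 J x + SW 0 J x + (SW 0 J x + (x%:C ^+ 2 * SX 2 J x - nu * SZ 0 J x)))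
   + mu * (SY 0 J x + SZ 0 J x) - x%:C ^+ 2 * SX 0 J x =
  2%:R * SW 0 J x + (mu - nu) * SZ 0 J x + 2%:R * (x%:C ^+ 2 * T 1 (SX 2) J x).
Proof.
by move=> x0; exact: (Aop_combination _ _ _ _ _ _ (lX 0%N 0%N J x) (lX 1%N 0%N J x) (lX 1%N 1%N J x)).
Qed.

Theorem SX_solv J : solv mu nu ((2%:R * (J%:R - ka) + mu + 1) ^+ 2 - (mu + 1) ^+ 2 / 2%:R - (nu + 1) ^+ 2 / 2%:R) (SX 0 J).
Proof.
have d1 := @dX 0%N 0%N J; have d2 := hasDD (@dY 0%N 0%N J) (@dZ 0%N 0%N J).
exists (fun x => SY 0 J x + SZ 0 J x).
eexists.
(* The theta-derivative of the three-term form of A found in [SX_Aop], which is much shorter than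
   that of A as defined. *)
exists (fun x => 2%:R * (x%:C ^+ 2 * T 2 (SZ 2) J x - mu * T 0 (SW 0) J x + (x%:C ^+ 2 * T 0 (SY 2) J x - nu * T 0 (SW 0) J x)) +
   (mu - nu) * (T 0 (SW 0) J x + (x%:C ^+ 2 * T 0 (SX 2) J x - nu * T 0 (SZ 0) J x)) +
   2%:R * (x%:C ^+ 2 * (T 1 (SY 2) J x + T 1 (SZ 2) J x + 2%:R * T 1 (SX 2) J x))).
eexists; split; [exact: d1|exact: d2| | |].
- apply: hasD_ext (hasDD (hasDD (hasDZ 2%:R (@dW 0%N 0%N J)) (hasDZ (mu - nu) (@dZ 0%N 0%N J))) (hasDZ 2%:R (hasD_x2 (@dX 2%N 1%N J)))) => // x x0.
  by rewrite [RHS]SX_Aop.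
- have e1 := hasDZ 2%:R (hasDD (hasDB (hasD_x2 (@dZ 2%N 2%N J)) (hasDZ mu (@dW 0%N 0%N J))) (hasDB (hasD_x2 (@dY 2%N 0%N J)) (hasDZ nu (@dW 0%N 0%N J)))).
  have e2 := hasDZ (mu - nu) (hasDD (@dW 0%N 0%N J) (hasDB (hasD_x2 (@dX 2%N 0%N J)) (hasDZ nu (@dZ 0%N 0%N J)))).
  have e3 := hasDZ 2%:R (hasD_x2 (hasDD (hasDD (@dY 2%N 1%N J) (@dZ 2%N 1%N J)) (hasDZ 2%:R (@dX 2%N 1%N J)))).
  exact: (hasDD (hasDD e1 e2) e3).
move=> x x0; rewrite SX_Aop//.
set j := J%:R - ka.
have jX0 : j * T 0 (SX 0) J x = T 0 (SY 1) J x + (s0 * T 1 (SX 1) J x + T 1 (SZ 1) J x).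
  by rewrite jX addr0.
have jX1 : j * T 1 (SX 1) J x = T 1 (SX 1) J x + (T 1 (SY 2) J x + ((s0 + 1) * T 2 (SX 2) J x + T 2 (SZ 2) J x)).
  rewrite jS addrC; congr (_ + _); case: J @j jX0 {d1 d2} => [|J] j _; last exact: jX.
  by rewrite /T /= mulr0 !addr0.
have jZ1 : j * T 1 (SZ 1) J x = T 1 (SZ 1) J x + (T 1 (SW 2) J x + ((s0 + 1) * T 2 (SZ 2) J x + (x%:C ^+ 2 * T 2 (SX 4) J x - nu * T 2 (SZ 2) J x))).
  rewrite jS addrC; congr (_ + _); case: J @j jX0 jX1 {d1 d2} => [|J] j _ _; last exact: jZ.
  by rewrite /T /= !mulr0 subr0 !addr0.
have jY1 := @jY 1%N J x x0; rewrite -/j in jY1.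
rewrite -[SX 0 J x]/(T 0 (SX 0) J x) -[SW 0 J x]/(T 0 (SW 0) J x) -[SZ 0 J x]/(T 0 (SZ 0) J x).
have q1 k := lX k 0 J x; have q2 k := lX k 1 J x; have q3 k := lX k 2 J x.
have E1 : T 0 (SX 0) J x = T 0 (SX 2) J x - 2%:R * T 1 (SX 2) J x + T 2 (SX 2) J x.
  exact: level_twice (q1 0%N) (q1 1%N) (q2 1%N).
have E4 : T 1 (SX 2) J x = T 1 (SX 4) J x - 2%:R * T 2 (SX 4) J x + T 3 (SX 4) J x.
  exact: level_twice (q2 2%N) (q2 3%N) (q3 3%N).
have E6 : T 0 (SW 0) J x = T 0 (SW 2) J x - 2%:R * T 1 (SW 2) J x + T 2 (SW 2) J x.
  exact: level_twice (lW 0%N 0%N J x) (lW 1%N 0%N J x) (lW 1%N 1%N J x).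
have E7 : T 0 (SZ 0) J x = T 0 (SZ 2) J x - 2%:R * T 1 (SZ 2) J x + T 2 (SZ 2) J x.
  exact: level_twice (lZ 0%N 0%N J x) (lZ 1%N 0%N J x) (lZ 1%N 1%N J x).
exact: (operator_identity jX0 jX1 jY1 jZ1 E1 (q2 1%N) E4 E6 E7 (lY 1%N 0%N J x) (lZ 1%N 1%N J x)).
Qed.
End OperatorIdentity.
End FormalOperator.

(** * Laurent coefficients *)

Section LaurentUniqueness.
Variable R : realType.
Local Notation C := R[i].
Implicit Types (a b s z w t : C) (x : R) (u v f g : nat -> C) (n N J k : nat) (m j : int).

Definition root_arg N : C := (2 * pi / N%:R)%:C * 'i%C.
(* The average of w^m over the N-th roots of unity w. *)
Definition avg N m : C := N%:R^-1 * \sum_(0 <= k < N) cexp (k%:R * m%:~R * root_arg N).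

Lemma Re_iy N (y : R) : complex.Re (y%:C * root_arg N) = 0.
Proof. by rewrite /root_arg /=; ring. Qed.

Lemma cabs_iy N (y : R) : cabs (cexp (y%:C * root_arg N)) = 1.
Proof. by rewrite cabs_cexp Re_iy expR0. Qed.

Lemma kmC k m : k%:R * m%:~R = (k%:R * m%:~R : R)%:C :> C.
Proof. by rewrite rmorphM /= rmorph_nat rmorph_int. Qed.

Lemma avg_le N m : (0 < N)%N -> cabs (avg N m) <= 1.
Proof.
move=> N0; rewrite /avg cabsM cabsV cabs_nat.
have p : 0 < N%:R :> R by rewrite ltr0n.
rewrite mulrC ler_pdivrMr// mul1r (le_trans (cabs_sum _ _ _))//.
under eq_bigr do rewrite kmC cabs_iy.
by rewrite sumr_const_nat subn0.
Qed.

Lemma avg0 N : (0 < N)%N -> avg N 0 = 1.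
Proof.
move=> N0; rewrite /avg; under eq_bigr do rewrite mulr0 mul0r cexp0.
by rewrite sumr_const_nat subn0 mulVf// pnatr_eq0 -lt0n.
Qed.

Lemma cexp_i (y : R) : cexp (y%:C * 'i%C) = cos y +i* sin y :> C.
Proof.
have -> : y%:C * 'i%C = 0 +i* y :> C by apply: eqC => /=; ring.
by rewrite /cexp /= expR0 mul1r.
Qed.

Lemma cexp_2pi m : cexp ((2 * pi * m%:~R)%:C * 'i%C : C) = 1.
Proof.
have e1 : cexp ((2 * pi)%:C * 'i%C : C) = 1.
  by rewrite cexp_i -[2 * pi]add0r [2 * pi]mulr_natl cosD2pi sinD2pi cos0 sin0.
have hn n : cexp ((2 * pi * n%:R)%:C * 'i%C : C) = 1.
  have -> : (2 * pi * n%:R)%:C * 'i%C = n%:R * ((2 * pi)%:C * 'i%C) :> C.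
    by rewrite rmorphM /= rmorph_nat; ring.
  by rewrite cexpMn e1 expr1n.
case: m => n; first by rewrite -pmulrn hn.
rewrite NegzE mulrNz mulrN rmorphN mulNr cexpN -pmulrn hn invr1//.
Qed.

Lemma avg_gt N m : m != 0 -> (`|m| < N)%N -> avg N m = 0.
Proof.
move=> m0 mN; have N0 : (0 < N)%N by exact: leq_ltn_trans mN.
have p : N%:R != 0 :> R by rewrite pnatr_eq0 -lt0n.
set w := cexp (m%:~R * root_arg N).
have wN : w ^+ N = 1.
  apply: etrans (cexp_2pi m); rewrite -cexpMn; congr cexp; rewrite /root_arg mulrA kmC mulrA -rmorphM; congr (_%:C * _).
  by field.
have w1 : w - 1 != 0.
  rewrite subr_eq0; apply/eqP => e.
  wlog m1 : m m0 mN @w wN e / 0 < m.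
    move=> h; have [|m1] := ltP 0 m; first exact: h m0 mN wN e.
    have mneg : 0 < - m by rewrite oppr_gt0 lt_neqAle m0.
    apply: (h (- m)); rewrite ?oppr_eq0 ?abszN//; rewrite mulrNz mulNr cexpN -/w e invr1 ?expr1n//.
  case: m m1 m0 mN @w wN e => // n n0 _ nN w wN e.
  (* Half of the angle of w: if w = 1 then exp (i y) is 1 or -1, whereas sin y > 0 because 0 < y <
     pi. *)
  pose y : R := pi * (n%:R / N%:R).
  have wE : w = cexp (y%:C * 'i%C) ^+ 2.
    rewrite -cexpMn /w -pmulrn /root_arg; congr cexp; rewrite !mulrA; congr (_ * _).
    rewrite -!(rmorph_nat (real_complex R)) -!rmorphM; congr (_%:C).
    by rewrite /y; field.
  have : complex.Im (cexp (y%:C * 'i%C)) = 0.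
    have : (cexp (y%:C * 'i%C) - 1) * (cexp (y%:C * 'i%C) + 1) = 0.
      have : cexp (y%:C * 'i%C) ^+ 2 = 1 by rewrite -wE.
      move: (cexp _) => q hq; transitivity (q ^+ 2 - 1); first by ring.
      by rewrite hq subrr.
    move=> /eqP; rewrite mulf_eq0 subr_eq0 addr_eq0 => /orP[] /eqP -> //=.
    by rewrite oppr0.
  rewrite cexp_i /=.
  apply/eqP; rewrite gt_eqF// sin_gt0_pi//; rewrite /y.
  rewrite mulr_gt0 ?pi_gt0 ?divr_gt0 ?ltr0n//=.
  by rewrite gtr_pMr ?pi_gt0// ltr_pdivrMr ?ltr0n// mul1r ltr_nat.
rewrite /avg; under eq_bigr do rewrite -mulrA cexpMn -/w.
suff -> : \sum_(0 <= k < N) w ^+ k = 0 by rewrite mulr0.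
apply: (mulfI w1); rewrite mulr0 big_mkord -subrX1 wN subrr//.
Qed.

Lemma hassum_sum (I : Type) (l : seq I) (F : I -> nat -> C) (L : I -> C) :
  (forall i, hassum (F i) (L i)) -> hassum (fun n => \sum_(i <- l) F i n) (\sum_(i <- l) L i).
Proof.
move=> h.
have h1 : (fun N => \sum_(i <- l) \sum_(0 <= n < N) F i n) @ \oo --> \sum_(i <- l) L i.
  exact: (@cvgC_sum _ _ \oo _ _ l (fun i N => \sum_(0 <= n < N) F i n) L h).
apply: cvg_trans h1; apply: near_eq_cvg; near=> N; by rewrite exchange_big.
Unshelve. all: by end_near. Qed.

Lemma avg_cvg u A (e : nat -> int) j : absbnd u A ->
  (fun N => csum (fun n => u n * avg N.+1 (e n - j))) @ \oo --> csum (fun n => u n * (e n == j)%:R).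
Proof.
move=> uA; have [] := @tannery R nat \oo _ (fun N n => u n * avg N.+1 (e n - j)) (fun n => u n * (e n == j)%:R) (fun n => cabs (u n)) A uA; last by [].
- near=> N => n; rewrite cabsM ler_piMr ?cabs_ge0//; exact: avg_le.
- move=> n; have hc : (fun _ : nat => u n * (e n == j)%:R) @ \oo --> (u n * (e n == j)%:R) by exact: cvgC_cst.
  apply: cvg_trans hc; apply: near_eq_cvg; near=> N; congr (_ * _).
  have [->|ne] := eqVneq (e n) j; first by rewrite subrr avg0.
  rewrite avg_gt ?subr_eq0//.
  near: N; exists `|e n - j|%N => // N /= hN; by rewrite ltnS.
Unshelve. all: by end_near. Qed.

Lemma avg_csum u A (e : nat -> int) j N : absbnd u A ->
  csum (fun n => u n * avg N (e n - j)) =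
  N%:R^-1 * \sum_(0 <= k < N) cexp (- (k%:R * j%:~R * root_arg N)) * csum (fun n => u n * cexp (k%:R * (e n)%:~R * root_arg N)).
Proof.
move=> uA; apply: hassum_csum.
have h k : hassum (fun n => cexp (- (k%:R * j%:~R * root_arg N)) * (u n * cexp (k%:R * (e n)%:~R * root_arg N)))
   (cexp (- (k%:R * j%:~R * root_arg N)) * csum (fun n => u n * cexp (k%:R * (e n)%:~R * root_arg N))).
  apply: hassumZ; apply: (@absbnd_hassum _ _ A) => K; apply: le_trans (uA K).
  by apply: ler_sum => n _; rewrite cabsM kmC cabs_iy mulr1.
have h1 := hassumZ (c := N%:R^-1) (@hassum_sum _ (index_iota 0 N) _ _ h).
apply: cvg_trans h1; apply: near_eq_cvg; near=> K; apply: eq_bigr => n _.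
rewrite /avg [RHS]mulrCA; congr (_ * _); rewrite big_distrr /=.
apply: eq_bigr => k _; rewrite mulrCA -cexpD intrB; congr (_ * cexp _); ring.
Unshelve. all: by end_near. Qed.

(** Averaging w^(-j) times the double series over the roots of unity of order N + 1 keeps the
    exponents congruent to j; as N grows only j itself remains. The condition [v 0%N = 0] prevents
    the exponent 0 from being counted twice. *)
Lemma laurent_zero u v A B : absbnd u A -> absbnd v B -> v 0%N = 0 ->
  (forall w, cabs w = 1 -> csum (fun n => u n * w ^+ n) + csum (fun n => v n * w ^- n) = 0) ->
  forall n, u n = 0 /\ v n = 0.
Proof.
move=> uA vB v0 h.
have key j : csum (fun n => u n * (n%:Z == j)%:R) + csum (fun n => v n * (- n%:Z == j)%:R) = 0.
  have h1 := @avg_cvg u A (fun n => n%:Z) j uA; have h2 := @avg_cvg v B (fun n => - n%:Z) j vB.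
  have h3 : (fun N => csum (fun n => u n * avg N.+1 (n%:Z - j)) + csum (fun n => v n * avg N.+1 (- n%:Z - j))) @ \oo -->
      csum (fun n => u n * (n%:Z == j)%:R) + csum (fun n => v n * (- n%:Z == j)%:R) by exact: (cvgCD h1 h2).
  apply: (cvgC_unique h3); have hc : (fun _ : nat => 0 : C) @ \oo --> (0 : C) by exact: cvgC_cst.
  apply: cvg_trans hc; apply: near_eq_cvg; near=> N.
  rewrite (@avg_csum u A (fun n => n%:Z) j N.+1 uA) (@avg_csum v B (fun n => - n%:Z) j N.+1 vB).
  rewrite -mulrDr -big_split /= big1_seq ?mulr0// => k _.
  rewrite -mulrDr; set w := cexp (k%:R * root_arg N.+1).
  have w1 : cabs w = 1 by rewrite /w -(rmorph_nat (real_complex R)) cabs_iy.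
  have -> : (fun n => u n * cexp (k%:R * (n%:Z)%:~R * root_arg N.+1)) = fun n => u n * w ^+ n.
    by apply/funext => n; rewrite /w -cexpMn -pmulrn; congr (_ * cexp _); ring.
  have -> : (fun n => v n * cexp (k%:R * (- n%:Z)%:~R * root_arg N.+1)) = fun n => v n * w ^- n.
    apply/funext => n; rewrite /w -cexpMn -cexpN mulrNz -pmulrn; congr (_ * cexp _); ring.
  by rewrite h// mulr0.
have single (q : nat -> C) (e : nat -> int) n : injective e -> csum (fun k => q k * (e k == e n)%:R) = q n.
  move=> ie; rewrite (@csum_fin _ _ n.+1); last first.
    by move=> k kn; rewrite (inj_eq ie) gtn_eqF// mulr0.
  rewrite psumS eqxx mulr1 big1_seq ?add0r// => k; rewrite mem_index_iota => /andP[_ /andP[_ kn]].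
  by rewrite (inj_eq ie) ltn_eqF// mulr0.
have i1 : injective (fun n => n%:Z) by move=> p q [].
have i2 : injective (fun n => - n%:Z) by move=> p q /oppr_inj [].
have zz (q : nat -> C) (e : nat -> int) j : (forall k, q k * (e k == j)%:R = 0) -> csum (fun k => q k * (e k == j)%:R) = 0.
  by move=> hq; rewrite (@csum_fin _ _ 0%N) ?big_geq.
have hu n : u n = 0.
  have := key n%:Z; rewrite (single u (fun n => n%:Z) n i1) zz ?addr0//.
  case=> [|k]; first by rewrite v0 mul0r.
  by case: n => [|n]; rewrite mulr0.
move=> n; split; first exact: hu.
have := key (- n%:Z); rewrite (single v (fun n => - n%:Z) n i2) zz ?add0r// => k.
by rewrite hu mul0r.
Unshelve. all: by end_near. Qed.

Lemma hassum_geo u l (q : C) : hassum u l -> cabs q <= 2^-1 -> exists B, absbnd (fun n => u n * q ^+ n) B.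
Proof.
move=> h hq; have h0 := hassum_terms0 h.
have hr : (fun n => cabs (u n - 0)) @ \oo --> (0 : R) by exact/cvgC_cabs.
have cr : cvgn (fun n => cabs (u n - 0)) by apply/cvg_ex; exists 0.
have [M [_ hM]] := cvg_seq_bounded cr.
have {}hM n : cabs (u n) <= M + 1.
  have := hM (M + 1) (ltr_pwDr ltr01 (lexx M)) n I; rewrite /= subr0 ger0_norm ?cabs_ge0//.
have M0 : 0 <= M + 1 by exact: le_trans (cabs_ge0 _) (hM 0%N).
have h21 : 2^-1 < 1 :> R by rewrite invf_lt1// ltr1n.
exists ((M + 1) * (1 - 2^-1)^-1 ^+ 1) => N.
have hs := @rf_sum R 2^-1 1 N _ h21; rewrite invr_ge0 ler0n in hs.
apply: le_trans (ler_wpM2l M0 (hs isT)); rewrite big_distrr; apply: ler_sum => n _ /=.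
rewrite cabsM cabsX rf1 mul1r ler_pM ?cabs_ge0 ?exprn_ge0 ?cabs_ge0//.
by apply: lerXn2r; rewrite ?nnegrE ?cabs_ge0.
Qed.

Lemma hassum1S u l : hassum (fun n => u n.+1) l <-> (fun N => \sum_(1 <= n < N) u n) @ \oo --> l.
Proof.
have e : (fun N => \sum_(0 <= n < N) u n.+1) = (fun N => \sum_(1 <= n < N.+1) u n).
  by apply/funext => N; rewrite [RHS]big_add1.
by rewrite /hassum e -(@cvg_shiftS (R[i]^o) (fun N => \sum_(1 <= n < N) u n)).
Qed.

Lemma laurent_unique (F : C -> C) (c c' : int -> C) :
  is_laurent_expansion F c -> is_laurent_expansion F c' -> c = c'.
Proof.
move=> [r [r0 h]] [r' [r'0 h']].
pose d (n : int) := c n - c' n; pose r2 := Num.min r r' / 2.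
have m0 : 0 < Num.min r r' by rewrite lt_min r0.
have hd t : t != 0 -> cabs t < Num.min r r' -> exists a b, [/\ hassum (fun n => d n%:Z * t ^+ n) a,
    (fun N => \sum_(1 <= n < N) d (- n%:Z) * t ^- n) @ \oo --> b & a + b = 0].
  move=> t0; rewrite lt_min => /andP[t1 t2]; have [a [b [ha [hb e]]]] := h t t0 t1.
  have [a' [b' [ha' [hb' e']]]] := h' t t0 t2.
  exists (a - a'), (b - b'); split; last by move: e; rewrite e' => e; rewrite addrACA -opprD -e subrr.
  - have h3 : (fun N => \sum_(0 <= n < N) c n%:Z * t ^+ n - \sum_(0 <= n < N) c' n%:Z * t ^+ n) @ \oo --> a - a' by exact: (cvgCB ha ha').
    apply: cvg_trans h3; apply: near_eq_cvg; near=> N.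
    by rewrite -sumrB; apply: eq_bigr => n _; rewrite /d mulrBl.
  - have h3 : (fun N => \sum_(1 <= n < N) c (- n%:Z) * t ^- n - \sum_(1 <= n < N) c' (- n%:Z) * t ^- n) @ \oo --> b - b' by exact: (cvgCB hb hb').
    apply: cvg_trans h3; apply: near_eq_cvg; near=> N.
    by rewrite -sumrB; apply: eq_bigr => n _; rewrite /d mulrBl.
(* The expansions converge only conditionally by hypothesis. On the circle |t| = p the non-negative
   part is absolutely summable by convergence at 2 p, and the negative part by convergence at p /
   2. *)
pose p := r2 / 2.
have r20 : 0 < r2 by rewrite divr_gt0. have p0 : 0 < p by rewrite divr_gt0.
have p20 : 0 < p / 2 by rewrite divr_gt0.
have r2m : r2 < Num.min r r' by rewrite /r2 ltr_pdivrMr// ltr_pMr// ltr1n.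
have pr2 : p < r2 by rewrite /p ltr_pdivrMr// ltr_pMr// ltr1n.
have pp : p / 2 < p by rewrite ltr_pdivrMr// ltr_pMr// ltr1n.
have cpos (y : R) : 0 < y -> cabs y%:C = y by move=> y0; rewrite cabsR gtr0_norm.
have npos (y : R) : 0 < y -> y%:C != 0 :> C by move=> y0; rewrite -cabs_eq0 cpos// gt_eqF.
have half2 : cabs (2^-1 : C) <= 2^-1 by rewrite cabsV cabs_nat.
pose v n : C := if n is n'.+1 then d (- n%:Z) * p%:C ^- n else 0.
have [A uA] : exists A, absbnd (fun n => d n%:Z * p%:C ^+ n) A.
  have [|a [b [ha _ _]]] := hd r2%:C (npos _ r20); first by rewrite cpos.
  have [A hA] := hassum_geo ha half2; exists A.
  have -> // : (fun n => d n%:Z * p%:C ^+ n) = (fun n => d n%:Z * r2%:C ^+ n * 2^-1 ^+ n).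
  by apply/funext => n; rewrite -mulrA -exprMn /p rmorphM /= fmorphV rmorph_nat.
have [B vB] : exists B, absbnd v B.
  have [|a [b [_ hb _]]] := hd (p / 2)%:C (npos _ p20); first by rewrite cpos// (lt_trans pp)// (lt_trans pr2).
  have hb1 := (hassum1S (fun n => d (- n%:Z) * (p / 2)%:C ^- n) b).2 hb.
  have [B hB] := hassum_geo hb1 half2; exists B => -[|N]; first by have := hB 0%N; rewrite !big_geq.
  rewrite psumSl cabs0 add0r; apply: le_trans (hB N.+1); rewrite psumS.
  apply: (@le_trans _ _ (\sum_(0 <= n < N) cabs (d (- n.+1%:Z) * (p / 2)%:C ^- n.+1 * 2^-1 ^+ n))); last by rewrite lerDl cabs_ge0.
  apply: ler_sum => n _; rewrite -mulrA [leLHS]cabsM [leRHS]cabsM ler_wpM2l ?cabs_ge0//.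
  have -> : (p / 2)%:C ^- n.+1 * 2^-1 ^+ n = 2%:R * p%:C ^- n.+1.
    rewrite rmorphM /= fmorphV rmorph_nat exprMn [2^-1 ^+ n.+1]exprS.
    have : p%:C ^+ n.+1 != 0 by rewrite expf_neq0// npos.
    have : (2^-1 : C) ^+ n != 0 by rewrite expf_neq0// invr_eq0 pnatr_eq0.
    by move: (p%:C ^+ n.+1) (2^-1 ^+ n) => P Q hP hQ; field; rewrite hP hQ.
  by rewrite [leRHS]cabsM cabs_nat ler_peMl ?cabs_ge0// ler1n.
have key := laurent_zero uA vB erefl _.
have {}key n : d n%:Z * p%:C ^+ n = 0 /\ v n = 0.
  apply: key => w w1.
  have w0 : w != 0 by rewrite -cabs_eq0 w1 oner_eq0.
  have [||a [b [ha hb e]]] := hd (p%:C * w).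
  - by rewrite mulf_neq0 ?npos.
  - by rewrite cabsM w1 mulr1 cpos// (lt_trans pr2).
  have hb1 := (hassum1S (fun n => d (- n%:Z) * (p%:C * w) ^- n) b).2 hb.
  rewrite -e; congr (_ + _); apply: hassum_csum.
    by apply: cvg_trans ha; apply: near_eq_cvg; near=> N; apply: eq_bigr => k _; rewrite exprMn mulrA.
  rewrite /hassum -(@cvg_shiftS (R[i]^o)); apply: cvg_trans hb1; apply: near_eq_cvg; near=> N.
  rewrite /= psumSl mul0r add0r; apply: eq_bigr => k _.
  by rewrite exprMn invfM mulrA.
apply/funext => -[n|n]; apply/eqP; rewrite -subr_eq0.
  have [/eqP] := key n; rewrite mulf_eq0 [_ ^+ _ == 0]expf_eq0 (negbTE (npos _ p0)) andbF orbF//.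
have [_ /eqP] := key n.+1; rewrite /v mulf_eq0 invr_eq0 [_ ^+ _ == 0]expf_eq0 (negbTE (npos _ p0)) andbF orbF NegzE//.
Unshelve. all: by end_near. Qed.

Lemma laurent_coefE (F : C -> C) (c : int -> C) : is_laurent_expansion F c -> laurent_coef F = c.
Proof. by move=> h; apply: xget_unique => // c' h'; exact: laurent_unique h' h. Qed.

End LaurentUniqueness.

(** * Laurent expansion of G as a double series *)

Section LaurentExpansion.
Variable R : realType.
Local Notation C := R[i].
Implicit Types (a b z t mu nu : C) (x : R) (u v : nat -> C) (n N J k : nat) (m j : int) (F H : C -> C) (c : int -> C) (phi : nat -> R -> C).
Local Notation Re := complex.Re.

Lemma hassum_cons u (l : C) : hassum (fun n => u n.+1) l -> hassum u (u 0%N + l).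
Proof.
move=> h; rewrite /hassum -(@cvg_shiftS (R[i]^o)).
have hc : (fun _ : nat => u 0%N) @ \oo --> u 0%N by exact: cvgC_cst.
have h2 : (fun N => u 0%N + \sum_(0 <= k < N) u k.+1) @ \oo --> u 0%N + l by exact: (cvgCD hc h).
by apply: cvg_trans h2; apply: near_eq_cvg; near=> N; rewrite /= psumSl.
Unshelve. all: by end_near. Qed.

Lemma laurent_ext F H c (r : R) : 0 < r -> (forall t, t != 0 -> cabs t < r -> F t = H t) ->
  is_laurent_expansion F c -> is_laurent_expansion H c.
Proof.
move=> r0 FH [r' [r'0 h]]; exists (Num.min r r'); split; first by rewrite lt_min r0.
by move=> t t0; rewrite lt_min => /andP[t1 t2]; rewrite -FH//; exact: h.
Qed.

Lemma laurent_scl F c a : is_laurent_expansion F c -> is_laurent_expansion (fun t => a * F t) (fun m => a * c m).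
Proof.
move=> [r [r0 h]]; exists r; split; first exact: r0.
move=> t t0 tr; have [p [q [hp [hq e]]]] := h t t0 tr.
have ha : (fun _ : nat => a) @ \oo --> a by exact: cvgC_cst.
exists (a * p), (a * q); split; last split; last by rewrite e mulrDr.
  have h1 : (fun N => a * \sum_(0 <= n < N) c n%:Z * t ^+ n) @ \oo --> a * p by exact: (cvgCM ha hp).
  by apply: cvg_trans h1; apply: near_eq_cvg; near=> N; rewrite big_distrr; apply: eq_bigr => k _ /=; rewrite mulrA.
have h1 : (fun N => a * \sum_(1 <= n < N) c (- n%:Z) * t ^- n) @ \oo --> a * q by exact: (cvgCM ha hq).
by apply: cvg_trans h1; apply: near_eq_cvg; near=> N; rewrite big_distrr; apply: eq_bigr => k _ /=; rewrite mulrA.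
Unshelve. all: by end_near. Qed.

Lemma laurent_add F H c c' : is_laurent_expansion F c -> is_laurent_expansion H c' ->
  is_laurent_expansion (fun t => F t + H t) (fun m => c m + c' m).
Proof.
move=> [r [r0 h]] [r' [r'0 h']]; exists (Num.min r r'); split; first by rewrite lt_min r0.
move=> t t0; rewrite lt_min => /andP[t1 t2].
have [p [q [hp [hq e]]]] := h t t0 t1; have [p' [q' [hp' [hq' e']]]] := h' t t0 t2.
exists (p + p'), (q + q'); split; last split; last by rewrite e e' addrACA.
  have h1 : (fun N => \sum_(0 <= n < N) c n%:Z * t ^+ n + \sum_(0 <= n < N) c' n%:Z * t ^+ n) @ \oo --> p + p' by exact: (cvgCD hp hp').
  by apply: cvg_trans h1; apply: near_eq_cvg; near=> N; rewrite -big_split; apply: eq_bigr => k _ /=; rewrite mulrDl.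
have h1 : (fun N => \sum_(1 <= n < N) c (- n%:Z) * t ^- n + \sum_(1 <= n < N) c' (- n%:Z) * t ^- n) @ \oo --> q + q' by exact: (cvgCD hq hq').
by apply: cvg_trans h1; apply: near_eq_cvg; near=> N; rewrite -big_split; apply: eq_bigr => k _ /=; rewrite mulrDl.
Unshelve. all: by end_near. Qed.

Definition natco (s : nat -> C) : int -> C := fun m => if m is Posz J then s J else 0.

Lemma laurent_taylor (s : nat -> C) H (r : R) : 0 < r ->
  (forall t, cabs t < r -> hassum (fun J => s J * t ^+ J) (H t)) -> is_laurent_expansion H (natco s).
Proof.
move=> r0 h; exists r; split; first exact: r0.
move=> t t0 tr; exists (H t), 0; split; first exact: h.
split; last by rewrite addr0.
have hc : (fun _ : nat => 0 : C) @ \oo --> (0 : C) by exact: cvgC_cst.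
apply: cvg_trans hc; apply: near_eq_cvg; near=> N.
rewrite big1_seq// => -[|k]; rewrite mem_index_iota => /andP[_ /andP[k1 _]] //.
by rewrite mul0r.
Unshelve. all: by end_near. Qed.

Lemma laurent_step F c : is_laurent_expansion F c ->
  is_laurent_expansion (fun t => t^-1 * F t) (fun m => c (m + 1)).
Proof.
move=> [r [r0 h]]; exists r; split; first exact: r0.
move=> t t0 tr; have [p [q [hp [hq e]]]] := h t t0 tr.
exists (t^-1 * (p - c 0)), (t^-1 * (q + c 0)); split; last split; last by rewrite e -mulrDr addrA; congr (_ * _); ring.
  have h1 := hassumZ (c := t^-1) (hassumS hp); rewrite expr0 mulr1 in h1.
  apply: cvg_trans h1; apply: near_eq_cvg; near=> N; apply: eq_bigr => k _.
  have -> : k%:Z + 1 = k.+1%:Z by rewrite -PoszD addn1.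
  by rewrite exprS mulrCA mulKf.
have h1 := (hassum1S (fun n => c (- n%:Z) * t ^- n) q).2 hq.
have h2 := hassumZ (c := t^-1) (@hassum_cons (fun n => c (- n%:Z) * t ^- n) _ h1).
rewrite oppr0 expr0 invr1 mulr1 addrC in h2.
apply/hassum1S; apply: cvg_trans h2; apply: near_eq_cvg; near=> N; apply: eq_bigr => k _.
have -> : - k.+1%:Z + 1 = - k%:Z by rewrite -addn1 PoszD opprD subrK.
by rewrite exprS invfM mulrCA.
Unshelve. all: by end_near. Qed.

Lemma laurent_shift F c N : is_laurent_expansion F c ->
  is_laurent_expansion (fun t => t ^- N * F t) (fun m => c (m + N%:Z)).
Proof.
move=> h; elim: N => [|N IH].
  have -> : (fun t => t ^- 0 * F t) = F by apply/funext => t; rewrite expr0 invr1 mul1r.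
  by have -> : (fun m => c (m + 0)) = c by apply/funext => m; rewrite addr0.
have := laurent_step IH.
have -> : (fun t => t^-1 * (t ^- N * F t)) = fun t => t ^- N.+1 * F t.
  by apply/funext => t; rewrite exprS invfM mulrA.
have -> // : (fun m => c (m + 1 + N%:Z)) = fun m => c (m + N.+1%:Z).
by apply/funext => n; rewrite -addrA -PoszD.
Qed.

(* [ser (cI a) z] is the sum of [hc a n * z ^+ n]. *)
Definition hc a n : C := if odd n then 0 else cI a n./2 / 2%:R ^+ n.

Lemma psum_double (V : nmodType) (f : nat -> V) K :
  \sum_(0 <= n < K.*2) f n = \sum_(0 <= k < K) (f k.*2 + f k.*2.+1).
Proof.
elim: K => [|K IH]; first by rewrite !big_geq.
by rewrite doubleS !psumS IH addrA.
Qed.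

Lemma hc_even a k : hc a k.*2 = cI a k / 2%:R ^+ k.*2.
Proof. by rewrite /hc odd_double doubleK. Qed.

Lemma hc_odd a k : hc a k.*2.+1 = 0.
Proof. by rewrite /hc /= odd_double. Qed.

Lemma cabs_hc_even a k : cabs (hc a k.*2) = cabs (cI a k) * 2^-1 ^+ k.*2.
Proof.
rewrite hc_even; apply: etrans (cabsM (cI a k) _) _; congr (_ * _).
by rewrite cabsV (cabsX 2%:R) cabs_nat exprVn.
Qed.

Lemma hc_aux (p X : R) k : p * 2^-1 ^+ k.*2 * X ^+ k.*2 = p * (X / 2) ^+ 2 ^+ k.
Proof. by rewrite -exprM -mul2n [in RHS]exprMn -mulrA [X in _ * X = _]mulrC. Qed.

Lemma hc_bnd a (X : R) : 0 <= X -> exists B, forall M, \sum_(0 <= n < M) cabs (hc a n) * X ^+ n <= B.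
Proof.
move=> X0; have [|B hB] := @ent_bnd R (cI a) ((X / 2) ^+ 2) (ent_cI a); first exact: sqr_ge0.
exists B => M; apply: le_trans (hB M).
have h0 n : 0 <= cabs (hc a n) * X ^+ n by rewrite mulr_ge0 ?cabs_ge0 ?exprn_ge0.
apply: (@le_trans _ _ (\sum_(0 <= n < M.*2) cabs (hc a n) * X ^+ n)).
  by apply: (@psum_le _ (fun n => cabs (hc a n) * X ^+ n)) => //; rewrite -addnn leq_addr.
rewrite psum_double; apply: ler_sum => k _.
rewrite hc_odd cabs0 mul0r addr0 cabs_hc_even.
by rewrite hc_aux.
Qed.

Lemma hassum_hc a z : hassum (fun n => hc a n * z ^+ n) (ser (cI a) z).
Proof.
have [B hB] := hc_bnd a (cabs_ge0 z).
have hA : absbnd (fun n => hc a n * z ^+ n) B.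
  by move=> M; apply: le_trans (hB M); apply: ler_sum => n _; rewrite cabsM cabsX.
have h := absbnd_hassum hA.
suff -> : ser (cI a) z = csum (fun n => hc a n * z ^+ n) by [].
have hs := @ent_ser R _ z (ent_cI a).
apply: (hassum_unique hs).
have hd : (fun K => K.*2) @ \oo --> \oo.
  move=> P [n _ hn]; exists n => // k /= nk; apply: hn => /=; apply: (leq_trans nk); by rewrite -addnn leq_addr.
have h2 : (fun K => \sum_(0 <= n < K.*2) hc a n * z ^+ n) @ \oo --> csum (fun n => hc a n * z ^+ n).
  exact: (@cvg_comp _ _ _ (fun K => K.*2) (fun K => \sum_(0 <= n < K) hc a n * z ^+ n) _ _ _ hd h).
apply: cvg_trans h2; apply: near_eq_cvg; near=> K.
rewrite psum_double; apply: eq_bigr => k _.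
rewrite hc_odd mul0r addr0 hc_even exprMn exprVn mul2n; ring.
Unshelve. all: by end_near. Qed.

Lemma hc_rec a n : n.+2%:R * (n.+2%:R + 2%:R * a) * hc a n.+2 = hc a n.
Proof.
have [[k ->]|[k ->]] : (exists k, n = k.*2) \/ (exists k, n = k.*2.+1).
  by rewrite -[n]odd_double_half; case: (odd n); [right|left]; exists n./2.
- rewrite -doubleS !hc_even -(cI_rec a k) -[in X in X * (X + _)]mul2n doubleS !exprS natrM.
  by field; rewrite expf_neq0 ?pnatr_eq0.
- by rewrite -doubleS !hc_odd mulr0.
Qed.

(** The powers of x in the Frobenius series; [cpow] covers the negative exponents n < N and has a
    uniform theta-derivative. *)
Definition gc a N n x : C := hc a n * cpow x%:C (n%:R - N%:R).

Lemma cpowx_nat n N x : 0 < x -> cpow x%:C (n%:R - N%:R) = x%:C ^+ n * x%:C ^- N.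
Proof. by move=> x0; rewrite -cpow_mul cpowN !cpow_nat ?posC_neq0. Qed.

(** The m-th power of z = t x / (1 - t) merges with the prefactor into one power of 1 - t, and
    [fubini_diag] collects the powers of t. The factor t^(-N) is left out here and restored by
    [laurent_shift]. *)
Lemma SX_expand mu nu a N F phi x : AT F phi -> 0 < x -> exists2 r : R, 0 < r & forall t, cabs t < r ->
  hassum (fun J => SX mu nu N%:R (gc a N) phi 0 J x * t ^+ J)
    (Gpref mu nu t * ((x%:C / (1 - t)) ^- N * ser (cI a) (t * x%:C / (1 - t))) * F (x%:C / (1 - t))).
Proof.
move=> [_ hAT] x0; have [r [A [r0 r1 h]]] := hAT x x0.
have h2 : 0 < 2^-1 :> R by rewrite invr_gt0.
have h21 : 2^-1 < 1 :> R by rewrite invf_lt1// ltr1n.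
exists (Num.min r 2^-1); first by rewrite lt_min r0.
move=> t; rewrite lt_min => /andP[/ltW tr t2]; have [hA hF] := h t tr.
have t1 : cabs t < 1 by exact: lt_trans t2 h21.
pose be : C := (mu + nu + 2%:R) / 2%:R - N%:R + 0%:R.
have [K hK] := ex_natbnd (cabs be).
have A0 : 0 <= A by have := hA 0%N; rewrite big_geq.
pose al (m n : nat) := gc a N m x * t ^+ m * (conv (phi^~ x) (rf (m%:R + be)) n * t ^+ n).
have hcv (m : nat) : absbnd (fun n => conv (phi^~ x) (rf (m%:R + be)) n * t ^+ n) (A * 2 ^+ (m + K)) /\
    hassum (fun n => conv (phi^~ x) (rf (m%:R + be)) n * t ^+ n) (F (x%:C / (1 - t)) * cpow (1 - t) (- (m%:R + be))).
  have hb : cabs (m%:R + be) <= (m + K)%:R.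
    by apply: le_trans (cabsD _ _) _; rewrite cabs_nat natrD lerD2l.
  have b1 := rf_bnd hb h21 (ltW t2).
  have := absbndM hA b1; rewrite conv_pow (hassum_csum hF) (hassum_csum (@binomial_series R (m%:R + be) t t1)).
  by have -> : (1 - 2^-1)^-1 = 2 :> R by field.
pose C0 := cabs (x%:C ^- N) * A * 2 ^+ K.
have C00 : 0 <= C0 by rewrite !mulr_ge0 ?cabs_ge0 ?exprn_ge0.
(* The m-th row grows like 2^m through its exponent; |t|^m with |t| < 1/2 compensates. *)
have alM (m : nat) : absbnd (al m) (C0 * (cabs (hc a m) * x ^+ m)).
  move=> M; rewrite /al; under eq_bigr do rewrite cabsM.
  rewrite -big_distrr /=; apply: le_trans (ler_wpM2l (cabs_ge0 _) ((hcv m).1 M)) _.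
  rewrite /gc cpowx_nat// !cabsM !cabsX cabsR (gtr0_norm x0) exprD.
  have -> : cabs (hc a m) * (x ^+ m * cabs (x%:C ^- N)) * cabs t ^+ m * (A * (2 ^+ m * 2 ^+ K)) =
     C0 * (cabs (hc a m) * x ^+ m) * (cabs t * 2) ^+ m by rewrite /C0 exprMn; ring.
  have X0 : 0 <= C0 * (cabs (hc a m) * x ^+ m) by rewrite mulr_ge0 ?mulr_ge0 ?cabs_ge0 ?exprn_ge0 ?(ltW x0).
  rewrite ler_piMr// exprn_ile1 ?mulr_ge0 ?cabs_ge0//.
  by rewrite -ler_pdivlMr// mul1r ltW.
have [B hB] := hc_bnd a (ltW x0).
have hM M : \sum_(0 <= m < M) C0 * (cabs (hc a m) * x ^+ m) <= C0 * B.
  by rewrite -big_distrr /= ler_wpM2l.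
have := fubini_diag alM hM.
have -> : (fun J => \sum_(0 <= k < J.+1) al k (J - k)%N) = fun J => SX mu nu N%:R (gc a N) phi 0 J x * t ^+ J.
  apply/funext => J; rewrite /SX /Sc big_distrl /=; apply: eq_big_nat => m /andP[_ mJ].
  have -> : t ^+ J = t ^+ m * t ^+ (J - m) by rewrite -exprD subnKC.
  by rewrite /al -/be; ring.
suff -> : csum (fun k => csum (al k)) = Gpref mu nu t * ((x%:C / (1 - t)) ^- N * ser (cI a) (t * x%:C / (1 - t))) * F (x%:C / (1 - t)) by [].
have hz : hassum (fun n => hc a n * (t * x%:C / (1 - t)) ^+ n) (ser (cI a) (t * x%:C / (1 - t))) by exact: hassum_hc.
apply: hassum_csum; have hz2 := hassumZ (c := Gpref mu nu t * (x%:C / (1 - t)) ^- N * F (x%:C / (1 - t))) hz.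
have -> : Gpref mu nu t * ((x%:C / (1 - t)) ^- N * ser (cI a) (t * x%:C / (1 - t))) * F (x%:C / (1 - t)) =
  Gpref mu nu t * (x%:C / (1 - t)) ^- N * F (x%:C / (1 - t)) * ser (cI a) (t * x%:C / (1 - t)) by ring.
apply: cvg_trans hz2; apply: near_eq_cvg; near=> M; apply: eq_bigr => m _.
have -> : csum (al m) = gc a N m x * t ^+ m * (F (x%:C / (1 - t)) * cpow (1 - t) (- (m%:R + be))).
  by apply: hassum_csum; exact: (hassumZ (proj2 (hcv m))).
have u0 := Re_neq0 (Re_1B t1); have x0' := posC_neq0 x0.
have -> : cpow (1 - t) (- (m%:R + be)) = Gpref mu nu t * (1 - t) ^- m * (1 - t) ^+ N.
  rewrite /Gpref -[(1 - t) ^+ N]cpow_nat// -[(1 - t) ^+ m]cpow_nat// -cpowN !cpow_mul; congr cpow.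
  by rewrite /be; ring.
rewrite /gc cpowx_nat// !exprMn !exprVn invfM invrK; ring.
Unshelve. all: by end_near. Qed.

End LaurentExpansion.

Arguments hasD_powx {R} s.
Section LambdaFormula.
Variable R : realType.
Local Notation C := R[i].
Implicit Types (a b z t mu nu : C) (x : R) (n N J k : nat) (m j : int) (F H : C -> C) (c : int -> C) (phi : nat -> R -> C).
Local Notation Re := complex.Re.

Lemma solv_ext mu nu lam (u v : R -> C) : (forall x, 0 < x -> u x = v x) -> solv mu nu lam u -> solv mu nu lam v.
Proof.
move=> uv [u1 [u2 [A1 [A2 [h1 h2 h3 h4 h5]]]]]; exists u1, u2, A1, A2; split.
- by apply: (hasD_ext uv _ h1).
- exact: h2.
- by apply: (hasD_ext _ _ h3) => // x x0; rewrite uv.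
- exact: h4.
- by move=> x x0; rewrite -uv//; exact: h5.
Qed.

Lemma solv_scl mu nu lam (u : R -> C) a : solv mu nu lam u -> solv mu nu lam (fun x => a * u x).
Proof.
move=> [u1 [u2 [A1 [A2 [h1 h2 h3 h4 h5]]]]].
exists (fun x => a * u1 x), (fun x => a * u2 x), (fun x => a * A1 x), (fun x => a * A2 x); split.
- exact: hasDZ.
- exact: hasDZ.
- by apply: hasD_ext (hasDZ a h3) => // x _; ring.
- exact: hasDZ.
- move=> x x0; have e := h5 x x0.
  have -> : x%:C ^+ 2 * ((lam + (mu - nu) * (mu + nu + 2%:R) / 2%:R) * (a * u x)) =
    a * (x%:C ^+ 2 * ((lam + (mu - nu) * (mu + nu + 2%:R) / 2%:R) * u x)) by ring.
  by rewrite -e; ring.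
Qed.

Lemma solv_add mu nu lam (u v : R -> C) : solv mu nu lam u -> solv mu nu lam v -> solv mu nu lam (fun x => u x + v x).
Proof.
move=> [u1 [u2 [A1 [A2 [h1 h2 h3 h4 h5]]]]] [v1 [v2 [B1 [B2 [k1 k2 k3 k4 k5]]]]].
exists (fun x => u1 x + v1 x), (fun x => u2 x + v2 x), (fun x => A1 x + B1 x), (fun x => A2 x + B2 x); split.
- exact: hasDD.
- exact: hasDD.
- by apply: hasD_ext (hasDD h3 k3) => // x _; ring.
- exact: hasDD.
- move=> x x0; have e := h5 x x0; have e' := k5 x x0.
  rewrite [in RHS]mulrDr [in RHS]mulrDr -e -e'; ring.
Qed.

Lemma solv_0 mu nu lam : solv mu nu lam (fun _ : R => 0).
Proof.
have h := @hasD_cst R (0 : C).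
exists (fun=> 0), (fun=> 0), (fun=> 0), (fun=> 0); split; try exact: h.
- by apply: hasD_ext h => // x _; rewrite !mulr0 addr0 subrr.
- by move=> x _; rewrite !mulr0 !addr0 subrr mulr0 addr0 mulr0 subrr.
Qed.

(** Both sides are sequences satisfying [tow], and at index 0 the identity is Bessel's equation in
    x, so [tow_ext] gives all n. *)
Lemma bessel_ode_coef nu phi : tow phi -> ODEr nu (phi 0%N) (fun=> 0) -> forall n x, 0 < x ->
  thv (thv phi) n x + nu * thv phi n x = x%:C ^+ 2 * conv (phi^~ x) (rf 2%:R) n.
Proof.
move=> tp [f1 [f2 [h1 h2 h3]]].
pose q n x : C := rf 2%:R n * x%:C ^+ 2.
have tq : tow q.
  move=> n; apply: hasD_ext (hasDZ (rf 2%:R n) (hasDM (@hasD_id R) (@hasD_id R))) => x _; first by rewrite /q expr2.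
  by rewrite /thv /q; have := rfS 2%:R n : _ = _ :> C => e; rewrite mulrA e; ring.
have t1 := tow_add (tow_thv (tow_thv tp)) (tow_scl nu (tow_thv tp)).
have t2 := tow_mul tp tq.
move=> n x x0.
have e1 y : 0 < y -> thv phi 0 y = f1 y by exact: (hasD_unique (@tp 0%N) h1).
have d1 : hasD f1 (thv (thv phi) 0%N) by apply: hasD_ext (@tow_thv R phi tp 0%N) => // y y0; rewrite e1.
have e2 y : 0 < y -> thv (thv phi) 0 y = f2 y by exact: (hasD_unique d1 h2).
have h : forall n x, 0 < x -> addv (thv (thv phi)) (sclv nu (thv phi)) n x = mulv phi q n x.
  apply: tow_ext t1 t2 _ => y y0; rewrite mulv0 /addv /sclv e1// e2// h3// /q rf0 addr0; ring.
rewrite -[LHS]/(addv (thv (thv phi)) (sclv nu (thv phi)) n x) h// /mulv /conv big_distrr /=.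
by apply: eq_bigr => i _; rewrite /q; ring.
Qed.

Lemma SX_is_solv mu nu a N F phi J :
  (forall n, (n%:R - N%:R) * (n%:R - N%:R + mu) = n%:R * (n%:R + 2%:R * a)) ->
  AT F phi -> ODEr nu (phi 0%N) (fun=> 0) ->
  solv mu nu (lambda mu nu (J%:Z - N%:Z)) (SX mu nu N%:R (gc a N) phi 0 J).
Proof.
move=> hN [tp _] hode.
have hg n : hasD (gc a N n) (fun x => (n%:R - N%:R) * gc a N n x).
  by apply: hasD_ext (hasDZ (hc a n) (hasD_powx (n%:R - N%:R))) => // x _; rewrite /gc; ring.
have := @SX_solv R mu nu N%:R (gc a N) phi hg _ _ _ tp (bessel_ode_coef tp hode) J.
rewrite /lambda intrB -!pmulrn; apply.
- by move=> x _; have := hN 0%N; rewrite !sub0r mul0r => ->; rewrite mul0r.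
- by move=> x _; rewrite /gc /hc /= mul0r mulr0.
- move=> n x x0; rewrite hN /gc [LHS]mulrA hc_rec !cpowx_nat// !exprS; ring.
Qed.

Arguments laurent_taylor {R s H r} _ _.
Arguments laurent_scl {R F c} a _.
Arguments laurent_shift {R F c} N _.

Lemma Lambda12E (i : nat) mu nu F phi x j : AT F phi -> 0 < x ->
  (forall t, G i mu nu t x = Gpref mu nu t * Itil (mu / 2%:R) (t * x%:C / (1 - t)) * F (x%:C / (1 - t))) ->
  Lambda i mu nu j x = natco (fun J => SX mu nu 0%:R (gc (mu / 2%:R) 0) phi 0 J x) j.
Proof.
move=> hF x0 hG; rewrite /Lambda.
have [r r0 h] := SX_expand mu nu (mu / 2%:R) 0 hF x0.
have h1 := laurent_coefE (laurent_taylor r0 h); rewrite -h1; congr (laurent_coef _ j).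
by apply/funext => t; rewrite hG ItilE expr0 invr1 mul1r.
Qed.

Lemma half_odd_nonint (n : nat) : ~ (exists k : int, (2 * n + 1)%:R / 2%:R = k%:~R :> C).
Proof.
move=> [k hk].
have e : (2 * n + 1)%:R = (2 * k)%:~R :> C.
  by rewrite -[LHS](@divfK _ 2%:R) ?pnatr_eq0// hk intrM mulrC.
have : (2 * n + 1)%:Z = 2 * k.
  by apply/eqP; rewrite -(eqr_int C) -e -pmulrn.
by clear; lia.
Qed.

Definition kap1 mu : C := pi%:C / 2%:R / csin (mu / 2%:R * pi%:C).

Lemma Ktil_combination (k P c u w p q f : C) :
  k * c * (u * (P * (w * p) * f)) + - k * (P * q * f) = P * (k * (c * (u * w) * p + -1 * q)) * f.
Proof. by ring. Qed.

(** For half-odd order, K is a combination of I_(mu/2) and I_(-mu/2). After normalization the latter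
    carries (z/2)^(-mu), an integral power: hence the pole of order mu in t, the index shift, and
    the constant 2^mu. *)
Lemma Lambda34E (i n : nat) mu nu F phi x j : AT F phi -> 0 < x -> mu = (2 * n + 1)%:R ->
  (forall t, G i mu nu t x = Gpref mu nu t * Ktil (mu / 2%:R) (t * x%:C / (1 - t)) * F (x%:C / (1 - t))) ->
  Lambda i mu nu j x = kap1 mu * 2%:R ^+ (2 * n + 1) * natco (fun J => SX mu nu (2 * n + 1)%:R (gc (- (mu / 2%:R)) (2 * n + 1)) phi 0 J x) (j + (2 * n + 1)%N%:Z) +
     - kap1 mu * natco (fun J => SX mu nu 0%:R (gc (mu / 2%:R) 0) phi 0 J x) j.
Proof.
move=> hF x0 hmu hG; rewrite /Lambda.
set N := (2 * n + 1)%N in hmu *.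
have [r r0 h] := SX_expand mu nu (mu / 2%:R) 0 hF x0.
have [r' r'0 h'] := SX_expand mu nu (- (mu / 2%:R)) N hF x0.
have l1 := laurent_scl (kap1 mu * 2%:R ^+ N) (laurent_shift N (laurent_taylor r'0 h')).
have l2 := laurent_scl (- kap1 mu) (laurent_taylor r0 h).
have l3 := laurent_add l1 l2.
suff -> : laurent_coef ((G i mu nu)^~ x) = fun m => kap1 mu * 2%:R ^+ N * natco (fun J => SX mu nu N%:R (gc (- (mu / 2%:R)) N) phi 0 J x) (m + N%:Z) +
     - kap1 mu * natco (fun J => SX mu nu 0%:R (gc (mu / 2%:R) 0) phi 0 J x) m by [].
apply: laurent_coefE; apply: (laurent_ext ltr01 _ l3) => t t0 t1.
have u0 := Re_neq0 (Re_1B t1); have xn0 := posC_neq0 x0.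
have z0 : t * x%:C / (1 - t) != 0 by rewrite !mulf_neq0// invr_eq0.
rewrite hG Ktil_nonint//; last by rewrite hmu; exact: half_odd_nonint.
have -> : - (2%:R * (mu / 2%:R)) = - N%:R by rewrite hmu [2%:R * _]mulrC divfK// pnatr_eq0.
have z2 : t * x%:C / (1 - t) / 2%:R != 0 by rewrite mulf_neq0// invr_eq0 pnatr_eq0.
rewrite cpowN cpow_nat// -/(kap1 mu).
have -> : (t * x%:C / (1 - t) / 2%:R) ^- N = 2%:R ^+ N * (t ^- N * (x%:C / (1 - t)) ^- N).
  have -> : t * x%:C / (1 - t) / 2%:R = t * (x%:C / (1 - t)) / 2%:R by rewrite (mulrA t).
  by rewrite exprMn exprVn [(t * _) ^+ N]exprMn !invfM invrK mulrC.
rewrite expr0 invr1 mul1r; exact: Ktil_combination.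
Qed.

End LambdaFormula.

(** * Solutions and their uniqueness *)

Section SolutionChains.
Variable R : realType.
Local Notation C := R[i].
Implicit Types (a b z mu nu lam : C) (x : R) (n k : nat) (f g u v : R -> C).

(** Differentiability n times, counted with theta; on x > 0 this is equivalent to the count with
    d/dx because multiplying by x or 1/x loses nothing. *)
Fixpoint Cn n f : Prop := if n is n'.+1 then exists2 g, hasD f g & Cn n' g else True.

Lemma Cn_ext n f g : (forall x, 0 < x -> f x = g x) -> Cn n f -> Cn n g.
Proof.
case: n => // n fg [h hf hn]; exists h; last exact: hn.
exact: (hasD_ext fg (fun x _ => erefl) hf).
Qed.

Lemma Cn_le n f : Cn n.+1 f -> Cn n f.
Proof. by elim: n f => // n IH f [g hg /IH hn]; exists g. Qed.

Lemma Cn_add n f g : Cn n f -> Cn n g -> Cn n (fun x => f x + g x).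
Proof.
elim: n f g => // n IH f g [f1 h1 h2] [g1 h3 h4]; exists (fun x => f1 x + g1 x); last exact: IH.
exact: hasDD.
Qed.

Lemma Cn_scl n f a : Cn n f -> Cn n (fun x => a * f x).
Proof.
elim: n f => // n IH f [f1 h1 h2]; exists (fun x => a * f1 x); last exact: IH.
exact: hasDZ.
Qed.

Lemma hasD_inv : hasD (fun x : R => x%:C^-1 : C) (fun x => - x%:C^-1).
Proof.
have e x : 0 < x -> cpow x%:C (-1) = x%:C^-1 :> C.
  by move=> x0; rewrite cpowN -[1]/(1%:R : C) cpow_nat ?posC_neq0.
apply: hasD_ext (@hasD_powx R (-1)) => x x0; first exact: e.
by rewrite e// mulN1r.
Qed.

Lemma Cn_mulx n f : Cn n f -> Cn n (fun x => x%:C * f x).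
Proof.
elim: n f => // n IH f [f1 h1 h2]; exists (fun x => x%:C * f x + x%:C * f1 x).
  exact: (hasDM (@hasD_id R) h1).
by apply: Cn_add; apply: IH => //; apply: Cn_le; exists f1.
Qed.

Lemma Cn_divx n f : Cn n f -> Cn n (fun x => x%:C^-1 * f x).
Proof.
elim: n f => // n IH f [f1 h1 h2]; exists (fun x => -1 * (x%:C^-1 * f x) + x%:C^-1 * f1 x).
  by apply: hasD_ext (hasDM hasD_inv h1) => // x _; ring.
apply: Cn_add; last exact: IH.
by apply: Cn_scl; apply: IH; apply: Cn_le; exists f1.
Qed.

Lemma cd_derivable f x l : cd f x l -> cderivable f x.
Proof. by move=> h; apply/cvg_ex; exists l. Qed.

Lemma cd_cderiv f x l : cd f x l -> cderiv f x = l.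
Proof. exact: cvgC_lim. Qed.

Lemma derivable_cd f x : cderivable f x -> cd f x (cderiv f x).
Proof. by move=> /cvg_ex [l hl]; rewrite (cd_cderiv hl). Qed.

Lemma hasD_cderiv f g x : hasD f g -> 0 < x -> cderiv f x = x%:C^-1 * g x.
Proof. by move=> h x0; exact: cd_cderiv (h x x0). Qed.

Lemma theta_hasD f g x : hasD f g -> 0 < x -> theta f x = g x.
Proof. by move=> h x0; rewrite /theta (hasD_cderiv h)// mulVKf// posC_neq0. Qed.

Lemma hasD_theta f : (forall x, 0 < x -> cderivable f x) -> hasD f (theta f).
Proof.
move=> h x x0; apply: cd_eq (derivable_cd (h x x0)) _.
by rewrite /theta mulKf// posC_neq0.
Qed.

Lemma Cn_derivable n f : Cn n f <-> (forall k, (k < n)%N -> forall x, 0 < x -> cderivable (iter k (@cderiv R) f) x).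
Proof.
elim: n f => [|n IH] f; first by split.
split.
  move=> [g hg hn] [_ x x0|k kn x x0]; first exact: cd_derivable (hg x x0).
  rewrite iterSr; move: k kn x x0; apply/IH.
  apply: (@Cn_ext _ (fun x => x%:C^-1 * g x)); last exact: Cn_divx.
  by move=> x x0; rewrite (hasD_cderiv hg).
move=> h; exists (theta f); first by apply: hasD_theta; exact: (h 0%N).
apply: Cn_mulx; apply/IH => k kn x x0; rewrite -iterSr; exact: h.
Qed.

Definition Aop mu u x := theta (thetaS mu u) x - (x ^+ 2)%:C * u x.

Lemma thetaS_hasD a f g x : hasD f g -> 0 < x -> thetaS a f x = g x + a * f x.
Proof. by move=> h x0; rewrite /thetaS (theta_hasD h). Qed.

Lemma hasD_thetaS a f g g2 : hasD f g -> hasD g g2 -> hasD (thetaS a f) (fun x => g2 x + a * g x).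
Proof.
move=> h h2; apply: hasD_ext (hasDD h2 (hasDZ a h)) => // x x0.
by rewrite (thetaS_hasD _ h).
Qed.

Arguments hasD_thetaS a {f g g2} _ _.
Lemma AopE mu u u1 u2 x : hasD u u1 -> hasD u1 u2 -> 0 < x -> Aop mu u x = u2 x + mu * u1 x - x%:C ^+ 2 * u x.
Proof.
by move=> h1 h2 x0; rewrite /Aop (theta_hasD (hasD_thetaS mu h1 h2))// rmorphXn.
Qed.

Lemma DopE mu nu u u1 u2 A1 A2 x : hasD u u1 -> hasD u1 u2 ->
  hasD (fun x => u2 x + mu * u1 x - x%:C ^+ 2 * u x) A1 -> hasD A1 A2 -> 0 < x ->
  Dop mu nu u x = x%:C ^- 2 * (A2 x + (mu + 2%:R * nu) * A1 x + nu * (mu + nu) * (u2 x + mu * u1 x - x%:C ^+ 2 * u x) -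
     x%:C ^+ 2 * (u2 x + mu * u1 x - x%:C ^+ 2 * u x)) - (mu - nu) * (mu + nu + 2%:R) / 2%:R * u x.
Proof.
move=> h1 h2 h3 h4 x0; rewrite /Dop -/(Aop mu u) -[theta (thetaS mu u) x - _]/(Aop mu u x).
have hA : hasD (Aop mu u) A1 by apply: hasD_ext h3 => // y y0; rewrite (AopE _ h1 h2).
have hB := hasD_thetaS (mu + nu) hA h4.
rewrite (thetaS_hasD _ hB)// (thetaS_hasD _ hA)// (AopE _ h1 h2)//.
have -> : (x ^- 2)%:C = x%:C ^- 2 by rewrite fmorphV rmorphXn.
have -> : (x ^+ 2)%:C = x%:C ^+ 2 by rewrite rmorphXn.
by congr (_ - _); congr (_ * _); ring.
Qed.

Lemma Dop_eq_iff mu nu lam q (K c X : C) : q != 0 -> (q^-1 * K - c * X = lam * X) <-> K = q * ((lam + c) * X).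
Proof.
move=> q0; split => [h|->]; last by rewrite mulKf//; ring.
by rewrite -[LHS](mulVKf q0); congr (_ * _); rewrite -[LHS](subrK (c * X)) h; ring.
Qed.

Lemma solvP mu nu lam u : solv mu nu lam u <-> is_solution mu nu lam u.
Proof.
have q0 x : 0 < x -> x%:C ^+ 2 != 0 :> C by move=> x0; rewrite expf_neq0// posC_neq0.
split.
  move=> [u1 [u2 [A1 [A2 [h1 h2 h3 h4 h5]]]]]; split.
    apply/(Cn_derivable 4); exists u1 => //; exists u2 => //.
    (* [u2] is recovered from A u, [u1] and [u], so the differentiability known for A u passes to
       it. *)
    apply: (@Cn_ext _ (fun x => (u2 x + mu * u1 x - x%:C ^+ 2 * u x) + - mu * u1 x + x%:C * (x%:C * u x))).
      by move=> x _; ring.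
    have c2 : Cn 2 u by exists u1 => //; exists u2.
    have c1 : Cn 2 u1.
      exists u2 => //.
      apply: (@Cn_ext _ (fun x => (u2 x + mu * u1 x - x%:C ^+ 2 * u x) + - mu * u1 x + x%:C * (x%:C * u x))).
        by move=> x _; ring.
      apply: Cn_add; last by do 2 apply: Cn_mulx; exact: Cn_le.
      by apply: Cn_add; [exists A1|apply: Cn_scl; exists u2].
    apply: Cn_add; last by do 2 apply: Cn_mulx.
    by apply: Cn_add; [exists A1 => //; exists A2|exact: Cn_scl].
  move=> x x0; rewrite (DopE nu h1 h2 h3 h4)//; apply/Dop_eq_iff => //; [exact: q0|exact: h5].
move=> [/(Cn_derivable 4) [u1 h1 [u2 h2 [u3 h3 [u4 h4 _]]]] hD].
pose Q f g x := x%:C ^+ 2 * (g x + 2%:R * f x).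
have d3 := hasDB (hasDD h3 (hasDZ mu h2)) (hasD_x2 h1).
have d4 := hasDB (hasDD h4 (hasDZ mu h3)) (hasD_x2 (hasDD h2 (hasDZ 2%:R h1))).
exists u1, u2; do 2 eexists; split; [exact: h1|exact: h2|exact: d3|exact: d4|] => x x0.
apply/(Dop_eq_iff nu) => //; first exact: q0.
by rewrite -hD// (DopE nu h1 h2 d3 d4).
Qed.

End SolutionChains.

Section SystemUniqueness.
Variable R : realType.
Local Notation C := R[i].
Implicit Types (a b z mu nu lam : C) (x : R) (n k : nat) (f g u v : R -> C).
Local Notation Re := complex.Re.
Local Notation Im := complex.Im.

Definition normsq z : R := Re z ^+ 2 + Im z ^+ 2.
Definition re_inner z (w : C) : R := Re z * Re w + Im z * Im w.

Lemma n2_ge0 z : 0 <= normsq z.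
Proof. by rewrite addr_ge0 ?sqr_ge0. Qed.

Lemma n2_cabs z : normsq z = cabs z ^+ 2.
Proof. by rewrite /normsq /cabs sqr_sqrtr ?addr_ge0 ?sqr_ge0. Qed.

Lemma ip_le z (w : C) : `|re_inner z w| <= cabs z * cabs w.
Proof.
rewrite -(ler_pXn2r (_ : (0 < 2)%N)) ?nnegrE ?mulr_ge0 ?cabs_ge0//.
rewrite exprMn -!n2_cabs real_normK ?num_real// -subr_ge0 /normsq /re_inner.
have -> : (Re z ^+ 2 + Im z ^+ 2) * (Re w ^+ 2 + Im w ^+ 2) - (Re z * Re w + Im z * Im w) ^+ 2 = (Re z * Im w - Im z * Re w) ^+ 2 by ring.
exact: sqr_ge0.
Qed.

Lemma n2_deriv v (w : R -> C) x : hasD v w -> 0 < x ->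
  is_derive x 1 (fun y => normsq (v y)) (x^-1 * (2 * re_inner (v x) (w x))).
Proof.
move=> h x0; have /cdP [h1 h2] := h x x0.
have e : x%:C^-1 = (x^-1)%:C :> C by rewrite fmorphV.
rewrite e Re_rmul in h1; rewrite e Im_rmul in h2.
rewrite /normsq; apply: is_derive_eq; rewrite /re_inner /GRing.scale /=; ring.
Qed.

Lemma mono_le (g g' : R -> R) p q : p <= q -> (forall x, p <= x <= q -> is_derive x 1 g (g' x)) ->
  (forall x, p <= x <= q -> 0 <= g' x) -> g p <= g q.
Proof.
move=> pq hg hg'.
have [||c cpq e] := @MVT_segment R g g' p q pq.
- by move=> x; rewrite in_itv /= => /andP[h1 h2]; apply: hg; rewrite !ltW.
- apply: derivable_within_continuous => x; rewrite in_itv /= => hx.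
  by have [] := hg x hx.
rewrite -subr_ge0 e mulr_ge0 ?subr_ge0//; apply: hg'.
by move: cpq; rewrite in_itv.
Qed.

Lemma is_derive_pow n (y : R) : is_derive y 1 (fun z : R => z ^+ n) (n%:R * y ^+ n.-1).
Proof.
case: n => [|n] /=.
  by rewrite mul0r; under eq_fun do rewrite expr0; exact: is_derive_cst.
elim: n => [|n IH]; first by rewrite expr0 mulr1; exact: is_derive_id.
have d : is_derive y 1 (fun z : R => z * z ^+ n.+1) (n.+2%:R * y ^+ n.+1).
  by apply: is_derive_eq; rewrite /GRing.scale /= mulr1 mulrCA -exprS -[n.+2%:R]natr1; ring.
by apply: (is_derive_eq _ erefl) => //; under eq_fun do rewrite exprS.
Qed.

Definition sum4 (f : nat -> R) := f 0%N + f 1%N + f 2%N + f 3%N.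

Lemma sum4_norm (f g : nat -> R) : (forall k, (k < 4)%N -> `|f k| <= g k) -> `|sum4 f| <= sum4 g.
Proof.
move=> h; rewrite /sum4.
apply: (le_trans (ler_normD _ _)); apply: lerD; last exact: h.
apply: (le_trans (ler_normD _ _)); apply: lerD; last exact: h.
by apply: (le_trans (ler_normD _ _)); apply: lerD; exact: h.
Qed.

(** For E = sum |v_i|^2 the hypothesis gives |theta E| <= 8 L E, from 2 L (sum |v_i|)^2 and
    Cauchy-Schwarz with four terms. Left of 1 the function y^(K+1) E increases, the power matching
    the singularity at 0; right of 1 exp (- K y) E decreases. Both vanish at 1. *)
Lemma linear_system_unique (v w : nat -> R -> C) :
  (forall i, (i < 4)%N -> hasD (v i) (w i)) ->
  (forall b : R, 0 < b -> exists2 L : R, 0 <= L & forall x i, 0 < x -> x <= b -> (i < 4)%N ->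
     cabs (w i x) <= L * sum4 (fun k => cabs (v k x))) ->
  (forall i, (i < 4)%N -> v i 1 = 0) -> forall i x, (i < 4)%N -> 0 < x -> v i x = 0.
Proof.
move=> hD hL h1 i x i4 x0.
pose E (y : R) := sum4 (fun k => normsq (v k y)).
pose T (y : R) := sum4 (fun k => 2 * re_inner (v k y) (w k y)).
have dE (y : R) : 0 < y -> is_derive y 1 E (y^-1 * T y).
  move=> y0; rewrite /E /T /sum4.
  have d0 := n2_deriv (@hD 0%N isT) y0; have d1 := n2_deriv (@hD 1%N isT) y0.
  have d2 := n2_deriv (@hD 2%N isT) y0; have d3 := n2_deriv (@hD 3%N isT) y0.
  by apply: is_derive_eq; ring.
have E0 (y : R) : 0 <= E y by exact: (addr_ge0 (addr_ge0 (addr_ge0 (n2_ge0 _) (n2_ge0 _)) (n2_ge0 _)) (n2_ge0 _)).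
have E1 : E 1 = 0 by rewrite /E /sum4 !h1// /normsq /= expr0n !addr0.
have b0 : 0 < Num.max 1 x by rewrite lt_max ltr01.
have [L L0 hL'] := hL _ b0.
have TE (y : R) : 0 < y -> y <= Num.max 1 x -> `|T y| <= 8 * L * E y.
  move=> y0 yb; have hw k := hL' y k y0 yb.
  pose S := sum4 (fun k => cabs (v k y)).
  have Hk k : (k < 4)%N -> `|2 * re_inner (v k y) (w k y)| <= 2 * (cabs (v k y) * (L * S)).
    move=> k4; rewrite normrM ger0_norm// ler_wpM2l//; apply: le_trans (ip_le _ _) _.
    by rewrite ler_wpM2l ?cabs_ge0// hw.
  apply: (@le_trans _ _ (2 * L * S ^+ 2)).
    have -> : 2 * L * S ^+ 2 = sum4 (fun k => 2 * (cabs (v k y) * (L * S))) by rewrite [in RHS]/sum4 {1}/S /sum4 /S /sum4; ring.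
    exact: sum4_norm Hk.
  have -> : 8 * L * E y = 2 * L * (4 * E y) by ring.
  rewrite ler_wpM2l ?mulr_ge0// /S /E /sum4 !n2_cabs.
  move: (cabs _) (cabs _) (cabs _) (cabs _) => s r q p; rewrite -subr_ge0.
  have -> : 4 * (p ^+ 2 + q ^+ 2 + r ^+ 2 + s ^+ 2) - (p + q + r + s) ^+ 2 =
      (p - q) ^+ 2 + (p - r) ^+ 2 + (p - s) ^+ 2 + (q - r) ^+ 2 + (q - s) ^+ 2 + (r - s) ^+ 2 by ring.
  by rewrite !addr_ge0 ?sqr_ge0.
suff Ex : E x <= 0.
  have Ei : normsq (v i x) <= E x.
    have g k := n2_ge0 (v k x).
    by rewrite /E /sum4; case: i i4 => [|[|[|[|//]]]] _; rewrite -subr_ge0; move: (g 0%N) (g 1%N) (g 2%N) (g 3%N) => g0 g1 g2 g3; lra.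
  apply/eqP; rewrite -cabs_eq0 -sqrf_eq0 -n2_cabs eq_le n2_ge0 andbT; exact: le_trans Ei Ex.
have [K hK] := ex_natbnd (8 * L).
have KT (y : R) : 0 < y -> y <= Num.max 1 x -> 0 <= K%:R * E y + T y /\ T y <= K%:R * E y.
  move=> y0 yb; have := TE y y0 yb; have hKE := ler_wpM2r (E0 y) hK.
  by rewrite ler_norml => /andP[t1 t2]; split; lra.
have [x1|x1] := leP x 1.
  have h := @mono_le (fun y => y ^+ K.+1 * E y) (fun y => y ^+ K * (K.+1%:R * E y + T y)) x 1 x1 _ _.
  have {}h : x ^+ K.+1 * E x <= 0.
    have -> : 0 = 1 ^+ K.+1 * E 1 by rewrite E1 mulr0.
    apply: h => y /andP[xy y1]; have y0 := lt_le_trans x0 xy.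
      have d := dE y y0; have dp := is_derive_pow K.+1 y; apply: is_derive_eq; rewrite /GRing.scale /= exprS; field; by rewrite gt_eqF.
    rewrite mulr_ge0 ?exprn_ge0 ?(ltW y0)// -natr1.
    have [] := KT y y0; first by rewrite le_max y1.
    by have := E0 y; lra.
  by rewrite -(pmulr_rle0 _ (exprn_gt0 K.+1 x0)).
have h := @mono_le (fun y => - (expR (- (K%:R * y)) * E y)) (fun y => expR (- (K%:R * y)) * (K%:R * E y - y^-1 * T y)) 1 x (ltW x1) _ _.
have {}h : - (expR (- (K%:R * 1)) * E 1) <= - (expR (- (K%:R * x)) * E x).
  apply: h => y /andP[y1 yx]; have y0 := lt_le_trans ltr01 y1.
    have d := dE y y0; apply: is_derive_eq; rewrite /GRing.scale /=; ring.
  rewrite mulr_ge0 ?expR_ge0// subr_ge0 mulrC ler_pdivrMr//.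
  have [|_ h2] := KT y y0; first by rewrite le_max yx orbT.
  apply: le_trans h2 _.
  by rewrite ler_peMr// mulr_ge0.
move: h; rewrite E1 mulr0 oppr0 oppr_ge0 pmulr_rle0 ?expR_gt0//.
Qed.
End SystemUniqueness.

Section SolutionUniqueness.
Variable R : realType.
Local Notation C := R[i].
Implicit Types (a b z mu nu lam : C) (x : R) (n k : nat) (f g u v : R -> C).

(** The equation is a first-order system in u, theta u, A u and theta A u, with coefficients bounded
    on every (0, b]. *)
Lemma solv_unique mu nu lam u : solv mu nu lam u -> u 1 = 0 -> theta u 1 = 0 -> Aop mu u 1 = 0 -> theta (Aop mu u) 1 = 0 ->
  forall x, 0 < x -> u x = 0.
Proof.
move=> [u1 [u2 [A1 [A2 [h1 h2 h3 h4 h5]]]]] e0 e1 e2 e3 x x0.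
pose A x : C := u2 x + mu * u1 x - x%:C ^+ 2 * u x.
have one : 0 < 1 :> R by [].
have hA : hasD (Aop mu u) A1 by apply: hasD_ext h3 => // y y0; rewrite (AopE _ h1 h2).
rewrite (theta_hasD h1)// in e1; rewrite (theta_hasD hA)// in e3; rewrite (AopE _ h1 h2)// in e2.
pose v (i : nat) : R -> C := match i with 0 => u | 1 => u1 | 2 => A | _ => A1 end%N.
pose c := lam + (mu - nu) * (mu + nu + 2%:R) / 2%:R.
pose w3 x : C := - (mu + 2%:R * nu) * A1 x - nu * (mu + nu) * A x + x%:C ^+ 2 * A x + x%:C ^+ 2 * (c * u x).
have hw3 y : 0 < y -> A2 y = w3 y.
  move=> y0; have := h5 y y0; rewrite -/c -/(A y) /w3 => <-; ring.
pose w1 x : C := A x - mu * u1 x + x%:C ^+ 2 * u x.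
pose w (i : nat) : R -> C := match i with 0 => u1 | 1 => w1 | 2 => A1 | _ => w3 end%N.
have hD i : (i < 4)%N -> hasD (v i) (w i).
  move=> _; case: i => [|[|[|i]]].
  - exact: h1.
  - apply: hasD_ext h2 => [y _|y _]; [reflexivity|rewrite /w /w1 /A; ring].
  - exact: h3.
  - apply: (hasD_ext _ hw3 h4) => y _; reflexivity.
apply: (@linear_system_unique _ v w hD _ _ 0%N) => //; last by case=> [|[|[|[|//]]]].
move=> b b0.
pose L := 1 + cabs mu + b ^+ 2 + cabs (mu + 2%:R * nu) + cabs (nu * (mu + nu)) + b ^+ 2 * cabs c.
have cm : 0 <= cabs mu by exact: cabs_ge0.
have c1 : 0 <= cabs (mu + 2%:R * nu) by exact: cabs_ge0.
have c2 : 0 <= cabs (nu * (mu + nu)) by exact: cabs_ge0.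
have c3 : 0 <= cabs c by exact: cabs_ge0.
have b2 : 0 <= b ^+ 2 by exact: sqr_ge0.
have bc : 0 <= b ^+ 2 * cabs c by exact: mulr_ge0.
exists L; first by rewrite /L; lra.
move=> y i y0 yb i4; rewrite /sum4 /=.
have q : cabs (y%:C ^+ 2) <= b ^+ 2.
  by rewrite cabsX cabsR gtr0_norm// lerXn2r// nnegrE ltW.
have dB (p q1 : C) : cabs (p - q1) <= cabs p + cabs q1 by rewrite -(cabsN q1) cabsD.
have U0 : 0 <= cabs (u y) by exact: cabs_ge0.
have U1 : 0 <= cabs (u1 y) by exact: cabs_ge0.
have U2 : 0 <= cabs (A y) by exact: cabs_ge0.
have U3 : 0 <= cabs (A1 y) by exact: cabs_ge0.
have qm z : cabs (y%:C ^+ 2 * z) <= b ^+ 2 * cabs z by rewrite cabsM ler_wpM2r ?cabs_ge0.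
have LE (p : R) : 0 <= p -> p <= L -> forall r s, 0 <= r -> r <= s -> p * r <= L * s.
  by move=> p0 pL r s r0 rs; apply: ler_pM.
case: i i4 => [|[|[|i]]] _; rewrite /v /w.
- rewrite -[leLHS]mul1r; apply: LE => //; last by lra. by rewrite /L; lra.
- rewrite /w1; apply: le_trans (cabsD _ _) _; apply: le_trans (lerD (dB _ _) (qm _)) _.
  rewrite [cabs (mu * _)](cabsM mu) /L; nra.
- rewrite -[leLHS]mul1r; apply: LE => //; last by lra. by rewrite /L; lra.
- rewrite /w3; apply: le_trans (cabsD _ _) _; apply: le_trans (lerD (cabsD _ _) (qm _)) _.
  apply: le_trans (lerD (lerD (dB _ _) (qm _)) (lexx _)) _.
  rewrite (cabsM (- (mu + 2%:R * nu))) cabsN (cabsM (nu * (mu + nu))) (cabsM c) mulrA.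
  have M (p r s : R) : 0 <= p -> r <= s -> p * r <= p * s by move=> *; apply: ler_wpM2l.
  pose S := cabs (u y) + cabs (u1 y) + cabs (A y) + cabs (A1 y).
  have S0 : 0 <= S by rewrite /S; lra.
  have d1 : cabs (mu + 2%:R * nu) * cabs (A1 y) <= cabs (mu + 2%:R * nu) * S by apply: M => //; rewrite /S; lra.
  have d2 : cabs (nu * (mu + nu)) * cabs (A y) <= cabs (nu * (mu + nu)) * S by apply: M => //; rewrite /S; lra.
  have d3 : b ^+ 2 * cabs (A y) <= b ^+ 2 * S by apply: M => //; rewrite /S; lra.
  have d4 : b ^+ 2 * cabs c * cabs (u y) <= b ^+ 2 * cabs c * S by apply: M => //; rewrite /S; lra.
  have d5 := mulr_ge0 cm S0.
  apply: le_trans (lerD (lerD (lerD d1 d2) d3) d4) _; rewrite -!mulrDl; apply: (ler_wpM2r S0).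
  rewrite /L addrAC -!addrA; lra.
Qed.
End SolutionUniqueness.

(** * Behaviour at 0 and the fundamental system *)

Section Independence.
Variable R : realType.
Local Notation C := R[i].
Implicit Types (a b z mu nu lam : C) (x s e : R) (n k J : nat) (f g u v : R -> C).

Definition lim0 f e (L : C) := (fun x => wt e x * f x) @ 0^'+ --> L.

Lemma near_right_cvg f g (L : C) : (forall x, 0 < x -> f x = g x) -> f @ 0^'+ --> L -> g @ 0^'+ --> L.
Proof.
move=> fg h; apply: cvg_trans h; apply: near_eq_cvg.
by move: (near_right R); apply: filterS => x x0; rewrite fg.
Qed.

Lemma lim0_ext f g e L : (forall x, 0 < x -> f x = g x) -> lim0 f e L -> lim0 g e L.
Proof. by move=> fg; apply: near_right_cvg => x x0; rewrite fg. Qed.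

Lemma lim0_add f g e L L' : lim0 f e L -> lim0 g e L' -> lim0 (fun x => f x + g x) e (L + L').
Proof.
move=> h1 h2; have h : (fun x => wt e x * f x + wt e x * g x) @ 0^'+ --> L + L' by exact: (cvgCD h1 h2).
by apply: near_right_cvg h => x _; rewrite mulrDr.
Qed.

Lemma lim0_scl f e L a : lim0 f e L -> lim0 (fun x => a * f x) e (a * L).
Proof.
move=> h1; have hc : (fun _ : R => a) @ 0^'+ --> a by exact: cvgC_cst.
have h : (fun x => a * (wt e x * f x)) @ 0^'+ --> a * L by exact: (cvgCM hc h1).
by apply: near_right_cvg h => x _; rewrite mulrCA.
Qed.

Lemma lim0_weak f e e' L : e < e' -> lim0 f e L -> lim0 f e' 0.
Proof.
move=> ee h; have d0 : 0 < e' - e by rewrite subr_gt0.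
have h1 : (fun x => wt (e' - e) x * (wt e x * f x)) @ 0^'+ --> 0 * L by exact: (cvgCM (wt_cvg0 d0) h).
rewrite mul0r in h1; apply: near_right_cvg h1 => x x0.
by rewrite mulrA -wtD// subrK.
Qed.

Lemma lim0_sum (I : Type) (l : seq I) (f : I -> R -> C) e (L : I -> C) : (forall i, lim0 (f i) e (L i)) ->
  lim0 (fun x => \sum_(i <- l) f i x) e (\sum_(i <- l) L i).
Proof.
move=> h; have h1 : (fun x => \sum_(i <- l) wt e x * f i x) @ 0^'+ --> \sum_(i <- l) L i.
  exact: (@cvgC_sum _ _ _ _ _ l (fun i x => wt e x * f i x) L h).
by apply: near_right_cvg h1 => x _; rewrite big_distrr.
Qed.

Lemma wt_nat n x : 0 < x -> wt n%:R x = x%:C ^+ n / 2%:R ^+ n.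
Proof.
move=> x0; rewrite /wt powR_mulrn ?divr_ge0 ?ltW// exprMn rmorphM /= !rmorphXn /=.
by rewrite fmorphV rmorph_nat exprVn.
Qed.

Lemma lim0_gc a N n : lim0 (gc a N n) N%:R (if n is 0%N then hc a 0 / 2%:R ^+ N else 0).
Proof.
have E x : 0 < x -> (hc a n * 2%:R ^+ n / 2%:R ^+ N) * wt n%:R x = wt N%:R x * gc a N n x.
  move=> x0; rewrite !wt_nat// /gc cpowx_nat//.
  have x1 : x%:C ^+ N != 0 by rewrite expf_neq0// posC_neq0.
  have t1 k : 2%:R ^+ k != 0 :> C by rewrite expf_neq0// pnatr_eq0.
  move: (t1 n) (t1 N) x1; move: (x%:C ^+ N) (2%:R ^+ n) (2%:R ^+ N) (x%:C ^+ n) => p q r s q0 r0 p0.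
  by field; rewrite q0 r0 p0.
apply: near_right_cvg E _.
have hc0 : (fun _ : R => hc a n * 2%:R ^+ n / 2%:R ^+ N) @ 0^'+ --> hc a n * 2%:R ^+ n / 2%:R ^+ N by exact: cvgC_cst.
case: n hc0 => [|n] hc0.
  have {}hc0 : (fun _ : R => hc a 0 / 2%:R ^+ N) @ 0^'+ --> hc a 0 / 2%:R ^+ N by exact: cvgC_cst.
  by apply: near_right_cvg hc0 => x x0; rewrite [0%:R]mulr0n wt0 expr0 [in RHS]mulr1 mulr1.
have h : (fun x => hc a n.+1 * 2%:R ^+ n.+1 / 2%:R ^+ N * wt n.+1%:R x) @ 0^'+ --> hc a n.+1 * 2%:R ^+ n.+1 / 2%:R ^+ N * 0.
  by apply: (cvgCM hc0); apply: wt_cvg0; rewrite ltr0n.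
by rewrite mulr0 in h.
Qed.

(** Only the lowest term m = 0 of the first factor survives at weight N + s, and [rf_vdm] merges the
    exponent of 1 - t with the one from the second factor. *)
Lemma SX_lim mu nu a N phi s (c : C) J : Asy phi s c ->
  lim0 (SX mu nu N%:R (gc a N) phi 0 J) (N%:R + s) (hc a 0 / 2%:R ^+ N * (c * rf ((mu + nu + 2%:R) / 2%:R - N%:R - s%:C) J)).
Proof.
move=> hphi; set be := (mu + nu + 2%:R) / 2%:R - N%:R.
have hconv b n : lim0 (fun x => conv (phi^~ x) (rf b) n) s (c * rf (b - s%:C) n).
  have h := @lim0_sum _ (index_iota 0 n.+1) (fun i x => rf b (n - i)%N * phi i x) s (fun i => rf b (n - i)%N * (c * rf (- s%:C) i)) _.
  have {}h := h (fun i => lim0_scl (a := rf b (n - i)%N) (hphi i)).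
  have -> : c * rf (b - s%:C) n = \sum_(0 <= i < n.+1) rf b (n - i)%N * (c * rf (- s%:C) i).
    by rewrite [b - _]addrC -rf_vdm big_distrr; apply: eq_bigr => i _ /=; ring.
  by apply: lim0_ext h => x _; apply: eq_bigr => i _; rewrite mulrC.
have hm (m : nat) : lim0 (fun x => gc a N m x * conv (phi^~ x) (rf (m%:R + (be + 0%:R))) (J - m)%N) (N%:R + s)
    ((if m is 0%N then hc a 0 / 2%:R ^+ N else 0) * (c * rf (m%:R + (be + 0%:R) - s%:C) (J - m)%N)).
  have h : (fun x => (wt N%:R x * gc a N m x) * (wt s x * conv (phi^~ x) (rf (m%:R + (be + 0%:R))) (J - m)%N)) @ 0^'+ -->
    (if m is 0%N then hc a 0 / 2%:R ^+ N else 0) * (c * rf (m%:R + (be + 0%:R) - s%:C) (J - m)%N).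
    exact: (cvgCM (@lim0_gc a N m) (hconv (m%:R + (be + 0%:R)) (J - m)%N)).
  by apply: near_right_cvg h => x x0; rewrite wtD//; ring.
have h := @lim0_sum _ (index_iota 0 J.+1) _ _ _ hm.
have -> : hc a 0 / 2%:R ^+ N * (c * rf (be - s%:C) J) =
   \sum_(0 <= m < J.+1) (if m is 0%N then hc a 0 / 2%:R ^+ N else 0) * (c * rf (m%:R + (be + 0%:R) - s%:C) (J - m)%N).
  rewrite psumSl big1 ?addr0 ?subn0; last by move=> i _; rewrite mul0r.
  by rewrite add0r.
exact: h.
Qed.

(** Among the non-zero coefficients take the one with the largest exponent and multiply the relation
    by its weight: all other terms tend to 0. *)
Lemma lim0_indep (f : nat -> R -> C) (e : nat -> R) (L a : nat -> C) :
  (forall i, (1 <= i <= 4)%N -> lim0 (f i) (e i) (L i) /\ L i != 0) ->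
  (forall i k, (1 <= i <= 4)%N -> (1 <= k <= 4)%N -> e i = e k -> i = k) ->
  (forall x, 0 < x -> \sum_(1 <= i < 5) a i * f i x = 0) -> forall i, (1 <= i <= 4)%N -> a i = 0.
Proof.
move=> hL einj h0 i0 hi0; apply/eqP; apply: contraT => ai0.
pose P (i : 'I_4) := a i.+1 != 0.
have i04 : (i0.-1 < 4)%N by case: i0 hi0 {ai0}.
have Pi0 : P (Ordinal i04) by rewrite /P /= prednK//; case/andP: hi0.
have [i Pi imax] := @arg_maxP _ _ 'I_4 (Ordinal i04) P (fun i => e i.+1) Pi0.
have b (k : 'I_4) : (1 <= k.+1 <= 4)%N by rewrite ltnS leq0n /= ltn_ord.
have hk (k : 'I_4) : lim0 (fun x => a k.+1 * f k.+1 x) (e i.+1) (if k == i then a i.+1 * L i.+1 else 0).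
  have [->|ki] := eqVneq k i; first by apply: lim0_scl; case: (hL i.+1 (b i)).
  have [ak|ak] := eqVneq (a k.+1) 0.
    have hz : lim0 (fun=> 0) (e i.+1) 0.
      have hc0 : (fun _ : R => 0 : C) @ 0^'+ --> (0 : C) by exact: cvgC_cst.
      by apply: near_right_cvg hc0 => x _; rewrite mulr0.
    by apply: lim0_ext hz => x _; rewrite ak mul0r.
  have le : e k.+1 < e i.+1.
    have im : e k.+1 <= e i.+1 by exact: imax k ak.
    rewrite lt_neqAle im andbT; apply: contra_neq ki => ee.
    by apply: val_inj; have [] := einj k.+1 i.+1 (b k) (b i) ee.
  exact: lim0_weak le (lim0_scl (a := a k.+1) (proj1 (hL k.+1 (b k)))).
have := @lim0_sum _ (index_enum 'I_4) _ _ _ hk.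
rewrite -big_mkcond big_pred1_eq => hlim.
have hz : (fun _ : R => 0 : C) @ 0^'+ --> (0 : C) by exact: cvgC_cst.
have {}hlim : (fun _ : R => 0 : C) @ 0^'+ --> a i.+1 * L i.+1.
  apply: near_right_cvg hlim => x x0.
  by have := h0 x x0; rewrite big_add1 /= big_mkord => ->; rewrite mulr0.
have e0 : a i.+1 * L i.+1 = 0 by exact: (cvgC_unique hlim hz).
move/eqP : e0; rewrite mulf_eq0 (negbTE Pi) /=.
by have [_ /negbTE ->] := hL i.+1 (b i).
Qed.

Lemma rf_neq0 (b : C) n : (forall k : nat, b + k%:R != 0) -> rf b n != 0.
Proof.
move=> h; rewrite /rf mulf_neq0 ?invr_eq0 ?fact_neq0//.
by rewrite prodf_seq_neq0; apply/allP => k _; exact: h.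
Qed.

End Independence.

Arguments solv_scl {R mu nu lam u} a _.
Section FundamentalSystem.
Variable R : realType.
Local Notation C := R[i].
Implicit Types (b z mu nu lam : C) (x s e : R) (n k J : nat) (g u v : R -> C).

Lemma solv_hasD mu nu lam u : solv mu nu lam u ->
  [/\ hasD u (theta u), hasD (thetaS mu u) (theta (thetaS mu u)) & hasD (Aop mu u) (theta (Aop mu u))].
Proof.
move=> [u1 [u2 [A1 [A2 [h1 h2 h3 h4 h5]]]]].
have th f g : hasD f g -> hasD f (theta f).
  by move=> h; apply: hasD_ext (h) => // x x0; rewrite (theta_hasD h).
split; first exact: th h1.
- exact: (th _ _ (@hasD_thetaS R mu _ _ _ h1 h2)).
- by apply: (th _ A1); apply: hasD_ext h3 => // y y0; rewrite (AopE _ h1 h2).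
Qed.

Section Comb.
Variables (I : finType) (mu nu lam : C) (f : I -> R -> C) (w : I -> C).
Hypothesis hf : forall i, solv mu nu lam (f i).
Let F x := \sum_i w i * f i x.

Lemma solv_comb : solv mu nu lam F.
Proof.
rewrite /F; elim: (index_enum _) => [|i l IH].
  by apply: solv_ext (@solv_0 R mu nu lam) => x _; rewrite big_nil.
by apply: solv_ext (solv_add (solv_scl (w i) (hf i)) IH) => x _; rewrite big_cons.
Qed.

Let comb (p : I -> R -> C) (P : R -> C) : (forall i, hasD (p i) (theta (p i))) ->
  (forall x, 0 < x -> P x = \sum_i w i * p i x) -> forall x, 0 < x -> theta P x = \sum_i w i * theta (p i) x.
Proof.
move=> hp hP x x0; have h := hasD_sum (index_enum I) (fun i => hasDZ (w i) (hp i)).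
have h1 : hasD P (fun x => \sum_i w i * theta (p i) x) by apply: hasD_ext h => // y y0; rewrite hP.
exact: theta_hasD h1 x0.
Qed.

Lemma comb_theta x : 0 < x -> theta F x = \sum_i w i * theta (f i) x.
Proof. by apply: comb => // i; case: (solv_hasD (hf i)). Qed.

Lemma comb_Aop x : 0 < x -> Aop mu F x = \sum_i w i * Aop mu (f i) x.
Proof.
move=> x0; rewrite /Aop (@comb (fun i => thetaS mu (f i)))//.
- rewrite /F big_distrr -sumrB; apply: eq_bigr => i _ /=; ring.
- by move=> i; case: (solv_hasD (hf i)).
- move=> y y0; rewrite /thetaS comb_theta// /F big_distrr -big_split; apply: eq_bigr => i _ /=; ring.
Qed.

Lemma comb_thetaA x : 0 < x -> theta (Aop mu F) x = \sum_i w i * theta (Aop mu (f i)) x.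
Proof. by apply: comb; [move=> i; case: (solv_hasD (hf i))|exact: comb_Aop]. Qed.
End Comb.

Definition data mu u : 'rV[C]_4 := \row_(j < 4) match val j with
  | 0%N => u 1 | 1%N => theta u 1 | 2%N => Aop mu u 1 | _ => theta (Aop mu u) 1 end.

Lemma data_comb mu nu lam (I : finType) (f : I -> R -> C) (w : I -> C) : (forall i, solv mu nu lam (f i)) ->
  data mu (fun x => \sum_i w i * f i x) = \sum_i w i *: data mu (f i).
Proof.
move=> hf; apply/rowP => j; rewrite mxE summxE.
have -> : \sum_k (w k *: data mu (f k)) 0 j = \sum_k w k * (match val j with
  | 0%N => f k 1 | 1%N => theta (f k) 1 | 2%N => Aop mu (f k) 1 | _ => theta (Aop mu (f k)) 1 end).
  by apply: eq_bigr => k _; rewrite mxE mxE.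
case: j => -[|[|[|[|//]]]] j4 /=.
- by [].
- exact: comb_theta hf _ ltr01.
- exact: comb_Aop hf _ ltr01.
- exact: comb_thetaA hf _ ltr01.
Qed.

Lemma data_unique mu nu lam u : solv mu nu lam u -> data mu u = 0 -> forall x, 0 < x -> u x = 0.
Proof.
move=> hu /rowP h; apply: (solv_unique hu).
- by have := h (@Ordinal 4 0 isT); rewrite !mxE.
- by have := h (@Ordinal 4 1 isT); rewrite !mxE.
- by have := h (@Ordinal 4 2 isT); rewrite !mxE.
- by have := h (@Ordinal 4 3 isT); rewrite !mxE.
Qed.

(** Cauchy data determine a solution, so a linear relation between the data of the four functions is
    one between the functions. Their 4 x 4 data matrix is therefore invertible, and the data of any
    solution can be matched. *)
Lemma fundamental_of_indep mu nu lam (f : nat -> R -> C) :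
  (forall i, (1 <= i <= 4)%N -> solv mu nu lam (f i)) ->
  (forall a : nat -> C, (forall x : R, 0 < x -> \sum_(1 <= i < 5) a i * f i x = 0) ->
      forall i : nat, (1 <= i <= 4)%N -> a i = 0) ->
  fundamental_system mu nu lam f.
Proof.
move=> hs ind; split; last split.
- by move=> i hi; apply/solvP; exact: hs.
- exact: ind.
move=> u /solvP hu.
pose g (i : 'I_4) := f i.+1.
have hg i : solv mu nu lam (g i) by apply: hs; rewrite ltnS leq0n /= ltn_ord.
pose M : 'M[C]_4 := \matrix_(i, j) data mu (g i) 0 j.
have MV (w : 'rV[C]_4) : w *m M = \sum_(i < 4) w 0 i *: data mu (g i).
  apply/rowP => j; rewrite !mxE summxE; apply: eq_bigr => i _; by rewrite !mxE.
have sumE (a : nat -> C) x : \sum_(1 <= i < 5) a i * f i x = \sum_(i < 4) a i.+1 * g i x.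
  by rewrite big_add1 /= big_mkord.
have free : row_free M.
  rewrite -kermx_eq0; apply/eqP/row_matrixP => k; rewrite row0.
  set w := row k _.
  have wM : w *m M = 0 by rewrite -row_mul mulmx_ker row0.
  rewrite MV -(data_comb (w 0) hg) in wM.
  have hz := data_unique (solv_comb (w 0) hg) wM.
  pose a (i : nat) : C := if i is i'.+1 then (if insub i' is Some o then w 0 o else 0) else 0.
  have az := ind a _; apply/rowP => i; rewrite [RHS]mxE.
  have -> : w 0 i = a i.+1 by rewrite /a valK.
  apply: az; last by rewrite ltnS leq0n /= ltn_ord.
  by move=> x x0; rewrite sumE -[RHS](hz x x0); apply: eq_bigr => o _; rewrite /a valK.
have Mu : M \in unitmx by rewrite -row_free_unit.
pose c := data mu u *m invmx M.
have cM : data mu u = \sum_(i < 4) c 0 i *: data mu (g i) by rewrite -MV /c mulmxKV.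
pose a (i : nat) : C := if i is i'.+1 then (if insub i' is Some o then c 0 o else 0) else 0.
exists a => x x0; rewrite sumE.
have -> : \sum_(i < 4) a i.+1 * g i x = \sum_(i < 4) c 0 i * g i x by apply: eq_bigr => i _; rewrite /a valK.
pose g0 x := \sum_(i < 4) c 0 i * g i x.
(* The difference of u and the matching combination is written as a sum over [bool], so that
   [data_comb] and [solv_comb] apply to it. *)
pose p (b : bool) : R -> C := if b then u else g0.
pose q (b : bool) : C := if b then 1 else -1.
have hp (b : bool) : solv mu nu lam (p b) by case: b; [exact: hu|exact: (solv_comb (c 0) hg)].
have d0 : data mu (fun x => \sum_b q b * p b x) = 0.
  by rewrite (data_comb q hp) big_bool /= (data_comb (c 0) hg) -cM scale1r scaleN1r subrr.
have := data_unique (solv_comb q hp) d0 x0.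
by rewrite big_bool /= mul1r mulN1r => /eqP; rewrite subr_eq0 => /eqP.
Qed.

End FundamentalSystem.

Arguments lim0_scl {R f e L} a _.
Section MainTheorem.
Variable R : realType.
Local Notation C := R[i].
Implicit Types (b z mu nu lam : C) (x s e : R) (n k J N : nat) (g u v : R -> C) (F : C -> C) (phi : nat -> R -> C) (j : int).

(** Indices below -N carry the coefficient 0, which is a solution for every eigenvalue; this covers
    all integers j. *)
Lemma natco_solv mu nu (S : nat -> R -> C) N j : (forall J, solv mu nu (lambda mu nu (J%:Z - N%:Z)) (S J)) ->
  solv mu nu (lambda mu nu j) (fun x => natco (fun J => S J x) (j + N%:Z)).
Proof.
move=> h; case E : (j + N%:Z) => [J|J] /=; last exact: solv_0.
by have -> : j = J%:Z - N%:Z by rewrite -E addrK.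
Qed.

Lemma indicial0 mu n : (n%:R - 0%:R) * (n%:R - 0%:R + mu) = n%:R * (n%:R + 2%:R * (mu / 2%:R)).
Proof. by rewrite subr0 [2%:R * _]mulrC divfK// pnatr_eq0. Qed.

Lemma indicialN mu N n : mu = N%:R -> (n%:R - N%:R) * (n%:R - N%:R + mu) = n%:R * (n%:R + 2%:R * (- (mu / 2%:R))).
Proof. by move=> ->; rewrite mulrN [2%:R * _]mulrC divfK ?pnatr_eq0// subrK mulrC. Qed.

Lemma Lambda12_solv (i : nat) mu nu F phi j : AT F phi -> ODEr nu (phi 0%N) (fun=> 0) ->
  (forall t x, G i mu nu t x = Gpref mu nu t * Itil (mu / 2%:R) (t * x%:C / (1 - t)) * F (x%:C / (1 - t))) ->
  solv mu nu (lambda mu nu j) (Lambda i mu nu j).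
Proof.
move=> hF hode hG.
have h := @natco_solv mu nu (fun J => SX mu nu 0%:R (gc (mu / 2%:R) 0) phi 0 J) 0 j (fun J => SX_is_solv J (indicial0 mu) hF hode).
apply: solv_ext h => x x0.
by rewrite addr0 (Lambda12E j hF x0 (fun t => hG t x)).
Qed.

Lemma Lambda34_solv (i n : nat) mu nu F phi j : AT F phi -> ODEr nu (phi 0%N) (fun=> 0) -> mu = (2 * n + 1)%:R ->
  (forall t x, G i mu nu t x = Gpref mu nu t * Ktil (mu / 2%:R) (t * x%:C / (1 - t)) * F (x%:C / (1 - t))) ->
  solv mu nu (lambda mu nu j) (Lambda i mu nu j).
Proof.
move=> hF hode hmu hG.
have h1 := @natco_solv mu nu (fun J => SX mu nu 0%:R (gc (mu / 2%:R) 0) phi 0 J) 0 j (fun J => SX_is_solv J (indicial0 mu) hF hode).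
have h2 := @natco_solv mu nu (fun J => SX mu nu (2 * n + 1)%:R (gc (- (mu / 2%:R)) (2 * n + 1)) phi 0 J) (2 * n + 1) j
  (fun J => SX_is_solv J (fun m => indicialN m hmu) hF hode).
apply: solv_ext (solv_add (solv_scl (kap1 mu * 2%:R ^+ (2 * n + 1)) h2) (solv_scl (- kap1 mu) h1)) => x x0.
by rewrite addr0 (Lambda34E j hF x0 hmu (fun t => hG t x)).
Qed.

(* Lambda_(i,j) is equivalent to a multiple of x^(- exponent mu nu i) at 0+. *)
Definition exponent (p q : R) (i : nat) : R :=
  match i with 1%N => 0 | 2%N => q | 3%N => p + 0 | _ => p + q end.

Lemma exponent_inj (p q : R) : 0 < p -> 0 < q -> p <> q -> forall i k, (1 <= i <= 4)%N -> (1 <= k <= 4)%N ->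
  exponent p q i = exponent p q k -> i = k.
Proof.
move=> p0 q0 pq [|[|[|[|[|i]]]]] [|[|[|[|[|k]]]]] // _ _; rewrite /exponent => h;
  first [by exfalso; lra | by case: pq; lra].
Qed.

Section Asymptotics.
Variables (n : nat) (v : R).
Let mu : C := (2 * n + 1)%:R.
Hypothesis v0 : 0 < v.
Hypothesis hmv : ~ (exists k : int, mu - v%:C = (2 * k)%:~R).

Lemma lim_Lambda12 (i : nat) F phi s c (J : nat) : AT F phi -> Asy phi s c ->
  (forall t x, G i mu v%:C t x = Gpref mu v%:C t * Itil (mu / 2%:R) (t * x%:C / (1 - t)) * F (x%:C / (1 - t))) ->
  lim0 (Lambda i mu v%:C J%:Z) s (hc (mu / 2%:R) 0 / 2%:R ^+ 0 * (c * rf ((mu + v%:C + 2%:R) / 2%:R - 0%:R - s%:C) J)).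
Proof.
move=> hF hA hG; have h := @SX_lim R mu v%:C (mu / 2%:R) 0 phi s c J hA.
rewrite add0r in h; apply: lim0_ext h => x x0.
by rewrite (Lambda12E J%:Z hF x0 (fun t => hG t x)).
Qed.

(** The I_(-mu/2) part decides, since the other part has only exponent s. The coefficient of t^J has
    index J + mu once the pole is split off. *)
Lemma lim_Lambda34 (i : nat) F phi s c (J : nat) : AT F phi -> Asy phi s c ->
  (forall t x, G i mu v%:C t x = Gpref mu v%:C t * Ktil (mu / 2%:R) (t * x%:C / (1 - t)) * F (x%:C / (1 - t))) ->
  lim0 (Lambda i mu v%:C J%:Z) ((2 * n + 1)%:R + s) (kap1 mu * 2%:R ^+ (2 * n + 1) * (hc (- (mu / 2%:R)) 0 / 2%:R ^+ (2 * n + 1) *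
     (c * rf ((mu + v%:C + 2%:R) / 2%:R - (2 * n + 1)%:R - s%:C) (J + (2 * n + 1))))).
Proof.
move=> hF hA hG; set N := (2 * n + 1)%N.
have h1 := @SX_lim R mu v%:C (mu / 2%:R) 0 phi s c J hA; rewrite add0r in h1.
have h2 := @SX_lim R mu v%:C (- (mu / 2%:R)) N phi s c (J + N) hA.
have ss : s < N%:R + s by rewrite ltrDr ltr0n /N addn1.
have h := lim0_add (lim0_scl (kap1 mu * 2%:R ^+ N) h2) (lim0_scl (- kap1 mu) (lim0_weak ss h1)).
rewrite mulr0 addr0 in h; apply: lim0_ext h => x x0.
by rewrite (Lambda34E J%:Z hF x0 erefl (fun t => hG t x)) -PoszD.
Qed.

Lemma muR : mu / 2%:R = ((2 * n + 1)%:R / 2 : R)%:C.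
Proof. by rewrite /mu rmorphM /= fmorphV !rmorph_nat. Qed.

Lemma mu2_nonint : ~ (exists k : int, ((2 * n + 1)%:R / 2 : R)%:C = k%:~R :> C).
Proof. by rewrite -muR; exact: half_odd_nonint. Qed.

Lemma kap1_neq0 : kap1 mu != 0.
Proof.
rewrite /kap1 mulf_neq0// ?invr_eq0; last by rewrite muR csin_neq0//; exact: mu2_nonint.
by rewrite mulf_neq0 ?invr_eq0 ?pnatr_eq0// posC_neq0// pi_gt0.
Qed.

Lemma hcI_neq0 : hc (mu / 2%:R) 0 != 0.
Proof.
rewrite /hc /= /cI fact0 expr0 !divr1 addr0; apply: rgamma_neq0 => k.
rewrite muR -(rmorph1 (real_complex R)) -rmorphD -(rmorphMn (real_complex R)) -rmorphN.
rewrite (inj_eq (@complexI R)) gt_eqF// (@le_lt_trans _ _ 0)// ?oppr_le0//.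
Qed.

Lemma hcK_neq0 : hc (- (mu / 2%:R)) 0 != 0.
Proof.
rewrite /hc /= /cI fact0 expr0 !divr1 addr0 muR; apply: rgamma_nonint; exact: mu2_nonint.
Qed.

(** A vanishing factor means b = -k, so 2 b is an even integer and mu - nu would be one too. *)
Lemma rf_neq0_of_noneven (b : C) J : (exists (m : int) (eps : bool), 2%:R * b = (if eps then mu - v%:C else - (mu - v%:C)) + (2 * m)%:~R) ->
  rf b J != 0.
Proof.
move=> [m [eps hb]]; apply: rf_neq0 => k; apply/eqP => e.
have e2 : 2%:R * b = - (2 * k%:Z)%:~R :> C.
  have -> : b = - k%:R by apply/eqP; rewrite -addr_eq0 e.
  by rewrite intrM -pmulrn mulrN.
rewrite e2 in hb; apply: hmv; case: eps hb => hb.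
  by exists (- k%:Z - m); rewrite mulrBr mulrN intrB intrN hb addrK.
have hk : (2 * k%:Z)%:~R = (mu - v%:C) - (2 * m)%:~R :> C by rewrite -[LHS]opprK hb opprD opprK.
by exists (m + k%:Z); rewrite mulrDr intrD hk [RHS]addrC subrK.
Qed.

Lemma fundamental_Lambda (J : nat) : fundamental_system mu v%:C (lambda mu v%:C J%:Z) (fun i => Lambda i mu v%:C J%:Z).
Proof.
have [pI [aI oI lI]] := Itil_side v%:C; have [pK [aK oK lK]] := Ktil_side v%:C.
have [cI0 cI1 LI] := lI v v0 erefl; have [cK0 cK1 LK] := lK v v0 erefl.
have s1 := @Lambda12_solv 1 mu v%:C _ _ J%:Z aI oI (fun t x => erefl).
have s2 := @Lambda12_solv 2 mu v%:C _ _ J%:Z aK oK (fun t x => erefl).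
have s3 := @Lambda34_solv 3 n mu v%:C _ _ J%:Z aI oI erefl (fun t x => erefl).
have s4 := @Lambda34_solv 4 n mu v%:C _ _ J%:Z aK oK erefl (fun t x => erefl).
apply: fundamental_of_indep.
  by case=> [|[|[|[|[|//]]]]].
have l1 := @lim_Lambda12 1 _ _ _ _ J aI LI (fun t x => erefl).
have l2 := @lim_Lambda12 2 _ _ _ _ J aK LK (fun t x => erefl).
have l3 := @lim_Lambda34 3 _ _ _ _ J aI LI (fun t x => erefl).
have l4 := @lim_Lambda34 4 _ _ _ _ J aK LK (fun t x => erefl).
set L1 := (X in lim0 _ _ X) in l1; set L2 := (X in lim0 _ _ X) in l2.
set L3 := (X in lim0 _ _ X) in l3; set L4 := (X in lim0 _ _ X) in l4.
have t0 k : (2%:R : C) ^+ k != 0 by rewrite expf_neq0// pnatr_eq0.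
have n0 : (2%:R : C) != 0 by rewrite pnatr_eq0.
have iv k : ((2%:R : C) ^+ k)^-1 != 0 by rewrite invr_eq0.
have kN := mulf_neq0 kap1_neq0 (t0 (2 * n + 1)%N).
have z1 : (2 * (2 * n + 2)%N%:Z)%:~R = 4%:R * n%:R + 4%:R :> C.
  by rewrite -(PoszM 2) -pmulrn natrM natrD natrM; ring.
have z2 : (2 * - (2 * n)%N%:Z)%:~R = - (4%:R * n%:R) :> C.
  by rewrite mulrN intrN -(PoszM 2) -pmulrn natrM natrM; ring.
have z3 : (2 * 1)%:~R = 2%:R :> C by [].
have rC0 : (0 : R)%:C = 0 :> C by [].
(* The four values of 2 b are mu + nu + 2, mu - nu + 2, nu - mu + 2 and 2 - mu - nu. Because 2 mu =
   4 n + 2, the first is -(mu - nu) + 2 (2 n + 2) and the last is (mu - nu) - 4 n. *)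
have L10 : L1 != 0.
  apply: (mulf_neq0 (mulf_neq0 hcI_neq0 (iv _)) (mulf_neq0 cI1 (rf_neq0_of_noneven _ _))).
  by exists (2 * n + 2)%N%:Z, false; rewrite z1 rC0 /mu natrD natrM; field.
have L20 : L2 != 0.
  apply: (mulf_neq0 (mulf_neq0 hcI_neq0 (iv _)) (mulf_neq0 cK1 (rf_neq0_of_noneven _ _))).
  by exists 1, true; rewrite z3; field.
have L30 : L3 != 0.
  apply: (mulf_neq0 kN (mulf_neq0 (mulf_neq0 hcK_neq0 (iv _)) (mulf_neq0 cI1 (rf_neq0_of_noneven _ _)))).
  by exists 1, false; rewrite z3 rC0 /mu; field.
have L40 : L4 != 0.
  apply: (mulf_neq0 kN (mulf_neq0 (mulf_neq0 hcK_neq0 (iv _)) (mulf_neq0 cK1 (rf_neq0_of_noneven _ _)))).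
  by exists (- (2 * n)%N%:Z), true; rewrite z2 /mu natrD natrM; field.
pose e := exponent (2 * n + 1)%:R v.
pose L (i : nat) : C := match i with 1%N => L1 | 2%N => L2 | 3%N => L3 | _ => L4 end.
move=> a; apply: (@lim0_indep R _ e L).
  move=> [|[|[|[|[|i]]]]] i4; try by exfalso.
  - exact: (conj l1 L10).
  - exact: (conj l2 L20).
  - exact: (conj l3 L30).
  - exact: (conj l4 L40).
have nv : (2 * n + 1)%:R <> v.
  by move=> nv; apply: hmv; exists 0; rewrite mulr0 /mu -nv rmorph_nat subrr.
have np : 0 < (2 * n + 1)%:R :> R by rewrite ltr0n addn1.
exact: exponent_inj np v0 nv.
Qed.

End Asymptotics.

End MainTheorem.

Theorem theorem4p5 (R : realType) :
  (* (a), i in {1,2}: all mu, nu in C, all j in Z *)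
  (forall (mu nu : R[i]) (i : nat) (j : int), (i = 1 \/ i = 2)%N ->
     is_solution mu nu (lambda mu nu j) (Lambda i mu nu j)) /\
  (* (a), i in {3,4}: mu a positive odd integer, nu in C, all j in Z *)
  (forall (mu nu : R[i]) (i : nat) (j : int),
     (exists m : nat, mu = (2 * m + 1)%:R) -> (i = 3 \/ i = 4)%N ->
     is_solution mu nu (lambda mu nu j) (Lambda i mu nu j)) /\
  (* (b) *)
  (forall (mu : R[i]) (nu : R) (j : nat),
     (exists m : nat, mu = (2 * m + 1)%:R) -> 0 < nu ->
     ~ (exists k : int, mu - nu%:C = (2 * k)%:~R) ->
     fundamental_system mu nu%:C (lambda mu nu%:C j%:Z)
       (fun i => Lambda i mu nu%:C j%:Z)).
Proof.
split; last split.
- move=> mu nu i j [->|->]; apply/solvP.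
    have [phi [hA hO _]] := Itil_side nu; exact: (@Lambda12_solv R 1 mu nu _ phi j hA hO (fun t x => erefl)).
  have [phi [hA hO _]] := Ktil_side nu; exact: (@Lambda12_solv R 2 mu nu _ phi j hA hO (fun t x => erefl)).
- move=> mu nu i j [m hm] [->|->]; apply/solvP.
    have [phi [hA hO _]] := Itil_side nu; exact: (@Lambda34_solv R 3 m mu nu _ phi j hA hO hm (fun t x => erefl)).
  have [phi [hA hO _]] := Ktil_side nu; exact: (@Lambda34_solv R 4 m mu nu _ phi j hA hO hm (fun t x => erefl)).
- by move=> mu nu j [m ->] nu0 h; exact: fundamental_Lambda nu0 h j.
Qed.
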